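(* Let $\delta\in(0,1)$ and let $g:[0,\infty)\to[0,\infty)$ be a non-decreasing function. Suppose that $(X_t)_{t\in\mathbb{Z}}$ is a strictly stationary sequence of random variables with $\mathbb{E}X_0=0$, $\mathbb{E}X_0^2<\infty$, $\sigma_n\to\infty$ as $n\to\infty$ and $\rho(n)\to 0$ as $n\to\infty$. Let $h_\delta$ and $h_d$ be the functions defined in the context (for any fixed admissible choice of $\varepsilon_1,\varepsilon_2,\bar c_2,q_0,k_0$). Suppose that $$\mathbb{E}\big[X_0^2\, g(|X_0|)\big]<\infty$$ and $$ g\Big(n^{1/2}\big(h_\delta(n)\,h_d(n)^{(2+\delta)/4}\big)^{-1/\delta}\Big)\gg h_d(n).$$ Then $S_n/\sigma_n$ converges in distribution to the standard normal law $N(0,1)$ as $n\to\infty$.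
   Context: Notation: $\log$ is the logarithm to base $2$; $\exp$ is the natural exponential; $[y]$ is the integer part of a real $y$. For sequences, $a_n\ll b_n$ (equivalently $b_n\gg a_n$) means $a_n=O(b_n)$ as $n\to\infty$. Slowly varying is meant in the usual (Karamata) sense as $n\to\infty$. For a strictly stationary sequence $(X_t)_{t\in\mathbb{Z}}$ on a probability space, $S_n=\sum_{i=1}^n X_i$, $\sigma_n^2=\mathrm{var}(S_n)$ ($\sigma_n\ge 0$), $\mathcal{F}_m^n$ is the $\sigma$-field generated by $(X_t)_{m\le t\le n}$ for $-\infty\le m\le n\le\infty$, and the mixing coefficient is $$\rho(n)=\sup\{|\mathrm{corr}(f,h)|: f\in L_2(\mathcal{F}_{-\infty}^0),\ h\in L_2(\mathcal{F}_n^\infty)\}.$$ Fix $0<\varepsilon_1<\varepsilon_2<1$. Set $$\underline{h}(n)=\bar c_2\exp\Big(-\sum_{i=1}^{[(1-\varepsilon_1)\log n]}\rho(2^i)/(1-\varepsilon_2)\Big),$$ where $\bar c_2>0$ is a constant (depending on the sequence and on $\varepsilon_1,\varepsilon_2$) such that $\sigma_n^2\ge n\,\underline{h}(n)$ for every $n\ge1$; such a constant exists by a known lemma of Peligrad. Let $q_0$ be an arbitrary (positive) non-increasing slowly varying function with $\sum_{i=1}^\infty q_0^{1/2}(2^i)<\infty$. Put $\underline{\ell}(n)=\underline{h}(n)^4q_0(n)$ (a non-increasing slowly varying function) and $2_\ast^i=[2^i\,\underline{\ell}(2^i)]$. Let $k_0$ be a positive integer such that $\rho(2_\ast^k)<1$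 for all $k\ge k_0$. Define $$h_\delta(n)=\exp\Big(5\sum_{i=1}^{[\log n]}\rho(2^i)^{2/(2+\delta)}\Big),\quad n\ge1,$$ $$h_d(n)=\exp\Big(-2\sum_{i=k_0}^{[\log n]}\log\{1-\rho(2_\ast^i)\}\Big),\quad n\ge 2^{k_0}.$$ *)

(* Defs.v *)
From HB Require Import structures.
From mathcomp Require Import all_boot all_order all_algebra.
From mathcomp Require Import all_classical all_reals all_analysis measurable_realfun.

Set Implicit Arguments.
Unset Strict Implicit.
Unset Printing Implicit Defensive.

Import Order.TTheory GRing.Theory Num.Theory.
Import numFieldNormedType.Exports.

Local Open Scope classical_set_scope.
Local Open Scope ring_scope.

Section probability_notions.
Context {d : measure_display} {T : measurableType d} {R : realType}.
Variable P : probability T R.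

(* Equality of the finite-dimensional distributions, on the Borel sets of R^n
   (the product sigma-algebra on n.-tuple R). *)
Definition strictly_stationary (X : int -> {RV P >-> R}) : Prop :=
  forall (n : nat) (t : n.-tuple int) (s : int) (B : set (n.-tuple R)),
    measurable B ->
    P [set w | B [tuple X (tnth t i + s) w | i < n]] =
    P [set w | B [tuple X (tnth t i) w | i < n]].

(* If f or h is degenerate, the denominator is 0 and corr f h = 0. *)
Definition corr (f h : T -> R) : R :=
  fine (covariance P f h) / Num.sqrt (fine 'V_P[f] * fine 'V_P[h]).

(* The sigma-field generated by the X t, t \in I. *)
Definition sigma_field (X : int -> {RV P >-> R}) (I : set int) : set (set T) :=
  <<s \bigcup_(t in I) g_sigma_algebra_preimage (X t) >>.

Definition L2_sub (F : set (set T)) : set (T -> R) :=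
  [set f | f \in Lfun P 2%:E /\
           measurable_fun [set: g_sigma_algebraType F]
             (f : g_sigma_algebraType F -> R)].

(* The set is nonempty and bounded by 1 (Cauchy-Schwarz), so sup is a genuine
   supremum. *)
Definition rho (X : int -> {RV P >-> R}) (n : nat) : R :=
  sup [set r : R | exists f h : T -> R,
    [/\ L2_sub (sigma_field X [set t | t <= 0]) f,
        L2_sub (sigma_field X [set t | n%:Z <= t]) h &
        r = `|corr f h|]].

Definition partial_sum (X : int -> {RV P >-> R}) (n : nat) : {RV P >-> R} :=
  \sum_(1 <= i < n.+1) (X i%:Z : {mfun T >-> R}).

Definition sigma (X : int -> {RV P >-> R}) (n : nat) : R :=
  Num.sqrt (fine 'V_P[partial_sum X n]).

Definition normalized_sum (X : int -> {RV P >-> R}) (n : nat) : {RV P >-> R} :=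
  (sigma X n)^-1 \o* partial_sum X n.

(* Convergence of the distribution functions at the continuity points of the
   limit. *)
Definition cvg_in_distribution (Y : nat -> {RV P >-> R})
    (mu : set R -> \bar R) : Prop :=
  forall x : R, {for x, continuous (fun y : R => mu `]-oo, y]%classic)} ->
    cdf (Y n) x @[n --> \oo] --> mu `]-oo, x]%classic.

End probability_notions.

Section real_functions.
Context {R : realType}.

Definition log2 (x : R) : R := ln x / ln 2.

(* Karamata's definition for a sequence; truncn is the integer part on
   nonnegative reals. *)
Definition slowly_varying (q : nat -> R) : Prop :=
  forall lam : R, 0 < lam ->
    q (Num.truncn (lam * n%:R)) / q n @[n --> \oo] --> (1 : R).

Definition admissible_q0 (q0 : nat -> R) : Prop :=
  [/\ forall n, (0 < n)%N -> 0 < q0 n,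
      forall m n, (0 < m)%N -> (m <= n)%N -> q0 n <= q0 m,
      slowly_varying q0 &
      cvgn (fun n => \sum_(1 <= i < n.+1) Num.sqrt (q0 (2 ^ i)%N))].

End real_functions.

(* r stands for the sequence of mixing coefficients rho(n). *)
Section auxiliary_functions.
Context {R : realType}.
Variable r : nat -> R.

Definition lower_h (eps1 eps2 c2 : R) (n : nat) : R :=
  c2 * expR (- \sum_(1 <= i < (Num.truncn ((1 - eps1) * log2 n%:R)).+1)
                 r (2 ^ i)%N / (1 - eps2)).

Definition lower_l (eps1 eps2 c2 : R) (q0 : nat -> R) (n : nat) : R :=
  lower_h eps1 eps2 c2 n ^+ 4 * q0 n.

Definition two_star (eps1 eps2 c2 : R) (q0 : nat -> R) (i : nat) : nat :=
  Num.truncn ((2 ^ i)%N%:R * lower_l eps1 eps2 c2 q0 (2 ^ i)%N).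

Definition h_delta (delta : R) (n : nat) : R :=
  expR (5 * \sum_(1 <= i < (Num.truncn (log2 (n%:R : R))).+1)
              r (2 ^ i)%N `^ (2 / (2 + delta))).

(* The inner logarithm is to base 2 as well, while the exponential is natural.
   For n < 2 ^ k0 the sum is empty and h_d is 1; only large n matter. *)
Definition h_d (eps1 eps2 c2 : R) (q0 : nat -> R) (k0 n : nat) : R :=
  expR (- 2 * \sum_(k0 <= i < (Num.truncn (log2 (n%:R : R))).+1)
                log2 (1 - r (two_star eps1 eps2 c2 q0 i))).

End auxiliary_functions.

(* Main.v *)
(* A doubling argument drives everything.  Let y_j be the standard deviation of a sum
   over 2^j consecutive terms.  Splitting 2^(j+1) terms into two blocks separated by
   2^(3j/4) terms, the correlation of the blocks is at most rho(2^(3j/4)), so that y_j^2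
   is 2^j up to factors exp(C sum rho(2^i)), and h_d absorbs these factors.

   Uniform integrability of (S_(2^r) / y_r)^2.  Truncate X at the level in the argument of
   g.  Since g >> h_d there, the moment hypothesis makes the sum of the upper parts
   negligible in L^2.  The moment of order q = 2 + delta / 2 of the sum of the lower parts
   satisfies a doubling inequality whose mixing error is rho^(2/q); its product is of
   smaller order than h_delta, which bounds the moment by y_r^q.

   Central limit theorem.  Split S_n into boundedly many blocks of length L = 2^j
   separated by gaps of length 2^(j/4), and swap the blocks one by one against a decrease
   of the variance parameter t^2 of the test function y |-> Phi((a - y) / t), a solution
   of the heat equation.  The errors are a Lindeberg term, controlled by uniform
   integrability, and rho(gap) times the number of blocks, which tends to 0.  At the end t
   is a small eps, and the test function is within eps of an indicator. *)

(* A budget of exponents fixes the constants. For a centred function of X, the variance of a block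
   of length 2^r is at most 2^r exp(S) times that of one term, while y_r^2 is at least 2^r
   exp(-(21/20) S), up to constants, where S is the sum of the rho(2^(3i/4)), about 4/3 of the sum
   of the rho(2^i) at most. The quotient costs the exponent 41/15 on the latter sum; [h_d] supplies
   2 / ln 2 > 14/5, because rho at [two_star] dominates rho(2^i) for large i. The gaps 2^(3i/4) are
   a compromise: shorter ones make S larger, longer ones cease to be negligible against the a priori
   bound y_r >= c 2^(23r/48), a weak form of the lower bound by [lower_h]. For the moments, q is
   less than 2 + delta, so that rho^(2/q) = o(rho^(2/(2+delta))) and constant factors in the
   exponent do no harm. Since the truncation level moves with r, the constants of the recursions
   must be uniform in the truncated function: hence the many statements of the form
   [exists C, ... forall h]. *)
Require Import Defs.
From HB Require Import structures.
From mathcomp Require Import all_boot all_order all_algebra.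
From mathcomp Require Import all_classical all_reals all_analysis.
From mathcomp Require Import measurable_realfun ring lra zify.

Set Implicit Arguments.
Unset Strict Implicit.
Unset Printing Implicit Defensive.

Import Order.TTheory GRing.Theory Num.Theory.
Import numFieldNormedType.Exports.

Local Open Scope classical_set_scope.
Local Open Scope ring_scope.

(** * Square-integrable functions *)

(* Locked to keep unification from unfolding integrals. *)
HB.lock Definition Ex {d : measure_display} {T : measurableType d} {R : realType}
  (P : probability T R) (f : T -> R) : R := \int[P]_x f x.

Section expectation.
Context {d : measure_display} {T : measurableType d} {R : realType}.
Variable P : probability T R.
Implicit Types f g : T -> R.
Local Notation Ex := (Ex P).

Definition ibl f : Prop := P.-integrable [set: T] (EFin \o f).

Lemma ibl_meas f : ibl f -> measurable_fun [set: T] f.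
Proof. by move=> /integrableP[/measurable_EFinP]. Qed.

Lemma ibl_le f g : measurable_fun [set: T] f -> (forall x, `|f x| <= g x) ->
  ibl g -> ibl f.
Proof.
move=> mf fg ig; apply: (@le_integrable _ _ _ _ _ _ _ (EFin \o g)) => //.
  exact/measurable_EFinP.
by move=> x _ /=; rewrite lee_fin (le_trans (fg x))// ler_norm.
Qed.

Lemma ibl_cst (c : R) : ibl (fun=> c).
Proof. exact: finite_measure_integrable_cst. Qed.

Lemma ibl_bounded f (M : R) : measurable_fun [set: T] f ->
  (forall x, `|f x| <= M) -> ibl f.
Proof. by move=> mf fM; apply: (ibl_le mf fM); exact: ibl_cst. Qed.

Lemma iblD f g : ibl f -> ibl g -> ibl (fun x => f x + g x).
Proof. by move=> fi gi; exact: (integrableD measurableT fi gi). Qed.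

Lemma iblB f g : ibl f -> ibl g -> ibl (fun x => f x - g x).
Proof. by move=> fi gi; exact: (integrableB measurableT fi gi). Qed.

Lemma iblZ (c : R) f : ibl f -> ibl (fun x => c * f x).
Proof. by move=> fi; exact: (integrableZl measurableT c fi). Qed.

Lemma ExD f g : ibl f -> ibl g -> Ex (fun x => f x + g x) = Ex f + Ex g.
Proof. by move=> ? ?; rewrite !Ex.unlock; apply: RintegralD. Qed.

Lemma ExB f g : ibl f -> ibl g -> Ex (fun x => f x - g x) = Ex f - Ex g.
Proof. by move=> ? ?; rewrite !Ex.unlock; apply: RintegralB. Qed.

Lemma ExZ (c : R) f : ibl f -> Ex (fun x => c * f x) = c * Ex f.
Proof. by move=> ?; rewrite !Ex.unlock; apply: RintegralZl. Qed.

Lemma Ex_cst (c : R) : Ex (fun=> c) = c.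
Proof.
by rewrite Ex.unlock /Rintegral integral_cst// [X in (_ * X)%E]probability_setT mule1.
Qed.

Lemma le_Ex f g : ibl f -> ibl g -> (forall x, f x <= g x) -> Ex f <= Ex g.
Proof. by move=> ? ? fg; rewrite !Ex.unlock; apply: le_Rintegral. Qed.

Lemma Ex_ge0 f : (forall x, 0 <= f x) -> 0 <= Ex f.
Proof. by move=> ?; rewrite Ex.unlock; apply: Rintegral_ge0. Qed.

Lemma normr_Ex f : ibl f -> `|Ex f| <= Ex (fun x => `|f x|).
Proof. by move=> ?; rewrite !Ex.unlock; apply: le_normr_Rintegral. Qed.

Lemma ibl_norm f : ibl f -> ibl (fun x => `|f x|).
Proof. exact: integrable_norm. Qed.

Lemma Ex_le_norm f g : ibl f -> ibl g -> (forall x, `|f x| <= g x) ->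
  `|Ex f| <= Ex g.
Proof.
move=> fi gi fg; apply: (le_trans (normr_Ex fi)); apply: le_Ex => //.
exact: ibl_norm.
Qed.

Lemma eq_Ex f g : f =1 g -> Ex f = Ex g.
Proof. by move=> /funext ->. Qed.

Definition sqi f : Prop :=
  measurable_fun [set: T] f /\ ibl (fun x => f x ^+ 2).
Definition N2 f : R := Num.sqrt (Ex (fun x => f x ^+ 2)).

Lemma sqi_meas f : sqi f -> measurable_fun [set: T] f. Proof. by case. Qed.

Lemma sqi_bounded f (M : R) : measurable_fun [set: T] f ->
  (forall x, `|f x| <= M) -> sqi f.
Proof.
move=> mf fM; split => //; apply: (@ibl_bounded _ (M ^+ 2)).
  exact: measurable_funX.
move=> x; rewrite normrX ler_sqr ?nnegrE ?normr_ge0//.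
exact: le_trans (normr_ge0 _) (fM x).
Qed.

Lemma sqiD f g : sqi f -> sqi g -> sqi (fun x => f x + g x).
Proof.
move=> [mf fi] [mg gi]; split; first exact: measurable_funD.
apply: (@ibl_le _ (fun x => 2 * f x ^+ 2 + 2 * g x ^+ 2)).
- by apply: measurable_funX; exact: measurable_funD.
- move=> x; rewrite ger0_norm ?sqr_ge0//.
  have := sqr_ge0 (f x - g x); nra.
- by apply: iblD; apply: iblZ.
Qed.

Lemma sqiZ (c : R) f : sqi f -> sqi (fun x => c * f x).
Proof.
move=> [mf fi]; split; first exact: measurable_funM.
by under eq_fun do rewrite exprMn; exact: iblZ.
Qed.

Lemma sqiB f g : sqi f -> sqi g -> sqi (fun x => f x - g x).
Proof.
move=> fi gi.
have := sqiD fi (sqiZ (-1) gi).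
by under eq_fun do rewrite mulN1r.
Qed.

Lemma sqi_cst (c : R) : sqi (fun=> c).
Proof. by split => //; exact: ibl_cst. Qed.

Lemma sqiM f g : sqi f -> sqi g -> ibl (fun x => f x * g x).
Proof.
move=> [mf fi] [mg gi].
apply: (@ibl_le _ (fun x => f x ^+ 2 + g x ^+ 2)).
- exact: measurable_funM.
- move=> x; rewrite normrM -(real_normK (num_real (f x))).
  rewrite -(real_normK (num_real (g x))).
  have := sqr_ge0 (`|f x| - `|g x|).
  have := normr_ge0 (f x); have := normr_ge0 (g x); nra.
- exact: iblD.
Qed.

Lemma sqi_ibl f : sqi f -> ibl f.
Proof. by move=> /(sqiM (sqi_cst 1)); under eq_fun do rewrite mul1r. Qed.

Lemma sqi_le f g : measurable_fun [set: T] f -> (forall x, `|f x| <= `|g x|) ->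
  sqi g -> sqi f.
Proof.
move=> mf fg [mg gi]; split => //.
apply: (ibl_le _ _ gi); first exact: measurable_funX.
by move=> x; rewrite normrX -(real_normK (num_real (g x))) ler_sqr ?nnegrE.
Qed.

Lemma N2_ge0 f : 0 <= N2 f. Proof. exact: sqrtr_ge0. Qed.

Lemma N2_sqr f : N2 f ^+ 2 = Ex (fun x => f x ^+ 2).
Proof. by rewrite sqr_sqrtr//; apply: Ex_ge0 => x; exact: sqr_ge0. Qed.

Lemma N2Z (c : R) f : sqi f -> N2 (fun x => c * f x) = `|c| * N2 f.
Proof.
move=> [mf fi]; rewrite /N2; under eq_fun do rewrite exprMn.
by rewrite ExZ// sqrtrM ?sqr_ge0// sqrtr_sqr.
Qed.

Lemma N2N f : N2 (fun x => - f x) = N2 f.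
Proof. by rewrite /N2; under eq_fun do rewrite sqrrN. Qed.

(** The discriminant criterion, stated for reals so that [N2_CS] only has to expand a square. If B =
    0 and C is not 0, the affine function takes the value -1 at -(A + 1) / (2C). *)
Lemma ge0_quadratic (A B C : R) : 0 <= B ->
  (forall t, 0 <= A + t * (2 * C) + t ^+ 2 * B) -> C ^+ 2 <= A * B.
Proof.
rewrite le_eqVlt => /predU1P[<-|B0] h.
  have [->|C0] := eqVneq C 0; first by rewrite expr0n mulr0.
  have := h (- (A + 1) / (2 * C)).
  rewrite mulr0 addr0 divfK ?mulf_neq0// ?pnatr_eq0//; lra.
have := h (- C / B).
have -> : A + - C / B * (2 * C) + (- C / B) ^+ 2 * B = A - C ^+ 2 / B.
  by field; rewrite gt_eqF.
by rewrite subr_ge0 ler_pdivrMr.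
Qed.

Lemma N2_sqrD f g : sqi f -> sqi g -> N2 (fun x => f x + g x) ^+ 2 =
  N2 f ^+ 2 + N2 g ^+ 2 + 2 * Ex (fun x => f x * g x).
Proof.
move=> sf sg; rewrite !N2_sqr.
have [_ fi] := sf; have [_ gi] := sg; have fg := sqiM sf sg.
rewrite -ExZ// -ExD// -ExD//.
- by apply: eq_Ex => x; ring.
- exact: iblD.
- exact: iblZ.
Qed.

Lemma N2_CS f g : sqi f -> sqi g -> `|Ex (fun x => f x * g x)| <= N2 f * N2 g.
Proof.
move=> sf sg; rewrite -ler_sqr ?nnegrE ?mulr_ge0 ?N2_ge0//.
rewrite real_normK ?num_real// exprMn !N2_sqr.
apply: ge0_quadratic; first by apply: Ex_ge0 => x; exact: sqr_ge0.
move=> t; have [_ fi] := sf; have [_ gi] := sg; have fg := sqiM sf sg.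
have := N2_sqrD sf (sqiZ t sg); rewrite N2Z// exprMn real_normK ?num_real//.
under [X in 2 * Ex X]eq_fun do rewrite mulrCA.
rewrite ExZ// (N2_sqr f) (N2_sqr g) => h; suff <- : N2 (fun x => f x + t * g x) ^+ 2 =
   Ex (fun x => f x ^+ 2) + t * (2 * Ex (fun x => f x * g x)) +
   t ^+ 2 * Ex (fun x => g x ^+ 2) by exact: sqr_ge0.
by rewrite h; ring.
Qed.

Lemma N2D f g : sqi f -> sqi g -> N2 (fun x => f x + g x) <= N2 f + N2 g.
Proof.
move=> sf sg; rewrite -ler_sqr ?nnegrE ?addr_ge0 ?N2_ge0//.
rewrite N2_sqrD// sqrrD -mulr_natl.
have := le_trans (ler_norm _) (N2_CS sf sg); lra.
Qed.

Lemma N2B f g : sqi f -> sqi g -> N2 (fun x => f x - g x) <= N2 f + N2 g.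
Proof.
move=> sf sg; rewrite -[N2 g]N2N; apply: (@N2D _ (fun x => - g x)) => //.
by have := sqiZ (-1) sg; under eq_fun do rewrite mulN1r.
Qed.

Lemma N2_dist f g : sqi f -> sqi g -> `|N2 f - N2 g| <= N2 (fun x => f x - g x).
Proof.
move=> sf sg; rewrite ler_norml; apply/andP; split.
  rewrite lerBrDr addrC lerBlDr.
  have := N2B sf (sqiB sf sg); under eq_fun do rewrite subKr; lra.
rewrite lerBlDr.
by have := N2D (sqiB sf sg) sg; under eq_fun do rewrite subrK.
Qed.

Lemma Ex_norm_le_N2 f : sqi f -> Ex (fun x => `|f x|) <= N2 f.
Proof.
move=> sf; have sn : sqi (fun x => `|f x|).
  apply: (sqi_le _ _ sf) => [|x]; last by rewrite normr_id.
  exact: measurableT_comp (sqi_meas sf).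
have := N2_CS (sqi_cst 1) sn; rewrite [N2 (fun=> 1)]/N2.
under [X in `|Ex X|]eq_fun do rewrite mul1r.
under [X in Num.sqrt (Ex X)]eq_fun do rewrite expr1n.
rewrite Ex_cst sqrtr1 mul1r => /(le_trans (ler_norm _)) /le_trans; apply.
rewrite /N2; under [X in Num.sqrt (Ex X) <= _]eq_fun => x
  do rewrite real_normK ?num_real//.
by [].
Qed.

Lemma N2_center f : sqi f -> N2 (fun x => f x - Ex f) <= N2 f.
Proof.
move=> sf; rewrite -ler_sqr ?nnegrE ?N2_ge0// !N2_sqr.
have [_ fi] := sf.
have -> : Ex (fun x => (f x - Ex f) ^+ 2) =
    Ex (fun x => f x ^+ 2) - (Ex f) ^+ 2.
  transitivity (Ex (fun x => f x ^+ 2 - (2 * Ex f * f x - Ex f ^+ 2))).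
    by apply: eq_Ex => x; ring.
  have h := iblZ (2 * Ex f) (sqi_ibl sf).
  rewrite ExB//; last by apply: iblB => //; exact: ibl_cst.
  rewrite ExB//; last exact: ibl_cst.
  rewrite ExZ; last exact: sqi_ibl.
  by rewrite Ex_cst; ring.
by rewrite lerBlDr lerDl sqr_ge0.
Qed.

Lemma sqi_Lfun f : sqi f -> f \in Lfun P 2%:E.
Proof.
move=> [mf fi]; rewrite inE; apply/andP; split; rewrite inE//=.
rewrite /finite_norm unlock /Lnorm poweR_lty//.
move/integrableP : fi => [_]; apply: le_lt_trans.
rewrite le_eqVlt; apply/orP; left; apply/eqP; apply: eq_integral => x _ /=.
by congr (_%:E); rewrite powR_mulrn ?normr_ge0// normrX.
Qed.

Lemma Lfun_sqi f : f \in Lfun P 2%:E -> sqi f.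
Proof.
move=> fL; split; last exact: Lfun2_integrable_sqr.
by move: fL; rewrite inE => /andP[]; rewrite inE.
Qed.

End expectation.

(** * Sums over blocks of a stationary sequence *)

Section stationarity.
Context {d : measure_display} {T : measurableType d} {R : realType}.
Variables (P : probability T R) (X : int -> {RV P >-> R}).
Hypothesis Xstat : strictly_stationary X.

Section tuples.
Variables (n : nat) (t : n.-tuple int).

Let vec (k : int) (w : T) : n.-tuple R := [tuple X (tnth t i + k) w | i < n].

Let measurable_vec k : measurable_fun [set: T] (vec k).
Proof.
apply/measurable_fun_tnthP => i.
rewrite (_ : _ \o _ = X (tnth t i + k)) //.
by apply/funext => w; rewrite /= tnth_mktuple.
Qed.

Let vecm k : {mfun T >-> n.-tuple R} := mfun_Sub (mem_set (measurable_vec k)).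

(** Stationarity is an equality of laws of tuples. Nonnegative integrands come first, as they ask
    for no integrability; [stat_Ex] then splits into positive and negative parts. *)
Lemma stat_integral k (F : n.-tuple R -> \bar R) :
  measurable_fun setT F -> (forall v, 0 <= F v)%E ->
  (\int[P]_w F [tuple X (tnth t i + k)%R w | i < n])%E =
  (\int[P]_w F [tuple X (tnth t i) w | i < n])%E.
Proof.
move=> mF F0.
transitivity (\int[P]_w (F \o vecm k) w)%E => //.
have -> : (\int[P]_w F [tuple X (tnth t i) w | i < n])%E =
  (\int[P]_w (F \o vecm 0%R) w)%E.
  apply: eq_integral => w _ /=; congr F.
  by apply: eq_mktuple => i; rewrite addr0.
rewrite -!ge0_integral_distribution//.
apply: eq_measure_integral => A mA _.
have e : P [set w | A (vec 0 w)] = P [set w | A [tuple X (tnth t i) w | i < n]].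
  congr (P _); apply/funext => w; congr A.
  by apply: eq_mktuple => i; rewrite addr0.
transitivity (P [set w | A (vec k w)]) => //.
by rewrite (Xstat t k mA) -e.
Qed.

Lemma stat_Ex k (F : n.-tuple R -> R) : measurable_fun setT F ->
  Ex P (fun w => F [tuple X (tnth t i + k) w | i < n]) =
  Ex P (fun w => F [tuple X (tnth t i) w | i < n]).
Proof.
move=> mF; rewrite Ex.unlock /Rintegral; congr fine.
rewrite integralE [RHS]integralE; congr (_ - _)%E.
  rewrite !funepos.unlock.
  apply: (@stat_integral k (fun v => maxe (F v)%:E 0%E)).
    by apply: measurable_maxe => //; exact/measurable_EFinP.
  by move=> v; rewrite le_max lexx orbT.
rewrite !funeneg.unlock.
apply: (@stat_integral k (fun v => (maxe (- (F v)%:E) 0)%E)).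
  apply: measurable_maxe => //; apply: measurableT_comp => //.
  exact/measurable_EFinP.
by move=> v; rewrite le_max lexx orbT.
Qed.

Lemma stat_ibl k (F : n.-tuple R -> R) : measurable_fun setT F ->
  ibl P (fun w => F [tuple X (tnth t i) w | i < n]) ->
  ibl P (fun w => F [tuple X (tnth t i + k) w | i < n]).
Proof.
move=> mF /integrableP[_ iF]; apply/integrableP; split.
  apply/measurable_EFinP; exact: (measurableT_comp mF (measurable_vec k)).
rewrite /= (@stat_integral k (fun v => `|(F v)%:E|%E))//.
by apply: measurableT_comp => //; exact/measurable_EFinP.
Qed.

End tuples.

Variable h : R -> R.
Hypothesis mh : measurable_fun [set: R] h.

Definition lsum (s : seq nat) (k : int) (w : T) : R :=
  \sum_(i <- s) h (X (i%:Z + k) w).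

Lemma measurable_lsum s k : measurable_fun [set: T] (lsum s k).
Proof.
by apply: measurable_sum => i; apply: measurableT_comp.
Qed.

Let measurable_nth n j :
  measurable_fun [set: n.-tuple R] (fun v : n.-tuple R => nth 0 v j).
Proof.
have [jn|nj] := ltnP j n.
  rewrite (_ : (fun _ => _) = (@tnth n R)^~ (Ordinal jn)).
    exact: measurable_tnth.
  by apply/funext => v; rewrite (tnth_nth 0).
rewrite (_ : (fun _ => _) = cst 0)//.
by apply/funext => v; rewrite nth_default// size_tuple.
Qed.

Let part n a b (v : n.-tuple R) : R := \sum_(a <= j < b) h (nth 0 v j).

Let measurable_part n a b : measurable_fun setT (@part n a b).
Proof.
apply: measurable_sum => i; apply: measurableT_comp => //.
exact: measurable_nth.
Qed.

(** Both sums are read off a single tuple, indexed by [s ++ u], because stationarity has to be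
    applied to their joint law. *)
Let lsum_part (s u : seq nat) (k : int) (w : T)
    (t := in_tuple [seq i%:Z | i <- s ++ u]) :
  (lsum s k w = part 0 (size s) [tuple X (tnth t i + k) w | i < _]) /\
  (lsum u k w =
   part (size s) (size s + size u) [tuple X (tnth t i + k) w | i < _]).
Proof.
have st : size [seq i%:Z | i <- s ++ u] = (size s + size u)%N.
  by rewrite size_map size_cat.
have E j : (j < size s + size u)%N ->
    nth 0 [tuple X (tnth t i + k) w | i < size [seq i%:Z | i <- s ++ u]] j =
    X ((nth 0%N (s ++ u) j)%:Z + k) w.
  rewrite -st => jn.
  have := tnth_nth 0 [tuple X (tnth t i + k) w | i < _] (Ordinal jn).
  move=> /= <-; rewrite tnth_mktuple (tnth_nth 0) /= (nth_map 0%N)//.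
  by move: jn; rewrite size_map.
split.
  rewrite /lsum /part (big_nth 0%N); apply: eq_big_nat => j /andP[_ js].
  by rewrite E ?(leq_trans js) ?leq_addr// nth_cat js.
rewrite /lsum /part (big_nth 0%N) -{1}(add0n (size s)) big_addn addKn.
apply: eq_big_nat => j /andP[_ js].
rewrite E ?nth_cat; last by rewrite addnC ltn_add2l.
by rewrite ltnNge leq_addl/= addnK.
Qed.

Lemma lsum_Ex2 (phi psi : R -> R) s u k :
  measurable_fun [set: R] phi -> measurable_fun [set: R] psi ->
  Ex P (fun w => phi (lsum s k w) * psi (lsum u k w)) =
  Ex P (fun w => phi (lsum s 0 w) * psi (lsum u 0 w)).
Proof.
move=> mphi mpsi.
pose t := in_tuple [seq i%:Z | i <- s ++ u].
pose F v := phi (@part _ 0 (size s) v) *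
            psi (@part (size [seq i%:Z | i <- s ++ u])
              (size s) (size s + size u) v).
have mF : measurable_fun setT F.
  by apply: measurable_funM; apply: measurableT_comp => //;
    exact: measurable_part.
have E k' : (fun w => phi (lsum s k' w) * psi (lsum u k' w)) =
    (fun w => F [tuple X (tnth t i + k') w | i < _]).
  by apply/funext => w; have [-> ->] := lsum_part s u k' w.
by rewrite !E (stat_Ex t k mF) (stat_Ex t 0 mF).
Qed.

Lemma lsum_Ex (phi : R -> R) s k : measurable_fun [set: R] phi ->
  Ex P (fun w => phi (lsum s k w)) = Ex P (fun w => phi (lsum s 0 w)).
Proof.
move=> mphi; have := @lsum_Ex2 phi (fun=> 1) s [::] k mphi.
move=> /(_ (measurable_cst _)).
by under [X in Ex _ X = _]eq_fun do rewrite mulr1;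
  under [X in _ = Ex _ X]eq_fun do rewrite mulr1.
Qed.

Lemma lsum_ibl (phi : R -> R) s k : measurable_fun [set: R] phi ->
  ibl P (fun w => phi (lsum s 0 w)) -> ibl P (fun w => phi (lsum s k w)).
Proof.
move=> mphi.
pose t := in_tuple [seq i%:Z | i <- s ++ [::]].
pose F v := phi (@part (size [seq i%:Z | i <- s ++ [::]]) 0 (size s) v).
have mF : measurable_fun setT F.
  by apply: measurableT_comp => //; exact: measurable_part.
have E k' : (fun w => phi (lsum s k' w)) =
    (fun w => F [tuple X (tnth t i + k') w | i < _]).
  by apply/funext => w; have [-> _] := lsum_part s [::] k' w.
rewrite !E => i0; apply: stat_ibl => //; move: i0.
congr (ibl P); apply/funext => w; congr F.
by apply: eq_mktuple => i; rewrite addr0.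
Qed.

Lemma lsum_shift s k (m : nat) : lsum [seq (i + m)%N | i <- s] k = lsum s (m%:Z + k).
Proof.
apply/funext => w; rewrite /lsum big_map; apply: eq_bigr => i _.
by rewrite PoszD addrA.
Qed.

End stationarity.

(** * Covariance bounds from the mixing coefficients *)

Section mixing.
Context {d : measure_display} {T : measurableType d} {R : realType}.
Variables (P : probability T R) (X : int -> {RV P >-> R}).

Lemma fine_covariance (f g : T -> R) :
  fine (covariance P f g) = Ex P (fun w => (f w - Ex P f) * (g w - Ex P g)).
Proof. by rewrite Ex.unlock !unlock. Qed.

Lemma covE (f g : T -> R) : sqi P f -> sqi P g ->
  Ex P (fun w => (f w - Ex P f) * (g w - Ex P g)) =
  Ex P (fun w => f w * g w) - Ex P f * Ex P g.
Proof.
move=> sf sg.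
have fg := sqiM sf sg; have fi := sqi_ibl sf; have gi := sqi_ibl sg.
transitivity (Ex P (fun w => f w * g w -
    (Ex P g * f w + (Ex P f * g w - Ex P f * Ex P g)))).
  by apply: eq_Ex => w; ring.
have i1 := iblZ (Ex P g) fi; have i2 := iblZ (Ex P f) gi.
have i3 := iblB i2 (ibl_cst P (Ex P f * Ex P g)).
rewrite ExB//; last exact: iblD.
rewrite ExD// ExB//; last exact: ibl_cst.
by rewrite ExZ// ExZ// Ex_cst; ring.
Qed.

Lemma corrE (f g : T -> R) : corr P f g =
  Ex P (fun w => (f w - Ex P f) * (g w - Ex P g)) /
  (N2 P (fun w => f w - Ex P f) * N2 P (fun w => g w - Ex P g)).
Proof.
rewrite /corr fine_covariance /N2 -sqrtrM; last by apply: Ex_ge0 => x; exact: sqr_ge0.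
rewrite /variance !fine_covariance.
by congr (_ / Num.sqrt (_ * _)); apply: eq_Ex => x; rewrite expr2.
Qed.

Lemma sqi_center (f : T -> R) : sqi P f -> sqi P (fun w => f w - Ex P f).
Proof. by move=> sf; apply: sqiB => //; exact: sqi_cst. Qed.

Lemma corr_le1 (f g : T -> R) : sqi P f -> sqi P g -> `|corr P f g| <= 1.
Proof.
move=> /sqi_center sf /sqi_center sg; rewrite corrE normrM normfV.
have := N2_CS sf sg.
have := mulr_ge0 (N2_ge0 P (fun w => f w - Ex P f)) (N2_ge0 P (fun w => g w - Ex P g)).
move: (Ex P _) (_ * N2 P _) => c n n0 cn; rewrite (ger0_norm n0).
have [->|nz] := eqVneq n 0; first by rewrite invr0 mulr0.
by rewrite ler_pdivrMr ?mul1r// lt_neqAle eq_sym nz.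
Qed.

(** In the degenerate case [corr] is 0 by division by zero and carries no information; there
    Cauchy-Schwarz shows that the covariance vanishes. Centring only decreases the norms. *)
Lemma cov_le (f g : T -> R) r : sqi P f -> sqi P g -> 0 <= r ->
  `|corr P f g| <= r ->
  `|Ex P (fun w => f w * g w) - Ex P f * Ex P g| <= r * (N2 P f * N2 P g).
Proof.
move=> sf sg r0; rewrite -covE// corrE normrM normfV => fg.
have cs := N2_CS (sqi_center sf) (sqi_center sg).
apply: le_trans (_ : _ <= r * (N2 P (fun w => f w - Ex P f) *
  N2 P (fun w => g w - Ex P g))) _; last first.
  by apply: ler_wpM2l => //; apply: ler_pM; rewrite ?N2_ge0 ?N2_center.
move: fg cs; have := mulr_ge0 (N2_ge0 P (fun w => f w - Ex P f))
  (N2_ge0 P (fun w => g w - Ex P g)).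
move: (Ex P _) (_ * N2 P _) => c n n0; rewrite (ger0_norm n0).
have [->|nz] := eqVneq n 0; first by rewrite mulr0.
by rewrite ler_pdivrMr// lt_neqAle eq_sym nz.
Qed.

Lemma L2_sub_cst0 F : L2_sub P F (cst 0).
Proof.
split; last exact: measurable_cst.
by apply: sqi_Lfun; exact: sqi_cst.
Qed.

Let rho_set n := [set r : R | exists f h : T -> R,
    [/\ L2_sub P (sigma_field X [set t | t <= 0]) f,
        L2_sub P (sigma_field X [set t | n%:Z <= t]) h &
        r = `|corr P f h|]].

Let rho_set_ub n : ubound (rho_set n) 1.
Proof.
move=> r [f [g [[/Lfun_sqi sf _] [/Lfun_sqi sg _] ->]]].
exact: corr_le1.
Qed.

Let rho_set0 n : rho_set n !=set0.
Proof.
exists `|corr P (cst 0) (cst 0)|, (cst 0), (cst 0); split => //; exact: L2_sub_cst0.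
Qed.

Let rho_has_sup n : has_sup (rho_set n).
Proof. by split; [exact: rho_set0 | exists 1; exact: rho_set_ub]. Qed.

Lemma corr_le_rho n (f g : T -> R) :
  L2_sub P (sigma_field X [set t | t <= 0]) f ->
  L2_sub P (sigma_field X [set t | n%:Z <= t]) g -> `|corr P f g| <= rho X n.
Proof.
move=> Lf Lg; apply: (ub_le_sup (proj2 (rho_has_sup n))).
by exists f, g.
Qed.

Lemma rho_ge0 n : 0 <= rho X n.
Proof.
apply: (le_trans (normr_ge0 (corr P (cst 0) (cst 0)))).
by apply: corr_le_rho; exact: L2_sub_cst0.
Qed.

Lemma rho_le1 n : rho X n <= 1.
Proof. by apply: ge_sup; [exact: rho_set0|exact: rho_set_ub]. Qed.

Lemma sigma_fieldS (I J : set int) : I `<=` J -> sigma_field X I `<=` sigma_field X J.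
Proof.
move=> IJ; apply: sub_sigma_algebra2; exact: bigcup_subset.
Qed.

Lemma L2_subS (F G : set (set T)) (f : T -> R) : F `<=` G -> L2_sub P F f -> L2_sub P G f.
Proof.
move=> FG [Lf mf]; split => // mT Y mY.
have := mf (@measurableT _ (g_sigma_algebraType F)) Y mY.
exact: (sub_sigma_algebra2 FG).
Qed.

Lemma rho_anti m n : (m <= n)%N -> rho X n <= rho X m.
Proof.
move=> mn; apply: ge_sup; first exact: rho_set0.
move=> r [f [g [Lf Lg ->]]]; apply: corr_le_rho => //.
by apply: L2_subS Lg; apply: sigma_fieldS => t /=; apply: le_trans; rewrite lez_nat.
Qed.

Lemma measurable_sigma_field (I : set int) t : I t ->
  measurable_fun [set: g_sigma_algebraType (sigma_field X I)]
    (X t : g_sigma_algebraType (sigma_field X I) -> R).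
Proof.
move=> It _ Y mY; apply: sub_sigma_algebra; apply: sub_sigma_algebra.
by exists t => //; exists Y.
Qed.

Variable h : R -> R.
Hypothesis mh : measurable_fun [set: R] h.
Hypothesis Xstat : strictly_stationary X.

Lemma L2_sub_lsum (I : set int) (phi : R -> R) s k :
  measurable_fun [set: R] phi ->
  (forall i, i \in s -> I (i%:Z + k)) -> sqi P (fun w => phi (lsum X h s k w)) ->
  L2_sub P (sigma_field X I) (fun w => phi (lsum X h s k w)).
Proof.
move=> mphi sI sq; split; first exact: sqi_Lfun.
apply: (measurableT_comp mphi).
(* Measurability of a sum is asked of every summand, so the summands outside [s] are replaced by
   0. *)
rewrite (_ : lsum X h s k = fun w => \sum_(i <- s)
    (if i \in s then h (X (i%:Z + k) w) else 0)); last first.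
  by apply/funext => w; rewrite /lsum; apply: eq_big_seq => i ->.
apply: (@measurable_sum _ (g_sigma_algebraType (sigma_field X I))) => i.
case: (boolP (i \in s)) => [is_|_]; last exact: measurable_cst.
apply: (measurableT_comp mh).
by apply: measurable_sigma_field; exact: sI.
Qed.

Lemma lsum_sqi (phi : R -> R) s k : measurable_fun [set: R] phi ->
  sqi P (fun w => phi (lsum X h s 0 w)) -> sqi P (fun w => phi (lsum X h s k w)).
Proof.
move=> mphi [_ i0]; split.
  by apply: (measurableT_comp mphi); exact: measurable_lsum.
apply: (@lsum_ibl _ _ _ _ _ Xstat _ mh (fun x => phi x ^+ 2)) => //.
exact: measurable_funX.
Qed.

Lemma lsum_N2 (phi : R -> R) s k : measurable_fun [set: R] phi ->
  N2 P (fun w => phi (lsum X h s k w)) = N2 P (fun w => phi (lsum X h s 0 w)).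
Proof.
move=> mphi; congr Num.sqrt.
apply: (lsum_Ex Xstat mh (phi := fun x => phi x ^+ 2)) => //.
exact: measurable_funX.
Qed.

(** A shift by -a puts the first sum at times <= 0 and the second at times >= p, where the
    definition of [rho] applies; stationarity undoes the shift. *)
Lemma mixing (phi psi : R -> R) s u a p :
  measurable_fun [set: R] phi -> measurable_fun [set: R] psi ->
  (forall i, i \in s -> (i <= a)%N) -> (forall i, i \in u -> (a + p <= i)%N) ->
  sqi P (fun w => phi (lsum X h s 0 w)) -> sqi P (fun w => psi (lsum X h u 0 w)) ->
  `|Ex P (fun w => phi (lsum X h s 0 w) * psi (lsum X h u 0 w)) -
    Ex P (fun w => phi (lsum X h s 0 w)) * Ex P (fun w => psi (lsum X h u 0 w))|
  <= rho X p * (N2 P (fun w => phi (lsum X h s 0 w)) *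
                N2 P (fun w => psi (lsum X h u 0 w))).
Proof.
move=> mphi mpsi sa ua sf sg.
rewrite -(lsum_Ex2 Xstat mh s u (- a%:Z) mphi mpsi).
rewrite -(lsum_Ex Xstat mh s (- a%:Z) mphi) -(lsum_Ex Xstat mh u (- a%:Z) mpsi).
rewrite -(lsum_N2 s (- a%:Z) mphi) -(lsum_N2 u (- a%:Z) mpsi).
have {}sf := lsum_sqi (- a%:Z) mphi sf; have {}sg := lsum_sqi (- a%:Z) mpsi sg.
have Lf : L2_sub P (sigma_field X [set t | t <= 0])
    (fun w => phi (lsum X h s (- a%:Z) w)).
  by apply: L2_sub_lsum => // i /sa ia /=; rewrite subr_le0 lez_nat.
have Lg : L2_sub P (sigma_field X [set t | p%:Z <= t])
    (fun w => psi (lsum X h u (- a%:Z) w)).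
  by apply: L2_sub_lsum => // i /ua ia /=; rewrite lerBrDr -PoszD lez_nat addnC.
exact: (cov_le sf sg (rho_ge0 p) (corr_le_rho Lf Lg)).
Qed.

End mixing.

(** * Block sums and the doubling inequalities for their standard deviations *)

Section blocks.
Context {d : measure_display} {T : measurableType d} {R : realType}.
Variables (P : probability T R) (X : int -> {RV P >-> R}).
Hypothesis Xstat : strictly_stationary X.
Variable h : R -> R.
Hypothesis mh : measurable_fun [set: R] h.

Definition blk (m n : nat) : T -> R := lsum X h (iota m n) 0.

Lemma measurable_blk m n : measurable_fun [set: T] (blk m n).
Proof. exact: measurable_lsum. Qed.

Lemma blk_lsum m n : blk m n = lsum X h (iota 0 n) m%:Z.
Proof.
rewrite /blk -[m in iota m n](addn0 m) iotaDl.
rewrite -[RHS](f_equal (lsum X h (iota 0 n)) (addr0 _)) -lsum_shift.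
by congr lsum; apply: eq_map => i; rewrite addnC.
Qed.

Lemma blk_Ex (phi : R -> R) m n : measurable_fun [set: R] phi ->
  Ex P (fun w => phi (blk m n w)) = Ex P (fun w => phi (blk 0 n w)).
Proof. by move=> mphi; rewrite (blk_lsum m); exact: (lsum_Ex Xstat mh (iota 0 n) m%:Z mphi). Qed.

Lemma blk_sqi (phi : R -> R) m n : measurable_fun [set: R] phi ->
  sqi P (fun w => phi (blk 0 n w)) -> sqi P (fun w => phi (blk m n w)).
Proof. by move=> mphi; rewrite (blk_lsum m); exact: (lsum_sqi mh Xstat m%:Z mphi). Qed.

Lemma blkD m a b w : blk m (a + b) w = blk m a w + blk (m + a) b w.
Proof. by rewrite /blk /lsum iotaD big_cat. Qed.

Lemma blk1 m w : blk m 1 w = h (X m%:Z w).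
Proof. by rewrite /blk /lsum big_seq1 addr0. Qed.

Lemma blk0 m w : blk m 0 w = 0.
Proof. by rewrite /blk /lsum big_nil. Qed.

Lemma mixing_blk (phi psi : R -> R) m a b p :
  measurable_fun [set: R] phi -> measurable_fun [set: R] psi ->
  sqi P (fun w => phi (blk m a w)) -> sqi P (fun w => psi (blk (m + a + p) b w)) ->
  `|Ex P (fun w => phi (blk m a w) * psi (blk (m + a + p) b w)) -
    Ex P (fun w => phi (blk m a w)) * Ex P (fun w => psi (blk (m + a + p) b w))|
  <= rho X p * (N2 P (fun w => phi (blk m a w)) *
                N2 P (fun w => psi (blk (m + a + p) b w))).
Proof.
move=> mphi mpsi; apply: (@mixing _ _ _ _ _ _ mh Xstat _ _ _ _ (m + a)%N) => //.
  by move=> i; rewrite mem_iota => /andP[_ /ltnW].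
by move=> i; rewrite mem_iota => /andP[].
Qed.

Hypothesis h_sqi : sqi P (fun w => h (X 0 w)).

Definition blkN (n : nat) : R := N2 P (blk 0 n).

Lemma blk_sqi1 m : sqi P (blk m 1).
Proof.
apply: (@blk_sqi id) => //.
by rewrite (_ : (fun _ => _) = fun w => h (X 0 w))//; apply/funext => w; rewrite blk1.
Qed.

Lemma sqi_blk m n : sqi P (blk m n).
Proof.
elim: n m => [|n IHn] m.
  by rewrite (_ : blk _ _ = fun=> 0); [exact: sqi_cst|apply/funext => w; rewrite blk0].
rewrite (_ : blk _ _ = fun w => blk m 1 w + blk (m + 1) n w).
  by apply: sqiD => //; exact: blk_sqi1.
by apply/funext => w; rewrite -blkD.
Qed.

Lemma N2_blk m n : N2 P (blk m n) = blkN n.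
Proof. by rewrite blk_lsum; exact: (@lsum_N2 _ _ _ _ _ _ mh Xstat id). Qed.

Lemma blkN_ge0 n : 0 <= blkN n. Proof. exact: N2_ge0. Qed.

Lemma blkN0 : blkN 0 = 0.
Proof.
rewrite /blkN /N2; under [Ex P _]eq_Ex do rewrite blk0 expr0n/=.
by rewrite Ex_cst sqrtr0.
Qed.

Lemma blkN1 : blkN 1 = N2 P (fun w => h (X 0 w)).
Proof. by congr N2; apply/funext => w; rewrite blk1. Qed.

Lemma blkND a b : blkN (a + b) <= blkN a + blkN b.
Proof.
rewrite -[blkN b](N2_blk (0 + a)); have := N2D (sqi_blk 0 a) (sqi_blk (0 + a) b).
by under [X in N2 _ X]eq_fun do rewrite -blkD.
Qed.

Lemma blkN_le n : blkN n <= n%:R * blkN 1.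
Proof.
elim: n => [|n IHn]; first by rewrite blkN0 mul0r.
by rewrite -addn1 (le_trans (blkND _ _))// natrD mulrDl mul1r lerD2r.
Qed.

Hypothesis h_mean : Ex P (fun w => h (X 0 w)) = 0.

Lemma Ex_blk m n : Ex P (blk m n) = 0.
Proof.
elim: n m => [|n IHn] m.
  by under [Ex P _]eq_Ex do rewrite blk0; rewrite Ex_cst.
transitivity (Ex P (fun w => blk m 1 w + blk (m + 1) n w)).
  by apply: eq_Ex => w; rewrite -blkD.
rewrite ExD; [|exact: sqi_ibl (sqi_blk _ _)..].
rewrite IHn addr0 (@blk_Ex id)//.
by under [Ex P _]eq_Ex do rewrite blk1.
Qed.

(* [2m = m + p + m - p]: two blocks separated by a gap, plus two short blocks. *)
Lemma blk_double m p w : blk 0 (m + m) w =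
  blk 0 m w + blk (m + p) m w + (blk m p w - blk (m + m) p w).
Proof.
have h1 := blkD 0 (m + m) p w; have h2 := blkD 0 m (p + m) w.
have h3 := blkD m p m w; rewrite !add0n in h1 h2.
have e : (m + (p + m) = m + m + p)%N by lia.
rewrite e h1 h3 in h2; lra.
Qed.

Lemma N2_blk2 m p :
  `|N2 P (fun w => blk 0 m w + blk (m + p) m w) ^+ 2 - 2 * blkN m ^+ 2| <=
  2 * rho X p * blkN m ^+ 2.
Proof.
rewrite N2_sqrD; [|exact: sqi_blk..].
rewrite !N2_blk -[X in `|X|]/(blkN m ^+ 2 + blkN m ^+ 2 + _ - _).
have := @mixing_blk id id 0 m m p (@measurable_id _ _ _) (@measurable_id _ _ _)
  (sqi_blk _ _) (sqi_blk _ _).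
rewrite /= !Ex_blk mulr0 subr0 add0n !N2_blk.
move: (Ex P _) (rho X p) (blkN m) => c r v cr.
rewrite (_ : _ - _ = 2 * c); last by ring.
by rewrite normrM ger0_norm// -mulrA ler_pM2l// expr2.
Qed.

Lemma N2_blk_double m p :
  `|blkN (m + m) - N2 P (fun w => blk 0 m w + blk (m + p) m w)| <= 2 * blkN p.
Proof.
have s2 := sqiD (sqi_blk 0 m) (sqi_blk (m + p) m).
apply: (le_trans (N2_dist (sqi_blk _ _) s2)).
rewrite (_ : N2 P _ = N2 P (fun w => blk m p w - blk (m + m) p w)).
  by apply: (le_trans (N2B (sqi_blk _ _) (sqi_blk _ _))); rewrite !N2_blk; lra.
by congr N2; apply/funext => w; rewrite (blk_double m p); ring.
Qed.

Lemma blkN_double_le m p :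
  blkN (m + m) <= Num.sqrt (2 * (1 + rho X p)) * blkN m + 2 * blkN p.
Proof.
have := le_trans (ler_norm _) (N2_blk_double m p); rewrite lerBlDl.
move=> /le_trans; apply; rewrite lerD2r.
rewrite -ler_sqr ?nnegrE ?N2_ge0 ?mulr_ge0 ?sqrtr_ge0 ?blkN_ge0//.
have r0 : 0 <= 2 * (1 + rho X p) by have := rho_ge0 X p; lra.
rewrite exprMn (sqr_sqrtr r0).
have := le_trans (ler_norm _) (N2_blk2 m p); lra.
Qed.

Lemma blkN_double_ge m p :
  Num.sqrt (2 * (1 - rho X p)) * blkN m - 2 * blkN p <= blkN (m + m).
Proof.
have := N2_blk_double m p; rewrite ler_norml => /andP[+ _].
rewrite lerNl opprB lerBlDr addrC -lerBlDr; apply: le_trans; rewrite lerD2r.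
rewrite -ler_sqr ?nnegrE ?N2_ge0 ?mulr_ge0 ?sqrtr_ge0 ?blkN_ge0//.
have r1 : 0 <= 2 * (1 - rho X p) by have := rho_le1 X p; lra.
rewrite exprMn (sqr_sqrtr r1).
have := N2_blk2 m p; rewrite ler_norml => /andP[+ _]; lra.
Qed.

End blocks.

(** * Moments of order q of sums over two blocks *)

Section powR_inequalities.
Context {R : realType}.
Implicit Types x y q : R.

Lemma ler_powRl x y q : 0 <= q -> 0 <= x -> x <= y -> x `^ q <= y `^ q.
Proof. by move=> q0 x0 xy; apply: ge0_ler_powR => //; rewrite nnegrE// (le_trans x0). Qed.

(** Compare with the cube: (1 + t)^q <= 1 + 3t + 3t^2 + t^3, where t^2 <= t^(q-1) and t^3 <= t^q
    because t <= 1 and q <= 3. *)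
Lemma powRD_le_unit t q : 2 <= q -> q <= 3 -> 0 <= t -> t <= 1 ->
  (1 + t) `^ q <= 1 + t `^ q + 3 * (t + t `^ (q - 1)).
Proof.
move=> q2 q3; rewrite le_eqVlt => /predU1P[<- _|t0 t1].
  by rewrite addr0 powR1 !powR0; lra.
have h1 : (1 + t) `^ q <= (1 + t) ^+ 3.
  by rewrite -powR_mulrn; [apply: ler_powR; lra|lra].
have h2 : t ^+ 2 <= t `^ (q - 1).
  by rewrite -powR_mulrn; [apply: ger_powR; lra|lra].
have h3 : t ^+ 3 <= t `^ q.
  by rewrite -powR_mulrn; [apply: ger_powR; lra|lra].
lra.
Qed.

Lemma powRD_le x y q : 2 <= q -> q <= 3 -> 0 <= x -> 0 <= y ->
  (x + y) `^ q <= x `^ q + y `^ q + 3 * (x `^ (q - 1) * y + x * y `^ (q - 1)).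
Proof.
move=> q2 q3.
wlog yx : x y / y <= x => [H x0 y0|].
  have [yx|/ltW xy] := leP y x; first exact: H.
  have := H _ _ xy y0 x0; rewrite (addrC y x); lra.
rewrite le_eqVlt => /predU1P[x0 y0|x0 y0].
  have -> : y = 0 by apply/eqP; rewrite eq_le y0 x0 yx.
  by rewrite -x0 !addr0 !mul0r mulr0 addr0 powR0; lra.
have h := @powRD_le_unit (y / x) q q2 q3 (divr_ge0 y0 (ltW x0)).
have {h} : y / x <= 1 by rewrite ler_pdivrMr// mul1r.
move=> /(@powRD_le_unit (y / x) q q2 q3 (divr_ge0 y0 (ltW x0))).
move=> /(ler_wpM2l (powR_ge0 x q)).
rewrite -powRM; [|lra|by rewrite addr_ge0// divr_ge0// ltW].
rewrite mulrDr mulr1 (mulrCA x) divff ?gt_eqF// mulr1 => /le_trans; apply.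
have e1 : x `^ q * (y / x) `^ q = y `^ q.
  rewrite -powRM//; [|lra|exact: divr_ge0 y0 (ltW x0)].
  by rewrite mulrCA divff ?gt_eqF// mulr1.
have e2 : x `^ q = x * x `^ (q - 1) by rewrite mulr_powRB1//; lra.
have e3 : x `^ (q - 1) * (y / x) `^ (q - 1) = y `^ (q - 1).
  rewrite -powRM//; [|lra|exact: divr_ge0 y0 (ltW x0)].
  by rewrite mulrCA divff ?gt_eqF// mulr1.
rewrite !mulrDr e1 mulr1 lerD2l.
rewrite [x `^ q * (3 * ((y / x) `^ _))]mulrCA.
rewrite [X in X + _](_ : _ = 3 * (x `^ (q - 1) * y)); last first.
  by rewrite e2; field; rewrite gt_eqF.
rewrite lerD2l [in leLHS]e2 -mulrA e3; lra.
Qed.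

Lemma powR_subadd x y q : 0 < q -> q <= 1 -> 0 <= x -> 0 <= y ->
  (x + y) `^ q <= x `^ q + y `^ q.
Proof.
move=> q0 q1 x0 y0.
have [->|s0] := eqVneq (x + y) 0.
  by rewrite powR0 ?gt_eqF// addr_ge0// powR_ge0.
have {}s0 : 0 < x + y by rewrite lt_neqAle eq_sym s0 addr_ge0.
have H z : 0 <= z -> z <= x + y -> z / (x + y) * (x + y) `^ q <= z `^ q.
  rewrite le_eqVlt => /predU1P[<- _|z0 zs]; first by rewrite mul0r mul0r powR_ge0.
  have h : z / (x + y) <= (z / (x + y)) `^ q.
    by apply: ger1_powR => //; rewrite divr_gt0//= ler_pdivrMr// mul1r.
  apply: (le_trans (ler_wpM2r (powR_ge0 _ _) h)).
  have zz := ltW z0; have ss := ltW s0; rewrite -powRM ?divr_ge0 ?addr_ge0// divfK ?gt_eqF//.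
have hx := H x x0 _; have hy := H y y0 _.
have := lerD (hx _) (hy _); rewrite -!mulrDl divff ?gt_eqF// mul1r; apply; lra.
Qed.

Lemma powR_bernoulli x b a : 1 < a -> 0 <= x -> 0 <= b ->
  x `^ a + b * x `^ (a - 1) <= (x + b) `^ a.
Proof.
move=> a1 x0 b0; rewrite -[x `^ a]mulr_powRB1//; last lra.
rewrite -[(x + b) `^ a]mulr_powRB1 ?addr_ge0//; last lra.
rewrite -mulrDl ler_wpM2l ?addr_ge0// ler_powRl//; lra.
Qed.

Lemma powR_half_sqr x q : (x `^ (q / 2)) ^+ 2 = x `^ q.
Proof.
by rewrite -powR_mulrn ?powR_ge0// -powRrM divfK ?pnatr_eq0.
Qed.

(** The real-number part of [moment_cross]: E stands for the mean of |S|^(q/2) |U|^(q/2), which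
    mixing bounds by a product of low moments plus r k^q. Subadditivity of the power 2/q separates
    the two terms; this is how r gets the exponent 2/q. *)
Lemma powR_cross (A r k q E : R) : 2 < q -> 0 <= A -> 0 <= r -> 0 <= k -> 0 <= E ->
  E <= A `^ (q / 2) + r * k `^ q ->
  E `^ (2 / q) * (k `^ q) `^ (1 - 2 / q) <=
  r `^ (2 / q) * k `^ q + A * k `^ (q - 2).
Proof.
move=> q2 A0 r0 k0 E0 Ele.
have q0 : q != 0 by rewrite gt_eqF//; lra.
have t0 : 0 < 2 / q by rewrite divr_gt0//; lra.
have t1 : 2 / q <= 1 by rewrite ler_pdivrMr; lra.
have kq0 := powR_ge0 k q.
have h1 := ler_powRl (ltW t0) E0 Ele.
have h2 := powR_subadd t0 t1 (powR_ge0 A (q / 2)) (mulr_ge0 r0 kq0).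
apply: le_trans (ler_wpM2r (powR_ge0 _ _) (le_trans h1 h2)) _.
have e1 : (A `^ (q / 2)) `^ (2 / q) = A.
  by rewrite -powRrM (_ : _ * (2 / q) = 1) ?powRr1//; field.
have e2 : (k `^ q) `^ (1 - 2 / q) = k `^ (q - 2).
  by rewrite -powRrM; congr (_ `^ _); field.
have e3 : (k `^ q) `^ (2 / q) * k `^ (q - 2) = k `^ q.
  have e0 : q * (2 / q) = 2 by field.
  rewrite -powRrM e0 -powRD; first by congr (_ `^ _); ring.
  by apply/implyP => /eqP e4; exfalso; clear -q2 e4; lra.
by rewrite e1 e2 (powRM _ r0 kq0) mulrDl addrC -mulrA e3.
Qed.

(** The term V k^(q-2) is absorbed through (k^2)^(q/2) + 3V (k^2)^(q/2 - 1) <= (k^2 + 3V)^(q/2).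
    After the root of order q, the variance simply adds to k^2 under a square root, a form that can
    be iterated. *)
Lemma moment_arith (al k V M q : R) : 2 < q -> 1 <= al -> 0 <= V -> 0 <= k -> 0 <= M ->
  M <= 2 * al * k `^ q + 6 * V * k `^ (q - 2) ->
  M `^ q^-1 <= (2 * al) `^ q^-1 * Num.sqrt (k ^+ 2 + 3 * V).
Proof.
move=> q2 al1 V0 k0 M0 Mle.
have q1 : 1 < q / 2 by rewrite ltr_pdivlMr; lra.
have q0 : q != 0 by rewrite gt_eqF//; lra.
have qi : 0 <= q^-1 by rewrite invr_ge0; lra.
have al0 : 0 <= 2 * al by lra.
have V3 : 0 <= 3 * V by rewrite mulr_ge0.
have key : M <= 2 * al * (k ^+ 2 + 3 * V) `^ (q / 2).
  apply: (le_trans Mle).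
  have e1 : (k ^+ 2) `^ (q / 2) = k `^ q.
    by rewrite -powR_mulrn// -powRrM; congr (_ `^ _); field.
  have e2 : (k ^+ 2) `^ (q / 2 - 1) = k `^ (q - 2).
    by rewrite -powR_mulrn// -powRrM; congr (_ `^ _); field.
  have h := powR_bernoulli q1 (sqr_ge0 k) V3; rewrite e1 e2 in h.
  apply: le_trans (ler_wpM2l al0 h); rewrite mulrDr lerD2l mulrA.
  apply: ler_wpM2r; first exact: powR_ge0.
  have := mulr_ge0 (_ : 0 <= al - 1) V0; clear -al1; lra.
have := ler_powRl qi M0 key => /le_trans; apply.
rewrite (powRM _ al0 (powR_ge0 _ _)) -powRrM.
have -> : q / 2 / q = 2^-1 by field.
by rewrite powR12_sqrt// addr_ge0 ?sqr_ge0.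
Qed.

End powR_inequalities.

Section Lq.
Context {d : measure_display} {T : measurableType d} {R : realType}.
Variable P : probability T R.
Implicit Types (f g u v : T -> R) (q : R).

Definition Mq q f : R := Ex P (fun x => `|f x| `^ q).
Definition Nq q f : R := Mq q f `^ q^-1.

Lemma Mq_ge0 q f : 0 <= Mq q f.
Proof. by apply: Ex_ge0 => x; exact: powR_ge0. Qed.

Lemma Nq_ge0 q f : 0 <= Nq q f. Proof. exact: powR_ge0. Qed.

Lemma Nq_powR q f : q != 0 -> Nq q f `^ q = Mq q f.
Proof. by move=> q0; rewrite -powRrM mulVf// powRr1// Mq_ge0. Qed.

Lemma measurable_abs_powR q f : measurable_fun [set: T] f ->
  measurable_fun [set: T] (fun x => `|f x| `^ q).
Proof.
move=> mf; apply: (measurableT_comp (measurable_powR _)).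
exact: measurableT_comp.
Qed.

Lemma Lnorm_Nq q f : ibl P (fun x => `|f x| `^ q) ->
  ('N[P]_q%:E[EFin \o f] = (Nq q f)%:E)%E.
Proof.
move=> fi; rewrite unlock /Lnorm /=.
rewrite (_ : (\int[P]_x _)%E = (Mq q f)%:E) ?poweR_EFin//.
by rewrite /Mq Ex.unlock /Rintegral fineK//; exact: integrable_fin_num.
Qed.

Lemma NqD q f g : 1 <= q -> measurable_fun [set: T] f -> measurable_fun [set: T] g ->
  ibl P (fun x => `|f x| `^ q) -> ibl P (fun x => `|g x| `^ q) ->
  ibl P (fun x => `|f x + g x| `^ q) ->
  Nq q (fun x => f x + g x) <= Nq q f + Nq q g.
Proof.
move=> q1 mf mg fi gi fgi; have := minkowski_EFin P mf mg q1.
by rewrite !Lnorm_Nq// -EFinD lee_fin.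
Qed.

Lemma hoelder_Ex (theta : R) u v : 0 < theta -> theta < 1 ->
  (forall x, 0 <= u x) -> (forall x, 0 <= v x) -> ibl P u -> ibl P v ->
  ibl P (fun x => u x `^ theta * v x `^ (1 - theta)) ->
  Ex P (fun x => u x `^ theta * v x `^ (1 - theta)) <=
  Ex P u `^ theta * Ex P v `^ (1 - theta).
Proof.
move=> t0 t1 u0 v0 ui vi uvi.
have t10 : 0 < 1 - theta by lra.
pose f x := u x `^ theta; pose g x := v x `^ (1 - theta).
have mf : measurable_fun [set: T] f.
  by apply: (measurableT_comp (measurable_powR _)); exact: ibl_meas ui.
have mg : measurable_fun [set: T] g.
  by apply: (measurableT_comp (measurable_powR _)); exact: ibl_meas vi.
have ef x : `|f x| `^ theta^-1 = u x.
  by rewrite ger0_norm ?powR_ge0// -powRrM divff ?gt_eqF// powRr1.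
have eg x : `|g x| `^ (1 - theta)^-1 = v x.
  by rewrite ger0_norm ?powR_ge0// -powRrM divff ?gt_eqF// powRr1.
have e1 x : `|(f \* g) x| `^ 1 = u x `^ theta * v x `^ (1 - theta).
  by rewrite powRr1// ger0_norm// mulr_ge0// powR_ge0.
have n1 : Nq 1 (f \* g)%R = Ex P (fun x => u x `^ theta * v x `^ (1 - theta)).
  rewrite /Nq invr1 powRr1 ?Mq_ge0//; exact: eq_Ex.
have n2 : Nq theta^-1 f = Ex P u `^ theta.
  by rewrite /Nq invrK; congr (_ `^ _); exact: eq_Ex.
have n3 : Nq (1 - theta)^-1 g = Ex P v `^ (1 - theta).
  by rewrite /Nq invrK; congr (_ `^ _); exact: eq_Ex.
have := @hoelder _ _ _ P f g theta^-1 (1 - theta)^-1 mf mg.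
rewrite !invr_gt0 !invrK => /(_ t0 t10); rewrite addrC subrK => /(_ erefl).
rewrite !Lnorm_Nq; [|by under eq_fun do rewrite ?ef ?eg ?e1..].
by rewrite -EFinM lee_fin n1 n2 n3.
Qed.

End Lq.

(** * Doubling inequality for the L^q norm of sums of bounded variables *)

Section moment_recursion.
Context {d : measure_display} {T : measurableType d} {R : realType}.
Variables (P : probability T R) (X : int -> {RV P >-> R}).
Hypothesis Xstat : strictly_stationary X.
Variable h : R -> R.
Hypothesis mh : measurable_fun [set: R] h.
Variable B : R.
Hypothesis hB : forall x, `|h x| <= B.
Variable q : R.
Hypotheses (q2 : 2 < q) (q3 : q <= 3).

Local Notation blk := (blk X h).
Local Notation K n := (Nq P q (blk 0 n)).

Lemma blk_bounded m n w : `|blk m n w| <= n%:R * B.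
Proof.
elim: n m => [|n IHn] m; first by rewrite blk0 normr0 mul0r.
have -> : blk m n.+1 w = h (X m%:Z w) + blk (m + 1) n w by rewrite -blk1 -blkD.
by rewrite (le_trans (ler_normD _ _))// -natr1 mulrDl mul1r addrC lerD.
Qed.

Lemma ibl_powR_bounded (f : T -> R) (C r : R) : 0 <= r -> measurable_fun [set: T] f ->
  (forall x, `|f x| <= C) -> ibl P (fun x => `|f x| `^ r).
Proof.
move=> r0 mf fC; apply: (@ibl_bounded _ _ _ _ _ (C `^ r)).
  exact: measurable_abs_powR.
by move=> x; rewrite ger0_norm ?powR_ge0// ler_powRl.
Qed.

Lemma ibl_powR_bounded2 (f g : T -> R) (C D r s : R) : 0 <= r -> 0 <= s ->
  measurable_fun [set: T] f -> measurable_fun [set: T] g ->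
  (forall x, `|f x| <= C) -> (forall x, `|g x| <= D) ->
  ibl P (fun x => `|f x| `^ r * `|g x| `^ s).
Proof.
move=> r0 s0 mf mg fC gD; apply: (@ibl_bounded _ _ _ _ _ (C `^ r * D `^ s)).
  by apply: measurable_funM; exact: measurable_abs_powR.
move=> x; rewrite ger0_norm ?mulr_ge0 ?powR_ge0//.
by apply: ler_pM; rewrite ?powR_ge0// ler_powRl.
Qed.

Lemma Nq_blk m n : Nq P q (blk m n) = K n.
Proof.
congr (_ `^ _); apply: (blk_Ex Xstat mh (phi := fun x => `|x| `^ q)).
exact: measurable_abs_powR.
Qed.

Lemma NqD_bounded (f g : T -> R) (C D : R) :
  measurable_fun [set: T] f -> measurable_fun [set: T] g ->
  (forall x, `|f x| <= C) -> (forall x, `|g x| <= D) ->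
  Nq P q (fun x => f x + g x) <= Nq P q f + Nq P q g.
Proof.
have [Q2 Q3] := (q2, q3).
move=> mf mg fC gD; have q1 : 1 <= q by lra.
have q0 : 0 <= q by lra.
apply: NqD => //.
- exact: (ibl_powR_bounded q0 mf fC).
- exact: (ibl_powR_bounded q0 mg gD).
- apply: (@ibl_powR_bounded _ (C + D) q q0); first exact: measurable_funD.
  by move=> x; rewrite (le_trans (ler_normD _ _))// lerD.
Qed.

Lemma NqN (f : T -> R) : Nq P q (fun x => - f x) = Nq P q f.
Proof. by congr (_ `^ _); apply: eq_Ex => x; rewrite normrN. Qed.

Lemma Nq_blk_le n : K n <= n%:R * K 1.
Proof.
have [Q2 Q3] := (q2, q3).
elim: n => [|n IHn].
  have q0 : q != 0 by rewrite gt_eqF//; lra.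
  rewrite mul0r /Nq /Mq; under eq_Ex do rewrite blk0 normr0 powR0//.
  by rewrite Ex_cst powR0// invr_neq0.
rewrite -[n.+1]addn1 natrD mulrDl mul1r.
apply: le_trans (lerD IHn (lexx _)); rewrite -[in leRHS](Nq_blk (0 + n) 1).
rewrite (_ : blk 0 (n + 1) = fun w => blk 0 n w + blk (0 + n) 1 w); last first.
  by apply/funext => w; rewrite blkD.
by apply: NqD_bounded => [||x|x]; [exact: measurable_blk..|exact: blk_bounded|exact: blk_bounded].
Qed.

Lemma Ex_abs_powR_le (f : T -> R) (C a : R) : 0 < a -> a < 2 ->
  measurable_fun [set: T] f -> (forall x, `|f x| <= C) ->
  Ex P (fun x => `|f x| `^ a) <= (N2 P f ^+ 2) `^ (a / 2).
Proof.
move=> a0 a2 mf fC; rewrite N2_sqr.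
have e x : `|f x| `^ a = (f x ^+ 2) `^ (a / 2) * 1 `^ (1 - a / 2).
  rewrite powR1 mulr1 -real_normK ?num_real// -powR_mulrn// -powRrM.
  by congr (_ `^ _); field.
rewrite (eq_Ex P e).
have := @hoelder_Ex _ _ _ P (a / 2) (fun x => f x ^+ 2) (fun=> 1).
rewrite Ex_cst powR1 mulr1; apply.
- by rewrite divr_gt0.
- by rewrite ltr_pdivrMr// mul1r.
- by move=> x; exact: sqr_ge0.
- by [].
- by have [] := sqi_bounded P mf fC.
- exact: ibl_cst.
- have := ibl_powR_bounded (ltW a0) mf fC; rewrite (funext e) powR1; exact.
Qed.

Let theta := 2 / q.

(** Write |S|^(q-1) |U| as (|S|^(q/2) |U|^(q/2))^(2/q) (|S|^q)^(1 - 2/q) and apply Hoelder. The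
    power q/2 is chosen because the L^2 norm of |S|^(q/2) is a moment of order q, so that the mixing
    error is rho times K^q. The disjunction serves both orders of the blocks. *)
Lemma moment_cross m p (S U : T -> R) (A : R) :
  (S = blk 0 m /\ U = blk (m + p) m) \/ (S = blk (m + p) m /\ U = blk 0 m) ->
  A = blkN X h m ^+ 2 ->
  Ex P (fun w => `|S w| `^ (q - 1) * `|U w|) <=
  rho X p `^ theta * K m `^ q + A * K m `^ (q - 2).
Proof.
have [Q2 Q3] := (q2, q3).
move=> SU AE; set M := K m `^ q.
have a0 : 0 < q / 2 by lra.
have t0 : 0 < theta by rewrite divr_gt0//; lra.
have t1 : theta < 1 by rewrite ltr_pdivrMr; lra.
have mS : measurable_fun [set: T] S by case: SU => -[-> _]; exact: measurable_blk.
have mU : measurable_fun [set: T] U by case: SU => -[_ ->]; exact: measurable_blk.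
have Sb x : `|S x| <= m%:R * B by case: SU => -[-> _]; exact: blk_bounded.
have Ub x : `|U x| <= m%:R * B by case: SU => -[_ ->]; exact: blk_bounded.
have q0 : q != 0 by rewrite gt_eqF//; lra.
have MS : Ex P (fun w => `|S w| `^ q) = M.
  by rewrite /M Nq_powR//; case: SU => -[-> _] //; rewrite /Mq;
    apply: (blk_Ex Xstat mh (phi := fun x => `|x| `^ q)); exact: measurable_abs_powR.
have e w : `|S w| `^ (q - 1) * `|U w| =
    (`|S w| `^ (q / 2) * `|U w| `^ (q / 2)) `^ theta * (`|S w| `^ q) `^ (1 - theta).
  rewrite powRM ?powR_ge0// -!powRrM.
  have -> : q / 2 * theta = 1 by rewrite /theta; field.
  have -> : q * (1 - theta) = q - 2 by rewrite /theta; field.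
  rewrite powRr1// powRr1// mulrAC; congr (_ * _).
  rewrite -[X in X * _]powRr1// -powRD; first by congr (_ `^ _); ring.
  by apply/implyP => /eqP; lra.
rewrite (eq_Ex P e).
apply: le_trans.
  apply: hoelder_Ex.
  - exact: t0.
  - exact: t1.
  - by move=> w; rewrite mulr_ge0 ?powR_ge0.
  - by move=> w; rewrite powR_ge0.
  - by apply: (ibl_powR_bounded2 _ _ mS mU Sb Ub); lra.
  - by apply: (ibl_powR_bounded _ mS Sb); lra.
  - rewrite -(funext e).
    have := ibl_powR_bounded2 (r := q - 1) (s := 1) _ _ mS mU Sb Ub.
    by under eq_fun do rewrite powRr1//; apply; lra.
rewrite MS.
have mphi : measurable_fun [set: R] (fun x => `|x| `^ (q / 2)).
  exact: measurable_abs_powR.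
have sb k : sqi P (fun w => `|blk k m w| `^ (q / 2)).
  apply: (@sqi_bounded _ _ _ _ _ ((m%:R * B) `^ (q / 2))).
    by apply: measurable_abs_powR; exact: measurable_blk.
  by move=> w; rewrite ger0_norm ?powR_ge0// ler_powRl ?blk_bounded//; lra.
have N2b k : N2 P (fun w => `|blk k m w| `^ (q / 2)) = Num.sqrt M.
  congr Num.sqrt; rewrite /M Nq_powR// /Mq.
  rewrite -(blk_Ex Xstat mh k m (phi := fun x => `|x| `^ q)); last first.
    exact: measurable_abs_powR.
  by apply: eq_Ex => w; exact: powR_half_sqr.
(* As q/2 < 2, these means are controlled by the variance alone. *)
have Eb k : Ex P (fun w => `|blk k m w| `^ (q / 2)) <= A `^ (q / 2 / 2).
  rewrite AE -(N2_blk Xstat mh k m).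
  by apply: Ex_abs_powR_le; [lra|lra|exact: measurable_blk|exact: blk_bounded].
have Eb0 k : 0 <= Ex P (fun w => `|blk k m w| `^ (q / 2)).
  by apply: Ex_ge0 => w; exact: powR_ge0.
have A0 : 0 <= A by rewrite AE sqr_ge0.
have M0 : 0 <= M by exact: powR_ge0.
have mix := @mixing_blk _ _ _ P X Xstat h mh _ _ 0%N m m p mphi mphi (sb 0%N) (sb _).
rewrite !N2b -expr2 sqr_sqrtr// add0n in mix.
have Eu : Ex P (fun w => `|S w| `^ (q / 2) * `|U w| `^ (q / 2)) <=
    A `^ (q / 2) + rho X p * M.
  have -> : Ex P (fun w => `|S w| `^ (q / 2) * `|U w| `^ (q / 2)) =
      Ex P (fun w => `|blk 0 m w| `^ (q / 2) * `|blk (m + p) m w| `^ (q / 2)).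
    by case: SU => -[-> ->]//; apply: eq_Ex => w; rewrite mulrC.
  have := le_trans (ler_norm _) mix; rewrite lerBlDr => /le_trans; apply.
  rewrite addrC lerD2r.
  apply: (le_trans (ler_pM (Eb0 _) (Eb0 _) (Eb _) (Eb _))).
  rewrite -powRD; first by have -> : q / 2 / 2 + q / 2 / 2 = q / 2 by field.
  by apply/implyP => /eqP; lra.
have r0 := rho_ge0 X p.
have Eu0 : 0 <= Ex P (fun w => `|S w| `^ (q / 2) * `|U w| `^ (q / 2)).
  by apply: Ex_ge0 => w; rewrite mulr_ge0 ?powR_ge0.
exact: (powR_cross Q2 A0 r0 (Nq_ge0 _ _ _) Eu0 Eu).
Qed.

Lemma moment_pair m p :
  Mq P q (fun w => blk 0 m w + blk (m + p) m w) <=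
  2 * (1 + 3 * rho X p `^ theta) * K m `^ q +
  6 * blkN X h m ^+ 2 * K m `^ (q - 2).
Proof.
have [Q2 Q3] := (q2, q3).
have q0 : q != 0 by rewrite gt_eqF//; lra.
pose S := blk 0 m; pose U := blk (m + p) m.
have mS : measurable_fun [set: T] S by exact: measurable_blk.
have mU : measurable_fun [set: T] U by exact: measurable_blk.
have Sb x : `|S x| <= m%:R * B by exact: blk_bounded.
have Ub x : `|U x| <= m%:R * B by exact: blk_bounded.
have c1 := @moment_cross m p S U _ (or_introl (conj erefl erefl)) erefl.
have c2 := @moment_cross m p U S _ (or_intror (conj erefl erefl)) erefl.
have i1 : ibl P (fun w => `|S w| `^ (q - 1) * `|U w|).
  have := ibl_powR_bounded2 (r := q - 1) (s := 1) _ _ mS mU Sb Ub.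
  by under eq_fun do rewrite powRr1//; apply; lra.
have i2 : ibl P (fun w => `|U w| `^ (q - 1) * `|S w|).
  have := ibl_powR_bounded2 (r := q - 1) (s := 1) _ _ mU mS Ub Sb.
  by under eq_fun do rewrite powRr1//; apply; lra.
have i3 : ibl P (fun w => `|S w| `^ q) by apply: (ibl_powR_bounded _ mS Sb); lra.
have i4 : ibl P (fun w => `|U w| `^ q) by apply: (ibl_powR_bounded _ mU Ub); lra.
have i5 := iblD i3 i4; have i6 := iblD i1 i2.
have i7 := iblZ 3 i6.
have iSU : ibl P (fun w => `|S w + U w| `^ q).
  apply: (@ibl_powR_bounded _ (m%:R * B + m%:R * B)); first lra.
    exact: measurable_funD.
  by move=> x; rewrite (le_trans (ler_normD _ _))// lerD.
have MS : Ex P (fun w => `|S w| `^ q) = K m `^ q by rewrite Nq_powR.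
have MU : Ex P (fun w => `|U w| `^ q) = K m `^ q.
  rewrite Nq_powR//; apply: (blk_Ex Xstat mh (phi := fun x => `|x| `^ q)).
  exact: measurable_abs_powR.
have le1 : Mq P q (fun w => S w + U w) <= Ex P (fun w => `|S w| `^ q + `|U w| `^ q +
    3 * (`|S w| `^ (q - 1) * `|U w| + `|U w| `^ (q - 1) * `|S w|)).
  apply: le_Ex => // [|w]; first exact: iblD.
  apply: le_trans (ler_powRl _ _ (ler_normD _ _)) _ => //; first lra.
  rewrite [in leRHS](mulrC _ `|S w|).
  by apply: powRD_le => //; lra.
apply: (le_trans le1).
rewrite ExD// ExD// ExZ// ExD// MS MU.
lra.
Qed.

(** The two short blocks of [blk_double] are estimated by the triangle inequality, term by term;
    this is affordable because p will be 2^(i/4) for m = 2^i. *)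
Lemma moment_double m p :
  K (m + m) <= (2 * (1 + 3 * rho X p `^ theta)) `^ q^-1 *
    Num.sqrt (K m ^+ 2 + 3 * blkN X h m ^+ 2) + 2 * p%:R * K 1.
Proof.
have [Q2 Q3] := (q2, q3).
have q0 : q != 0 by rewrite gt_eqF//; lra.
have mb k n : measurable_fun [set: T] (blk k n) by exact: measurable_blk.
have h1 : K (m + m) <= Nq P q (fun w => blk 0 m w + blk (m + p) m w) +
    2 * p%:R * K 1.
  rewrite (_ : blk 0 (m + m) = fun w => (blk 0 m w + blk (m + p) m w) +
      (blk m p w + (- blk (m + m) p w))); last first.
    by apply/funext => w; rewrite (blk_double X h m p).
  apply: le_trans.
    apply: (@NqD_bounded _ _ (m%:R * B + m%:R * B) (p%:R * B + p%:R * B)).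
    - exact: measurable_funD.
    - by apply: measurable_funD => //; exact: measurableT_comp.
    - by move=> x; rewrite (le_trans (ler_normD _ _))// lerD// blk_bounded.
    - by move=> x; rewrite (le_trans (ler_normD _ _))// normrN lerD// blk_bounded.
  rewrite lerD2l; apply: le_trans.
    apply: (@NqD_bounded _ _ (p%:R * B) (p%:R * B)) => //.
    - exact: measurableT_comp.
    - by move=> x; rewrite blk_bounded.
    - by move=> x; rewrite normrN blk_bounded.
  rewrite NqN (Nq_blk m) (Nq_blk (m + m)).
  apply: le_trans (lerD (Nq_blk_le p) (Nq_blk_le p)) _.
  by rewrite -mulrA [leRHS]mulr_natl mulr2n.
apply: (le_trans h1); rewrite lerD2r.
have al1 : 1 <= 1 + 3 * rho X p `^ theta by rewrite lerDl mulr_ge0// powR_ge0.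
apply: (moment_arith q2 al1 (sqr_ge0 _) (Nq_ge0 _ _ _) (Mq_ge0 _ _ _)).
exact: moment_pair.
Qed.

End moment_recursion.

(** * Recursive inequalities for real sequences *)

Section sequences.
Context {R : realType}.
Implicit Types u x y s : nat -> R.

(** One-sided, because it is applied to nonnegative sequences. *)
Definition null_seq u : Prop :=
  forall e : R, 0 < e -> exists N, forall n, (N <= n)%N -> u n <= e.

Lemma null_seq_comp u (f : nat -> nat) : null_seq u ->
  (forall M, exists N, forall n, (N <= n)%N -> (M <= f n)%N) -> null_seq (u \o f).
Proof.
move=> u0 f_oo e /u0[M uM]; have [N fN] := f_oo M.
by exists N => n /fN /uM.
Qed.

Lemma null_seq_geo (c : R) : 0 <= c -> c < 1 -> null_seq (fun n => c ^+ n).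
Proof.
move=> c0 c1 e e0; have nc : `|c| < 1 by rewrite ger0_norm.
have := cvg_expr nc => /cvgrPdist_le/(_ e e0)[N _ HN].
by exists N => n /HN /=; rewrite sub0r normrN ger0_norm// exprn_ge0.
Qed.

Lemma null_seqZ (c : R) u : 0 <= c -> null_seq u -> null_seq (fun n => c * u n).
Proof.
move=> c0 hu e e0; have [N HN] := hu (e / (c + 1)) (divr_gt0 e0 (ltr_wpDl c0 ltr01)).
exists N => n /HN h; have := ler_wpM2l c0 h; move/le_trans; apply.
by rewrite mulrCA ler_piMr ?(ltW e0)// ler_pdivrMr ?mul1r ?lerDl// ltr_wpDl.
Qed.

Lemma ev_max (f : nat -> R) N (c : R) :
  (forall n, (N <= n)%N -> f n <= c) -> exists C, 0 < C /\ forall n, f n <= C.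
Proof.
move=> fc; exists (1 + `|c| + \sum_(i < N) `|f i|); split.
  by rewrite ltr_wpDr ?sumr_ge0// ltr_wpDr.
move=> n; have [Nn|nN] := leqP N n.
  rewrite (le_trans (fc _ Nn))// -addrA [leRHS]addrCA ler_wpDr ?ler_norm//.
  by rewrite addr_ge0// sumr_ge0.
rewrite (bigD1 (Ordinal nN))//= [leRHS]addrCA ler_wpDr ?ler_norm//.
by rewrite addr_ge0// ?addr_ge0// sumr_ge0.
Qed.

Lemma ev_min (f : nat -> R) N (c : R) : 0 < c -> (forall n, 0 < f n) ->
  (forall n, (N <= n)%N -> c <= f n) -> exists c', 0 < c' /\ forall n, c' <= f n.
Proof.
move=> c0 f0 fc; have [|C [C0 HC]] := @ev_max (fun n => (f n)^-1) N c^-1.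
  by move=> n /fc h; rewrite lef_pV2 ?posrE.
exists C^-1; split; first by rewrite invr_gt0.
by move=> n; rewrite -[leRHS]invrK lef_pV2 ?posrE ?invr_gt0.
Qed.

(** A Cesaro argument. It will show that exponentials of sums of the rho(2^i) are smaller than any
    power of 2^n. *)
Lemma sum_null_seq u (e : R) : null_seq u -> 0 < e ->
  exists C, 0 < C /\ forall n, \sum_(i < n) u i <= C + e * n%:R.
Proof.
move=> u0 e0; have [N uN] := u0 e e0.
have [|C [C0 HC]] := @ev_max (fun n => \sum_(i < n) u i - e * n%:R) N
    (\sum_(i < N) u i).
  move=> n; elim: n => [|n IHn].
    by rewrite leqn0 => /eqP ->; rewrite !big_ord0 mulr0 subr0.
  rewrite leq_eqVlt => /predU1P[->|]; first by rewrite lerBlDr lerDl mulr_ge0 ?ltW.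
  rewrite ltnS => Nn; have := IHn Nn; have := uN _ Nn.
  rewrite big_ord_recr/= -natr1 mulrDr mulr1; lra.
by exists C; split => // n; have := HC n; rewrite lerBlDr.
Qed.

(** Variation of constants: x_r / W_r increases by at most be_r / W_(r+1) in one step. *)
Lemma linear_recursion (a be x : nat -> R) (W := fun r => \prod_(i < r) a i) :
  (forall i, 0 < a i) -> (forall i, x i.+1 <= a i * x i + be i) ->
  forall r, x r <= W r * (x 0%N + \sum_(i < r) be i / W i.+1).
Proof.
move=> a0 xr.
have W0 i : 0 < W i by exact: prodr_gt0.
have WS i : W i.+1 = a i * W i by rewrite /W big_ord_recr mulrC.
have W1 : W 0%N = 1 by rewrite /W big_ord0.
clearbody W; elim=> [|r IHr]; first by rewrite W1 !big_ord0 mul1r addr0.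
apply: (le_trans (xr r)).
apply: le_trans (lerD (ler_wpM2l (ltW (a0 r)) IHr) (lexx _)) _.
have e1 : W r.+1 * (be r / W r.+1) = be r by rewrite mulrCA divff ?mulr1// gt_eqF.
by rewrite big_ord_recr /= addrA [leRHS]mulrDr e1 {1}WS -mulrA.
Qed.

Lemma sum_geo (c : R) n : 0 <= c -> c < 1 -> \sum_(i < n) c ^+ i <= (1 - c)^-1.
Proof.
move=> c0 c1; have h : 0 < 1 - c by lra.
rewrite -[leLHS](mulfK (lt0r_neq0 h)) ler_pdivrMr// mulVf ?gt_eqF//.
rewrite mulrC -opprB mulNr -subrX1 opprB lerBlDr lerDl exprn_ge0//.
Qed.

Lemma sum_growth (z : nat -> R) (la : R) N : 1 < la -> (forall n, 0 < z n) ->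
  (forall n, (N <= n)%N -> la * z n <= z n.+1) ->
  exists C, 0 < C /\ forall r, \sum_(i < r.+1) z i <= C * z r.
Proof.
move=> la1 z0 zla.
(* If D bounds the ratio at n, then D / la + 1 bounds it at n + 1, and this is at most D once D >=
   la / (la - 1). The second summand covers the start at N. *)
pose D := la / (la - 1) + (\sum_(i < N.+1) z i) / z N.
have D1 : la / (la - 1) <= D.
  by rewrite lerDl divr_ge0// ?sumr_ge0// => *; exact: ltW.
have laD : 0 < la / (la - 1) by rewrite divr_gt0; lra.
have [|C [C0 HC]] := @ev_max (fun r => (\sum_(i < r.+1) z i) / z r) N D.
  elim=> [|n IHn].
    rewrite leqn0 => /eqP N0; rewrite /D N0; rewrite lerDr; exact: ltW.
  rewrite leq_eqVlt => /predU1P[N0|]; first by rewrite /D N0 lerDr ltW.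
  rewrite ltnS => Nn; have h := zla _ Nn; have := IHn Nn.
  rewrite !ler_pdivrMr// => h2; rewrite big_ord_recr /=.
  have D0 : 0 <= D by exact: le_trans (ltW laD) D1.
  apply: (le_trans (lerD h2 (lexx _))).
  rewrite -lerBrDr -[X in _ - X]mul1r -mulrBl.
  have h3 : la / (la - 1) * (la - 1) <= D * (la - 1) by rewrite ler_wpM2r//; lra.
  rewrite divfK in h3; last by rewrite gt_eqF; lra.
  have D1' : 0 <= D - 1 by nra.
  apply: le_trans (ler_wpM2l D1' h).
  rewrite mulrA ler_wpM2r ?(ltW (z0 n))//; lra.
by exists C; split => // r; rewrite -ler_pdivrMr.
Qed.

(** Group the i by fours. The four terms from i = 4Q on have indices at least aQ, and r(aQ) is at
    most the mean of the a values of r at the indices ending with aQ; the first group gives 4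
    r(0). *)
Lemma sum_gap (r : nat -> R) (a n : nat) : (0 < a)%N -> (a <= 4)%N ->
  (forall i, 0 <= r i) -> (forall i j, (i <= j)%N -> r j <= r i) ->
  \sum_(i < n) r (a * i %/ 4)%N <= 4 * r 0%N + 4 / a%:R * \sum_(1 <= j < n.+1) r j.
Proof.
move=> a0 a4 r0 rd.
have aR : (0 : R) < a%:R by rewrite ltr0n.
have H Q : \sum_(0 <= i < 4 * Q.+1) r (a * i %/ 4)%N <=
    4 * r 0%N + 4 / a%:R * \sum_(1 <= j < (a * Q).+1) r j.
  elim: Q => [|Q IHQ].
    rewrite muln0 [X in _ + _ * X]big_geq// mulr0 addr0.
    rewrite !big_nat_recr//= big_geq// add0r; have := rd 0%N; move=> h.
    have := h (a * 0 %/ 4)%N (leq0n _); have := h (a * 1 %/ 4)%N (leq0n _).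
    have := h (a * 2 %/ 4)%N (leq0n _); have := h (a * 3 %/ 4)%N (leq0n _).
    lra.
  rewrite (big_cat_nat (n := 4 * Q.+1))//=; last by rewrite leq_mul2l ltnW.
  rewrite [in leRHS](big_cat_nat (n := (a * Q).+1))//=; last first.
    by rewrite ltnS leq_mul2l leqnSn orbT.
  rewrite mulrDr addrA lerD//.
  have h1 : \sum_(4 * Q.+1 <= i < 4 * Q.+2) r (a * i %/ 4)%N <= 4 * r (a * Q.+1)%N.
    apply: (@le_trans _ _ (\sum_(4 * Q.+1 <= i < 4 * Q.+2) r (a * Q.+1)%N)).
      rewrite [leLHS]big_nat_cond [leRHS]big_nat_cond.
      apply: ler_sum => i /andP[/andP[h _] _]; apply: rd.
      rewrite leq_divRL//; apply: (@leq_trans (a * (4 * Q.+1))%N); first by lia.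
      by rewrite leq_mul2l h orbT.
    rewrite big_const_nat iter_addr_0 (_ : (4 * Q.+2 - 4 * Q.+1)%N = 4%N); last lia.
    by rewrite mulr_natl.
  have h2 : a%:R * r (a * Q.+1)%N <= \sum_((a * Q).+1 <= j < (a * Q.+1).+1) r j.
    apply: (@le_trans _ _ (\sum_((a * Q).+1 <= j < (a * Q.+1).+1) r (a * Q.+1)%N)).
      rewrite big_const_nat iter_addr_0 (_ : ((a * Q.+1).+1 - (a * Q).+1)%N = a).
        by rewrite mulr_natl.
      by rewrite mulnS; lia.
    rewrite [leLHS]big_nat_cond [leRHS]big_nat_cond.
    by apply: ler_sum => i /andP[/andP[_ h] _]; apply: rd.
  apply: (le_trans h1).
  have c0 : (0 : R) <= 4 / a%:R by rewrite divr_ge0// ltW.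
  have := ler_wpM2l c0 h2; rewrite mulrA divfK ?gt_eqF//.
have mono (f : nat -> R) i m k : (forall j, 0 <= f j) -> (m <= k)%N ->
    \sum_(i <= j < m) f j <= \sum_(i <= j < k) f j.
  move=> f0 mk; have [im|mi] := leqP i m.
    by rewrite [leRHS](big_cat_nat (n := m))//= lerDl sumr_ge0.
  by rewrite big_geq ?sumr_ge0// ltnW.
rewrite -(big_mkord xpredT (fun i => r (a * i %/ 4)%N)).
have nQ : (n <= 4 * (n %/ 4).+1)%N by rewrite ltnW// mulnC ltn_ceil.
apply: (le_trans (mono _ 0%N _ _ _ nQ)) => //.
apply: (le_trans (H _)); rewrite lerD2l ler_wpM2l ?divr_ge0//.
apply: mono => //; rewrite ltnS; apply: (@leq_trans (4 * (n %/ 4))%N).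
  by rewrite leq_mul2r a4 orbT.
by rewrite mulnC leq_trunc_div.
Qed.

(** For s >= 0 small, 1 / (1 - s) <= 1 + 21/20 s holds exactly up to s = 1/21; then use 1 + x <= exp
    x. *)
Lemma oneB_ge_expR (s : R) : 0 <= s -> s <= 21^-1 ->
  expR (- (21 / 20 * s)) <= 1 - s.
Proof.
move=> s0 s1; rewrite expRN -[leRHS]invrK lef_pV2 ?posrE ?expR_gt0 ?invr_gt0//; last lra.
apply: le_trans (expR_ge1Dx _).
have h : 0 < 1 - s by lra.
rewrite -[leLHS]mul1r ler_pdivrMr//; nra.
Qed.

Lemma oneB_ge_expR2 (s : R) : 0 <= s -> s <= 2^-1 -> expR (- (2 * s)) <= 1 - s.
Proof.
move=> s0 s1; rewrite expRN -[leRHS]invrK lef_pV2 ?posrE ?expR_gt0 ?invr_gt0//; last lra.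
apply: le_trans (expR_ge1Dx _).
have h : 0 < 1 - s by lra.
rewrite -[leLHS]mul1r ler_pdivrMr//; nra.
Qed.

End sequences.

(** * Crude and sharp growth of sequences satisfying the doubling inequalities *)

Section dyadic_recursions.
Context {R : realType}.

(* In base [2^(1/48)] the crude rates of growth used below (exponents 23/48, 28/48 and
   the gaps 1/4, 3/4) are integer powers. *)
Definition b48 : R := 2 `^ (48^-1).
Local Notation b := b48.

Lemma b48_gt0 : 0 < b. Proof. exact: powR_gt0. Qed.

Lemma b48X : b ^+ 48 = 2.
Proof. by rewrite -powR_mulrn ?powR_ge0// -powRrM mulVf ?powRr1. Qed.

Lemma b48_gt1 : 1 < b.
Proof.
rewrite ltNge; apply/negP => b1.
have := exprn_ile1 48 (ltW b48_gt0) b1; rewrite b48X; lra.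
Qed.

Let b0 := b48_gt0.
Let b1 := b48_gt1.

Lemma b48_le m n : (m <= n)%N -> b ^+ m <= b ^+ n.
Proof. by move=> mn; apply: ler_weXn2l => //; exact: ltW. Qed.

Lemma exp2_b48 k : (2 : R) ^+ k = b ^+ (48 * k).
Proof. by rewrite exprM b48X. Qed.

Lemma null_seq_b48 (C : R) k : (0 < k)%N -> 0 <= C ->
  null_seq (fun i => C * (b ^- k) ^+ i).
Proof.
move=> k0 C0; apply: null_seqZ => //; apply: null_seq_geo.
  by rewrite invr_ge0 exprn_ge0// ltW.
by rewrite invf_lt1 ?exprn_gt0// exprn_egt1// -lt0n.
Qed.

(** The factor sqrt 2 is b^24. Once 1 + t_i <= b^4, one step multiplies by at most b^26, and the
    slack up to b^28 absorbs the gap term, of size 2^(i/4). Before that index the bound 2^i x_0 is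
    used. The constant depends on t only and so serves all truncated functions at once. *)
Lemma crude_growth (t : nat -> R) : (forall i, 0 <= t i) -> null_seq t ->
  exists C, 0 < C /\ forall x : nat -> R, (forall i, 0 <= x i) ->
    (forall i, x i <= 2 ^+ i * x 0%N) ->
    (forall i, x i.+1 <= Num.sqrt (2 * (1 + t i)) * x i +
                         2 * (2 ^+ (i %/ 4) * x 0%N)) ->
    forall i, x i <= C * b ^+ (28 * i) * x 0%N.
Proof.
move=> t0 tn.
have b4 : 0 < b ^+ 4 - 1 by rewrite subr_gt0 exprn_egt1.
have [N HN] := tn _ b4.
have b28 : 0 < b ^+ 28 - b ^+ 26 by rewrite subr_gt0 ltr_eXn2l.
pose C := 2 ^+ N + 2 / (b ^+ 28 - b ^+ 26).
have C2 : 2 / (b ^+ 28 - b ^+ 26) <= C by rewrite lerDr exprn_ge0.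
have C0 : 0 < C by rewrite (lt_le_trans _ C2)// divr_gt0.
exists C; split=> // x x0 xle xr i.
have small j : (j <= N)%N -> x j <= C * b ^+ (28 * j) * x 0%N.
  move=> jN; apply: (le_trans (xle j)); apply: ler_wpM2r => //.
  apply: (@le_trans _ _ C); last first.
    by rewrite ler_peMr ?(ltW C0)// exprn_ege1// ltW.
  apply: (@le_trans _ _ (2 ^+ N)); first by rewrite ler_eXn2l// ltr1n.
  by rewrite lerDl divr_ge0// ltW.
have [/small//|/ltnW] := leqP i N.
elim: i => [|i IHi]; first by move=> h; apply: small.
rewrite leq_eqVlt => /predU1P[e|Ni]; first by apply: small; rewrite e.
rewrite ltnS in Ni; apply: (le_trans (xr i)).
have sq : Num.sqrt (2 * (1 + t i)) <= b ^+ 26.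
  rewrite -[leRHS](ger0_norm (exprn_ge0 26 (ltW b0))) -sqrtr_sqr ler_sqrt.
    rewrite -exprM (_ : (26 * 2 = 48 + 4)%N)// exprD b48X.
    have := HN i Ni; rewrite lerBrDl; lra.
  exact: sqr_ge0.
have h1 := ler_pM (sqrtr_ge0 _) (x0 i) sq (IHi Ni).
apply: (le_trans (lerD h1 (lexx _))).
have h2 : (2 : R) ^+ (i %/ 4) <= b ^+ (28 * i).
  rewrite exp2_b48 b48_le//; have := leq_trunc_div i 4.
    by move: (i %/ 4)%N => k; clear; lia.
have h3 : 2 <= C * (b ^+ 28 - b ^+ 26) by rewrite -ler_pdivrMr.
rewrite !mulrA -mulrDl ler_wpM2r// mulnS exprD.
have h4 := ler_wpM2l (ler0n R 2) h2.
have h5 := ler_wpM2r (exprn_ge0 (28 * i) (ltW b0)) h3.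
apply: (le_trans (lerD (lexx _) (le_trans h4 h5))).
rewrite le_eqVlt; apply/orP; left; apply/eqP; ring.
Qed.

(** By the crude bound the gap terms are of size b^(21i), while the products of the factors are at
    least b^(24i): relative to these products the gap terms form a geometric series of ratio b^(-3).
    What remains is the product of the 2 (1 + s_i). *)
Lemma sharp_upper (s : nat -> R) (C0 : R) : (forall i, 0 <= s i) -> 0 <= C0 ->
  exists C, 0 < C /\ forall x : nat -> R, (forall i, 0 <= x i) ->
    (forall i, x i.+1 <= Num.sqrt (2 * (1 + s i)) * x i +
                         2 * (C0 * b ^+ (28 * (3 * i %/ 4)) * x 0%N)) ->
    forall r, x r ^+ 2 <= C * (2 ^+ r * expR (\sum_(i < r) s i) * x 0%N ^+ 2).
Proof.
move=> s0 C00.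
pose D := 1 + 2 * C0 * (1 - b ^- 3)^-1.
have b3 : 0 < b ^- 3 by rewrite invr_gt0 exprn_gt0.
have b31 : b ^- 3 < 1 by rewrite invf_lt1 ?exprn_gt0// exprn_egt1.
have D1 : 1 <= D by rewrite /D lerDl !mulr_ge0// invr_ge0 subr_ge0 ltW.
exists (D ^+ 2); split; first by rewrite exprn_gt0//; lra.
move=> x x0 xr r.
pose al i := Num.sqrt (2 * (1 + s i)); pose W r := \prod_(i < r) al i.
have al0 i : 0 < al i by rewrite sqrtr_gt0; have := s0 i; lra.
have alb i : b ^+ 24 <= al i.
  rewrite -[leLHS](ger0_norm (exprn_ge0 24 (ltW b0))) -sqrtr_sqr ler_sqrt.
    by rewrite -exprM b48X; have := s0 i; lra.
  by have := s0 i; lra.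
have Wb j : b ^+ (24 * j) <= W j.
  elim: j => [|j IHj]; first by rewrite muln0 /W big_ord0.
  rewrite /W big_ord_recr mulnS exprD mulrC.
  by apply: ler_pM => //; rewrite exprn_ge0// ltW.
have W0 j : 0 < W j by apply: prodr_gt0.
have h := linear_recursion al0 xr r.
have h2 : \sum_(i < r) 2 * (C0 * b ^+ (28 * (3 * i %/ 4)) * x 0%N) / W i.+1 <=
    2 * C0 * (1 - b ^- 3)^-1 * x 0%N.
  apply: (@le_trans _ _ (\sum_(i < r) (2 * C0 * x 0%N) * (b ^- 3) ^+ i)).
    apply: ler_sum => i _; rewrite ler_pdivrMr//.
    rewrite -!mulrA ler_wpM2l// ler_wpM2l//.
    rewrite mulrC ler_wpM2l//.
    apply: (@le_trans _ _ ((b ^- 3) ^+ i * b ^+ (24 * i.+1))); last first.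
      by rewrite ler_wpM2l// exprn_ge0// ltW.
    rewrite exprVn -exprM mulrC ler_pdivlMr ?exprn_gt0// -exprD b48_le//.
    by have := leq_trunc_div (3 * i) 4; move: (3 * i %/ 4)%N => k; clear; lia.
  rewrite -mulr_sumr -!mulrA ler_wpM2l// ler_wpM2l// mulrC ler_wpM2r//.
  by apply: sum_geo => //; exact: ltW.
have h3 : x r <= W r * (D * x 0%N).
  apply: (le_trans h); rewrite (ler_wpM2l (ltW (W0 _)))// /D mulrDl mul1r.
  by rewrite lerD2l.
have h4 : x r ^+ 2 <= (W r * (D * x 0%N)) ^+ 2.
  by rewrite ler_sqr ?nnegrE// !mulr_ge0//; [exact: ltW|lra].
apply: (le_trans h4); rewrite !exprMn mulrCA ler_wpM2l ?sqr_ge0// ler_wpM2r ?sqr_ge0//.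
rewrite /W -prodrXl.
elim: r {h h2 h3 h4} => [|r IHr]; first by rewrite !big_ord0 expR0 mul1r.
rewrite !big_ord_recr/= [2 ^+ r.+1]exprSr expRD [leRHS]mulrACA.
apply: ler_pM => //; [by apply: prodr_ge0 => i _; exact: sqr_ge0|exact: sqr_ge0|].
rewrite /al sqr_sqrtr; last by have := s0 r; lra.
by rewrite ler_pM2l// expR_ge1Dx.
Qed.

Section lower.
Variables (s y : nat -> R) (C0 c : R).
Hypotheses (s0 : forall i, 0 <= s i) (sn : null_seq s) (C00 : 0 <= C0) (c0 : 0 < c).
Hypothesis yb : forall i, c * b ^+ (23 * i) <= y i.
Hypothesis yr : forall i, Num.sqrt (2 * (1 - s i)) * y i -
  2 * (C0 * b ^+ (28 * (3 * i %/ 4)) * y 0%N) <= y i.+1.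

Let y_gt0 i : 0 < y i.
Proof. by apply: lt_le_trans (yb i); rewrite mulr_gt0// exprn_gt0. Qed.

Let C1 : R := 2 * C0 * y 0%N / c.
(** Relative size of the gap term: b^(21i) against the a priori lower bound b^(23i). *)
Let z i : R := C1 * (b ^- 2) ^+ i.

Let C10 : 0 <= C1.
Proof. by rewrite divr_ge0 ?(ltW c0)// !mulr_ge0// ltW. Qed.

Let z0 i : 0 <= z i.
Proof. by rewrite mulr_ge0// exprn_ge0// invr_ge0 exprn_ge0// ltW. Qed.

Let gap i : 2 * (C0 * b ^+ (28 * (3 * i %/ 4)) * y 0%N) <= z i * y i.
Proof.
apply: le_trans (ler_wpM2l (z0 i) (yb i)).
rewrite /z /C1 (_ : _ * y 0%N / c * _ * _ = 2 * (C0 * ((b ^- 2) ^+ i * b ^+ (23 * i)) * y 0%N));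
  last by field; rewrite gt_eqF.
rewrite ler_pM2l// ler_wpM2r ?(ltW (y_gt0 _))// ler_wpM2l//.
rewrite exprVn -exprM mulrC ler_pdivlMr ?exprn_gt0// -exprD b48_le//.
by have := leq_trunc_div (3 * i) 4; move: (3 * i %/ 4)%N => k; clear; lia.
Qed.

Let lt21 : (0 : R) < 21^-1. Proof. by rewrite invr_gt0. Qed.
Let lt2 : (0 : R) < 2^-1. Proof. by rewrite invr_gt0. Qed.

(** For small s_i the factor sqrt(2 (1 - s_i)) is at least 1, so the subtracted gap term may be
    moved inside it and becomes the factor 1 - z_i. *)
Lemma lower_step : exists N, forall i, (N <= i)%N ->
  2 * (1 - s i) * (1 - z i) ^+ 2 * y i ^+ 2 <= y i.+1 ^+ 2 /\ s i <= 21^-1 /\ z i <= 2^-1.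
Proof.
have [N1 H1] := sn lt21.
have [N2 H2] := null_seq_b48 (k := 2) isT C10 lt2.
exists (N1 + N2)%N => i Ni.
have h1 : s i <= 21^-1 by apply: H1; move: Ni; clear; lia.
have h2 : z i <= 2^-1 by apply: H2; move: Ni; clear; lia.
split => //.
have s1 : 1 <= 2 * (1 - s i) by lra.
have q1 : 1 <= Num.sqrt (2 * (1 - s i)).
  by rewrite -[leLHS]sqrtr1 ler_sqrt//; lra.
have z1 : 0 <= 1 - z i by lra.
have h3 : Num.sqrt (2 * (1 - s i)) * (1 - z i) * y i <= y i.+1.
  apply: le_trans (yr i).
  apply: (@le_trans _ _ (Num.sqrt (2 * (1 - s i)) * y i - z i * y i)).
    rewrite mulrBr mulr1 mulrBl lerD2l lerN2 ler_wpM2r ?(ltW (y_gt0 _))//.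
    by rewrite ler_peMl.
  by rewrite lerD2l lerN2.
have : (Num.sqrt (2 * (1 - s i)) * (1 - z i) * y i) ^+ 2 <= y i.+1 ^+ 2.
  by rewrite ler_sqr ?nnegrE ?(ltW (y_gt0 _))// !mulr_ge0 ?sqrtr_ge0// ltW.
rewrite exprMn exprMn sqr_sqrtr//; lra.
Qed.

(** Growth in every single step, not only on average, is what makes sums over i comparable with
    their last term, through [sum_growth]. *)
Lemma lower_growth (e : R) : 0 < e -> exists N, forall i, (N <= i)%N ->
  (2 - e) * y i ^+ 2 <= y i.+1 ^+ 2.
Proof.
move=> e0; have [N HN] := lower_step.
have e8 : 0 < e / 8 by rewrite divr_gt0.
have [N1 H1] := sn e8; have [N2 H2] := null_seq_b48 (k := 2) isT C10 e8.
exists (N + N1 + N2)%N => i Ni.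
have [h [h1 h2]] : 2 * (1 - s i) * (1 - z i) ^+ 2 * y i ^+ 2 <= y i.+1 ^+ 2 /\
  s i <= 21^-1 /\ z i <= 2^-1 by apply: HN; move: Ni; clear; lia.
apply: le_trans h; rewrite ler_wpM2r ?sqr_ge0//.
have h3 : s i <= e / 8 by apply: H1; move: Ni; clear; lia.
have h4 : z i <= e / 8 by apply: H2; move: Ni; clear; lia.
have h5 := s0 i; have h6 := z0 i.
move: (s i) (z i) h1 h2 h3 h4 h5 h6 => s' z' h1 h2 h3 h4 h5 h6.
nra.
Qed.

(* Any constant above 1 would do in place of [21/20], as long as, with the gaps
   [2^(3i/4)], one has [4/3 * (1 + 21/20) <= 14/5]. *)
Lemma sharp_lower : exists c', 0 < c' /\ forall r,
  c' * (2 ^+ r * expR (- (21 / 20 * \sum_(i < r) s i))) <= y r ^+ 2.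
Proof.
have [N HN] := lower_step.
pose f r := y r ^+ 2 / (2 ^+ r * expR (- (21 / 20 * \sum_(i < r) s i))).
pose Z r := \sum_(i < r) z i.
have f0 r : 0 < f r by rewrite divr_gt0 ?exprn_gt0// mulr_gt0 ?exprn_gt0 ?expR_gt0.
have fS r : (N <= r)%N -> f r * expR (- (4 * z r)) <= f r.+1.
  move=> /HN[h [h1 h2]]; rewrite /f big_ord_recr /= mulrDr opprD expRD [2 ^+ r.+1]exprS.
  have e0 := expR_gt0 (- (21 / 20 * \sum_(i < r) s i)).
  have t0 : (0 : R) < 2 ^+ r by rewrite exprn_gt0.
  have s0' := s0 r; have z0' := z0 r.
  move: (expR (- (21 / 20 * \sum_(i < r) s i))) (2 ^+ r) e0 t0 => E T e0 t0.
  have g1 := oneB_ge_expR s0' h1; have g2 := oneB_ge_expR2 z0' h2.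
  have g3 : expR (- (4 * z r)) <= (1 - z r) ^+ 2.
    rewrite (_ : 4 * z r = 2 * z r + 2 * z r); last by lra.
    by rewrite opprD expRD -expr2 ler_sqr ?nnegrE ?expR_ge0// (le_trans _ g2) ?expR_ge0.
  have g0 := expR_gt0 (- (21 / 20 * s r)).
  move: (expR (- (21 / 20 * s r))) g0 g1 => E1 g0 g1.
  rewrite ler_pdivlMr ?mulr_gt0//.
  rewrite [leLHS](_ : _ = 2 * E1 * expR (- (4 * z r)) * y r ^+ 2); last first.
    by field; rewrite ?gt_eqF.
  apply: le_trans h; rewrite ler_wpM2r ?sqr_ge0//.
  by apply: ler_pM; rewrite ?expR_ge0 ?mulr_ge0 ?(ltW g0)// ler_pM2l.
have fZ r : (N <= r)%N -> f N * expR (- (4 * Z r)) <= f r.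
  elim: r => [|r IHr].
    rewrite leqn0 => /eqP ->; rewrite /Z big_ord0 mulr0 oppr0 expR0 mulr1//.
  rewrite leq_eqVlt => /predU1P[<-|].
    rewrite ler_piMr ?(ltW (f0 _))// -[leRHS]expR0 ler_expR oppr_le0 mulr_ge0//.
    by rewrite sumr_ge0.
  rewrite ltnS => Nr; apply: le_trans (fS _ Nr).
  rewrite /Z big_ord_recr /= mulrDr opprD expRD mulrA.
  by rewrite ler_wpM2r ?expR_ge0// IHr.
have b2 : 0 <= b ^- 2 by rewrite invr_ge0 exprn_ge0// ltW.
have b21 : b ^- 2 < 1 by rewrite invf_lt1 ?exprn_gt0// exprn_egt1.
(* All the factors (1 - z_i)^2 together lose at most exp(-4 sum z_i), and the sum of the z_i is a
   convergent geometric series. *)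
have [|||c' [c'0 Hc]] := @ev_min _ f N (f N * expR (- (4 * (C1 * (1 - b ^- 2)^-1)))).
- by rewrite mulr_gt0 ?expR_gt0.
- exact: f0.
- move=> n Nn; apply: le_trans (fZ n Nn).
  rewrite ler_pM2l// ler_expR lerN2 ler_pM2l//.
  by rewrite /Z -mulr_sumr ler_wpM2l// sum_geo.
exists c'; split => // r; rewrite -ler_pdivlMr; first exact: Hc.
by rewrite mulr_gt0 ?exprn_gt0 ?expR_gt0.
Qed.

End lower.

End dyadic_recursions.

(** * Solution of the recursion for the norms of order q *)

Section moment_sequence.
Context {R : realType}.
Local Notation b := (@b48 R).

(** The triangle inequality in the plane for the vectors (x, sqrt a) and (e, 0). *)
Lemma sqrt_shift (x e a : R) : 0 <= x -> 0 <= e -> 0 <= a ->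
  Num.sqrt ((x + e) ^+ 2 + a) <= Num.sqrt (x ^+ 2 + a) + e.
Proof.
move=> x0 e0 a0.
rewrite -ler_sqr ?nnegrE ?addr_ge0 ?sqrtr_ge0//.
have h1 : 0 <= (x + e) ^+ 2 + a by rewrite addr_ge0 ?sqr_ge0.
have h2 : 0 <= x ^+ 2 + a by rewrite addr_ge0 ?sqr_ge0.
rewrite (sqr_sqrtr h1) [leRHS]sqrrD (sqr_sqrtr h2).
have h3 : x <= Num.sqrt (x ^+ 2 + a).
  by rewrite -[leLHS](ger0_norm x0) -sqrtr_sqr ler_sqrt// lerDl.
have h4 := ler_wpM2r e0 h3; rewrite -mulr_natl; lra.
Qed.

(** Division by w_i, the product of the factors, turns the variance terms into multiples of A_j /
    w_j^2, at most of order z_j = y_j^2 / w_j^2. As q > 2, w_j^2 grows by about 2^(2/q) < 2 per step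
    and y_j^2 by nearly 2; hence z grows geometrically, its sum is of the order of z_r, and its
    contribution to K_r is of order y_r. The bound on A is asked for i < r only, because A will come
    from a truncation whose level depends on r. *)
Lemma moment_bound (q : R) (tau y : nat -> R) (CA : R) : 2 < q -> q <= 3 ->
  (forall i, 0 <= tau i) -> null_seq tau -> 0 < CA -> (forall i, 0 < y i) ->
  (forall e, 0 < e -> exists N, forall i, (N <= i)%N ->
     (2 - e) * y i ^+ 2 <= y i.+1 ^+ 2) ->
  exists C, 0 < C /\ forall (r : nat) (K A : nat -> R), (forall i, 0 <= K i) ->
    (forall i, 0 <= A i) -> (forall i, (i < r)%N -> A i <= CA * y i ^+ 2) ->
    (forall i, K i.+1 <= (2 * (1 + 3 * tau i)) `^ q^-1 *
      Num.sqrt (K i ^+ 2 + 3 * A i) + 2 * 2 ^+ (i %/ 4) * K 0%N) ->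
    K r <= C * ((\prod_(i < r) (2 * (1 + 3 * tau i)) `^ q^-1) * K 0%N + y r).
Proof.
move=> q2 q3 tau0 taun CA0 y0 ygr.
have q0 : q != 0 by rewrite gt_eqF//; lra.
have b0 := @b48_gt0 R; have b1 := @b48_gt1 R.
pose al i := (2 * (1 + 3 * tau i)) `^ q^-1.
pose w r := \prod_(i < r) al i.
have al1 i : 1 <= 2 * (1 + 3 * tau i) by have := tau0 i; lra.
have al0 i : 0 < al i by rewrite powR_gt0// (lt_le_trans ltr01).
have w0 i : 0 < w i by apply: prodr_gt0.
have wS i : w i.+1 = w i * al i by rewrite /w big_ord_recr.
(* As q <= 3, 2^(1/q) >= 2^(1/3) = b^16, which beats the gap terms, of size 2^(i/4) <= b^(12i). *)
have alb i : b ^+ 16 <= al i.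
  rewrite -powR_mulrn ?(ltW b0)// /b48 -powRrM.
  apply: (@le_trans _ _ (2 `^ q^-1)).
    apply: ler_powR; first by rewrite ler1n.
    rewrite (_ : 48^-1 * 16%:R = 3^-1); last by field.
    by rewrite lef_pV2 ?posrE//; lra.
  apply: ler_powRl; rewrite ?invr_ge0//; first lra.
  by have := tau0 i; lra.
have wb j : b ^+ (16 * j) <= w j.
  elim: j => [|j IHj]; first by rewrite muln0 /w big_ord0.
  by rewrite wS mulnS exprD mulrC; apply: ler_pM => //; rewrite exprn_ge0// ltW.
pose z i := y i ^+ 2 / w i ^+ 2.
have z0 i : 0 < z i by rewrite divr_gt0// exprn_gt0.
pose Q : R := 2 `^ (2 / q).
have Q1 : 1 <= Q by rewrite /Q -[leLHS](powRr0 2) ler_powR ?ler1n// divr_ge0//; lra.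
have Q2 : Q < 2.
  rewrite -[ltRHS]powRr1// /Q /powR (negbTE (lt0r_neq0 _)) ?ltr0n// ltr_expR.
  rewrite ltr_pM2r ?ln_gt0 ?ltr1n//; rewrite ltr_pdivrMr ?mul1r//; lra.
(* Then Q = 2 - 2e and (1 + e/8)^2 Q <= 2 - e: one factor 1 + e/8 is for the perturbation by tau,
   the other is the growth of z. *)
pose e := (2 - Q) / 2.
have e0 : 0 < e by rewrite /e; lra.
have e1 : e <= 1 by rewrite /e; lra.
have [N1 H1] := ygr _ e0.
have e24 : 0 < e / 24 by rewrite divr_gt0.
have [N2 H2] := taun _ e24.
have [||C1 [C10 HC1]] := @sum_growth _ z (1 + e / 8) (N1 + N2) _ z0.
- by rewrite ltrDl divr_gt0.
- move=> n Nn; have h1 := H1 n (leq_trans (leq_addr _ _) Nn).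
  have h2 := H2 n (leq_trans (leq_addl _ _) Nn).
  have w0n := w0 n; have al0n := al0 n; have al1n := al1 n.
  rewrite /z wS exprMn ler_pdivlMr ?mulr_gt0 ?exprn_gt0//.
  rewrite [leLHS](_ : _ = (1 + e / 8) * al n ^+ 2 * y n ^+ 2); last first.
    by field; rewrite gt_eqF.
  apply: le_trans h1; rewrite ler_wpM2r ?sqr_ge0//.
  have h3 : al n ^+ 2 <= Q * (1 + e / 8).
    rewrite /al -powR_mulrn ?powR_ge0// -powRrM [q^-1 * _]mulrC.
    rewrite (powRM _ (ler0n R 2)); last by have := tau0 n; lra.
    rewrite -/(2 / q) -/Q ler_wpM2l; [by []|lra|].
    apply: (@le_trans _ _ (1 + 3 * tau n)); last lra.
    apply: ler1_powR; first by have := tau0 n; lra.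
    rewrite ler_pdivrMr; lra.
  have h4 : 0 <= 1 + e / 8 by lra.
  apply: (le_trans (ler_wpM2l h4 h3)).
  have Qe : Q = 2 - 2 * e by rewrite /e; lra.
  rewrite Qe; clear -e0 e1; nra.
have b4 : 0 < 1 - b ^- 4 by rewrite subr_gt0 invf_lt1 ?exprn_gt0// exprn_egt1.
pose D1 := 1 + 2 * (1 - b ^- 4)^-1; pose D2 := Num.sqrt (3 * CA * C1).
exists (D1 + D2).
have D10 : 0 < D1 by rewrite /D1 ltr_wpDr// mulr_ge0// invr_ge0 ltW.
have D20 : 0 <= D2 by exact: sqrtr_ge0.
split; first exact: ltr_wpDr.
move=> r K A K0 A0 Ale Krec.
pose E i := \sum_(j < i) (2 * 2 ^+ (j %/ 4) * K 0%N) / w j.+1.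
pose V i := \sum_(j < i) 3 * A j / w j ^+ 2.
have Aw i : 0 <= 3 * A i / w i ^+ 2.
  by apply: divr_ge0; [apply: mulr_ge0; [exact: ler0n|exact: A0]|exact: sqr_ge0].
have V0 i : 0 <= V i.
  by apply: sumr_ge0.
have E0 i : 0 <= E i.
  by apply: sumr_ge0 => j _; rewrite divr_ge0 ?mulr_ge0 ?exprn_ge0// ltW.
(* Variances accumulate under the root and gap terms outside it; [sqrt_shift] keeps this shape from
   one step to the next. *)
have main i : K i <= w i * (Num.sqrt (K 0%N ^+ 2 + V i) + E i).
  elim: i => [|i IHi].
    by rewrite /V /E /w !big_ord0 !addr0 mul1r sqrtr_sqr ger0_norm.
  have h1 : Num.sqrt (K i ^+ 2 + 3 * A i) <=
      w i * (Num.sqrt (K 0%N ^+ 2 + V i.+1) + E i).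
    set s := Num.sqrt (K 0%N ^+ 2 + V i).
    have s0 : 0 <= s by exact: sqrtr_ge0.
    have h2 : K i ^+ 2 + 3 * A i <= w i ^+ 2 * ((s + E i) ^+ 2 + 3 * A i / w i ^+ 2).
      rewrite mulrDr -exprMn mulrCA divff ?mulr1 ?expf_neq0 ?gt_eqF// lerD2r.
      by rewrite ler_sqr ?nnegrE// mulr_ge0 ?addr_ge0// ltW.
    apply: (@le_trans _ _ (Num.sqrt (w i ^+ 2 * ((s + E i) ^+ 2 + 3 * A i / w i ^+ 2)))).
      by rewrite ler_sqrt// mulr_ge0 ?addr_ge0 ?sqr_ge0.
    rewrite sqrtrM ?sqr_ge0// sqrtr_sqr ger0_norm ?(ltW (w0 i))// ler_pM2l//.
    apply: (le_trans (sqrt_shift s0 (E0 i) (Aw i))).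
    by rewrite /s sqr_sqrtr ?addr_ge0 ?sqr_ge0// /V big_ord_recr /= addrA.
  apply: (le_trans (Krec i)).
  apply: (le_trans (lerD (ler_wpM2l (ltW (al0 i)) h1) (lexx _))).
  rewrite mulrA [al i * _]mulrC -wS [in leRHS]/E big_ord_recr /= addrA [leRHS]mulrDr lerD2l.
  by rewrite mulrCA divff ?mulr1// gt_eqF.
have hE : E r <= 2 * (1 - b ^- 4)^-1 * K 0%N.
  apply: (@le_trans _ _ (\sum_(j < r) 2 * K 0%N * (b ^- 4) ^+ j)).
    apply: ler_sum => j _; rewrite ler_pdivrMr//.
    rewrite [leLHS]mulrAC -[leRHS]mulrA ler_wpM2l ?mulr_ge0//.
    apply: (@le_trans _ _ ((b ^- 4) ^+ j * b ^+ (16 * j.+1))); last first.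
      by rewrite ler_wpM2l// exprn_ge0// invr_ge0 exprn_ge0// ltW.
    rewrite exprVn -exprM mulrC ler_pdivlMr ?exprn_gt0// exp2_b48 -exprD b48_le//.
    by have := leq_trunc_div j 4; move: (j %/ 4)%N => k; clear; lia.
  rewrite -mulr_sumr mulrAC ler_wpM2r// ler_wpM2l// sum_geo//.
    by rewrite invr_ge0 exprn_ge0// ltW.
  by rewrite -subr_gt0.
have hV : V r <= 3 * CA * C1 * z r.
  apply: (@le_trans _ _ (3 * CA * \sum_(j < r.+1) z j)); last first.
    by rewrite -[leRHS]mulrA ler_wpM2l ?mulr_ge0 ?(ltW CA0)// HC1.
  have zr : 0 <= 3 * CA * z r.
    by apply: mulr_ge0; [apply: mulr_ge0; [exact: ler0n|exact: ltW]|exact: ltW].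
  rewrite big_ord_recr mulrDr /=; apply: ler_wpDr => //.
  rewrite mulr_sumr; apply: ler_sum => j _.
  rewrite /z mulrA ler_wpM2r ?invr_ge0 ?sqr_ge0// -mulrA ler_wpM2l//.
  exact: Ale.
have hs : w r * Num.sqrt (K 0%N ^+ 2 + V r) <= w r * K 0%N + D2 * y r.
  have h1 : Num.sqrt (K 0%N ^+ 2 + V r) <= K 0%N + Num.sqrt (V r).
    have := @sqrt_shift 0 (K 0%N) (V r) (lexx _) (K0 _) (V0 _).
    by rewrite add0r expr0n /= add0r addrC [leRHS]addrC [V r + _]addrC.
  apply: le_trans (ler_wpM2l (ltW (w0 r)) h1) _; rewrite mulrDr lerD2l.
  rewrite -[leRHS]ger0_norm ?mulr_ge0 ?(ltW (y0 r))// -sqrtr_sqr.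
  rewrite -[w r]ger0_norm ?(ltW (w0 r))// -sqrtr_sqr -sqrtrM ?sqr_ge0//.
  rewrite ler_sqrt ?sqr_ge0// exprMn /D2 sqr_sqrtr ?mulr_ge0 ?(ltW CA0) ?(ltW C10)//.
  apply: (le_trans (ler_wpM2l (sqr_ge0 _) hV)).
  by rewrite /z mulrCA [_ ^+ 2 * (_ / _)]mulrCA divff ?mulr1// expf_neq0// gt_eqF.
apply: (le_trans (main r)); rewrite mulrDr.
have hE2 := ler_wpM2l (ltW (w0 r)) hE.
apply: (le_trans (lerD hs hE2)).
have wK : 0 <= w r * K 0%N by rewrite mulr_ge0// ltW.
have yr0 := ltW (y0 r).
rewrite -/(w r).
rewrite (_ : w r * K 0%N + D2 * y r + w r * (2 * (1 - b ^- 4)^-1 * K 0%N) =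
  D1 * (w r * K 0%N) + D2 * y r); last by rewrite /D1; ring.
rewrite -subr_ge0 (_ : _ - _ = D2 * (w r * K 0%N) + D1 * y r); last by ring.
exact: addr_ge0 (mulr_ge0 D20 wK) (mulr_ge0 (ltW D10) yr0).
Qed.

End moment_sequence.

(** * Growth of the variances along powers of two *)

Section dyadic_blocks.
Context {d : measure_display} {T : measurableType d} {R : realType}.
Variables (P : probability T R) (X : int -> {RV P >-> R}).
Hypothesis Xstat : strictly_stationary X.
Hypothesis rho0 : null_seq (rho X).
Local Notation b := (@b48 R).

Lemma pow2_double i : (2 ^ i.+1 = 2 ^ i + 2 ^ i)%N.
Proof. by rewrite expnS mul2n addnn. Qed.

(** The value [a] = 3 is for the sharp variance bounds; [a] = 1 is for the places where the sum over
    the gap is estimated trivially by its number of terms. *)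
Definition gap_rho (a i : nat) : R := rho X (2 ^ (a * i %/ 4)).

Lemma gap_rho_ge0 a i : 0 <= gap_rho a i. Proof. exact: rho_ge0. Qed.

Lemma null_seq_gap_rho a : (0 < a)%N -> null_seq (gap_rho a).
Proof.
move=> a0; apply: (null_seq_comp (u := rho X) (f := fun i => (2 ^ (a * i %/ 4))%N)) => //.
move=> M; exists (4 * M)%N => n Mn.
apply: (@leq_trans (2 ^ M)); first exact/ltnW/ltn_expl.
rewrite leq_exp2l// leq_divRL//; apply: (@leq_trans (1 * n)%N); first by lia.
by rewrite leq_mul2r a0 orbT.
Qed.

Lemma blkN_crude : exists C, 0 < C /\ forall h : R -> R,
  measurable_fun [set: R] h -> sqi P (fun w => h (X 0 w)) ->
  Ex P (fun w => h (X 0 w)) = 0 ->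
  forall i, blkN X h (2 ^ i) <= C * b ^+ (28 * i) * blkN X h 1.
Proof.
have [C [C0 H]] := crude_growth (gap_rho_ge0 1) (null_seq_gap_rho (ltn0Sn 0)).
exists C; split => // h mh hs hm i.
apply: (H (fun i => blkN X h (2 ^ i))) => [j|j|j]; first exact: blkN_ge0.
  by rewrite -natrX; exact: blkN_le.
rewrite pow2_double; apply: (le_trans (blkN_double_le Xstat mh hs hm _ (2 ^ (j %/ 4)))).
by rewrite /gap_rho mul1n lerD2l ler_pM2l// -natrX; exact: blkN_le.
Qed.

Lemma blkN_gap : exists C, 0 < C /\ forall h : R -> R,
  measurable_fun [set: R] h -> sqi P (fun w => h (X 0 w)) ->
  Ex P (fun w => h (X 0 w)) = 0 ->
  forall i, 2 * blkN X h (2 ^ (3 * i %/ 4)) <=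
    2 * (C * b ^+ (28 * (3 * i %/ 4)) * blkN X h 1).
Proof.
have [C [C0 H]] := blkN_crude; exists C; split => // h mh hs hm i.
by rewrite ler_pM2l//; exact: H.
Qed.

Lemma blkN_sharp : exists C, 0 < C /\ forall h : R -> R,
  measurable_fun [set: R] h -> sqi P (fun w => h (X 0 w)) ->
  Ex P (fun w => h (X 0 w)) = 0 ->
  forall r, blkN X h (2 ^ r) ^+ 2 <=
    C * (2 ^+ r * expR (\sum_(i < r) gap_rho 3 i) * blkN X h 1 ^+ 2).
Proof.
have [C1 [C10 H1]] := blkN_gap.
have [C [C0 H]] := sharp_upper (gap_rho_ge0 3) (ltW C10).
exists C; split => // h mh hs hm r.
apply: (H (fun i => blkN X h (2 ^ i))) => [j|j]; first exact: blkN_ge0.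
rewrite pow2_double; apply: (le_trans (blkN_double_le Xstat mh hs hm _ (2 ^ (3 * j %/ 4)))).
by rewrite lerD2l; exact: H1.
Qed.

Section second_moment.
Hypothesis X_sqi : sqi P (X 0).
Hypothesis X_mean : Ex P (X 0) = 0.
Variable c : R.
Hypothesis c0 : 0 < c.
Local Notation y i := (blkN X id (2 ^ i)).
Hypothesis yb : forall i, c * b ^+ (23 * i) <= y i.

Lemma y_gt0 i : 0 < y i.
Proof. by apply: lt_le_trans (yb i); rewrite mulr_gt0// exprn_gt0// b48_gt0. Qed.

Let midR : measurable_fun [set: R] (id : R -> R) := @measurable_id _ _ _.

Let y_rec : exists C0, 0 <= C0 /\ forall i, Num.sqrt (2 * (1 - gap_rho 3 i)) * y i -
  2 * (C0 * b ^+ (28 * (3 * i %/ 4)) * y 0) <= y i.+1.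
Proof.
have [C [C0 H]] := blkN_gap; exists C; split; first exact: ltW.
move=> i; rewrite [(2 ^ i.+1)%N]pow2_double.
apply: le_trans (blkN_double_ge Xstat midR X_sqi X_mean _ (2 ^ (3 * i %/ 4))).
by rewrite lerD2l lerN2; exact: (H id).
Qed.

Lemma y_growth (e : R) : 0 < e -> exists N, forall i, (N <= i)%N ->
  (2 - e) * y i ^+ 2 <= y i.+1 ^+ 2.
Proof.
have [C0 [C00 H]] := y_rec; apply: (lower_growth _ _ C00 c0 yb H) => //.
  exact: gap_rho_ge0.
exact: null_seq_gap_rho.
Qed.

Lemma y_lower : exists c', 0 < c' /\ forall r,
  c' * (2 ^+ r * expR (- (21 / 20 * \sum_(i < r) gap_rho 3 i))) <= y r ^+ 2.
Proof.
have [C0 [C00 H]] := y_rec; apply: (sharp_lower _ _ C00 c0 yb H) => //.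
  exact: gap_rho_ge0.
exact: null_seq_gap_rho.
Qed.

Lemma y_sum : exists C, 0 < C /\ forall r, \sum_(i < r.+1) y i <= C * y r.
Proof.
have [N HN] := @y_growth (1 / 2) ltac:(by rewrite divr_gt0).
(* The squares grow by 3/2 at least, and (6/5)^2 < 3/2. *)
apply: (@sum_growth _ _ (6 / 5) N _ y_gt0) => [|n /HN h].
  by rewrite ltr_pdivlMr//; lra.
rewrite -ler_sqr ?nnegrE ?mulr_ge0 ?(ltW (y_gt0 _))//.
apply: le_trans h; rewrite exprMn ler_wpM2r ?sqr_ge0//; lra.
Qed.

(** Binary expansion of m: each digit contributes at most one block of length 2^i with i <= j, and
    [y_sum] adds up their norms. *)
Lemma blkN_short : exists C, 0 < C /\ forall j m, (m < 2 ^ j.+1)%N ->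
  blkN X id m <= C * y j.
Proof.
have [C [C0 HC]] := y_sum; exists C; split => // j m mj.
apply: le_trans (HC j); elim: j m mj => [|j IHj] m mj.
  rewrite big_ord1.
  case: m mj => [|[|//]] _; last by rewrite expn0.
  by rewrite blkN0 blkN_ge0.
have [mj'|jm] := ltnP m (2 ^ j.+1)%N.
  by rewrite big_ord_recr /= ler_wpDr ?blkN_ge0// IHj.
rewrite big_ord_recr /= -(subnK jm) (le_trans (blkND Xstat midR X_sqi _ _))//.
by rewrite lerD2r IHj// ltn_subLR// -pow2_double.
Qed.

Lemma moment_blocks (q CA : R) : 2 < q -> q <= 3 -> 0 < CA ->
  exists C, 0 < C /\ forall r (h : R -> R) (B : R), measurable_fun [set: R] h ->
    (forall x, `|h x| <= B) ->
    (forall i, (i < r)%N -> blkN X h (2 ^ i) ^+ 2 <= CA * y i ^+ 2) ->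
    Nq P q (blk X h 0 (2 ^ r)) <=
    C * ((\prod_(i < r) (2 * (1 + 3 * gap_rho 1 i `^ (2 / q))) `^ q^-1) *
         Nq P q (blk X h 0 1) + y r).
Proof.
move=> q2 q3 CA0.
have t0 : 0 < 2 / q by rewrite divr_gt0//; lra.
have [|C [C0 H]] := @moment_bound R q (fun i => gap_rho 1 i `^ (2 / q)) (fun i => y i)
    CA q2 q3 (fun i => powR_ge0 _ _) _ CA0 y_gt0 y_growth.
  move=> e e0; have [N HN] := @null_seq_gap_rho 1 (ltn0Sn 0) (e `^ (2 / q)^-1) (powR_gt0 _ e0).
  exists N => n /HN h; apply: le_trans (ler_powRl (ltW t0) (gap_rho_ge0 _ _) h) _.
  by rewrite -powRrM mulVf ?gt_eqF// powRr1// ltW.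
exists C; split => // r h B mh hB hv.
apply: (H r (fun i => Nq P q (blk X h 0 (2 ^ i))) (fun i => blkN X h (2 ^ i) ^+ 2)) => // [i|i|i].
- exact: Nq_ge0.
- exact: sqr_ge0.
rewrite pow2_double.
have := moment_double Xstat mh hB q2 q3 (2 ^ i) (2 ^ (i %/ 4)).
by rewrite natrX /gap_rho mul1n.
Qed.

End second_moment.

End dyadic_blocks.

(** * The rate functions *)

Section rate_functions.
Context {R : realType}.
Local Notation b := (@b48 R).
Variable r : nat -> R.
Hypotheses (r_ge0 : forall n, 0 <= r n) (r_le1 : forall n, r n <= 1).
Hypothesis r_anti : forall m n, (m <= n)%N -> r n <= r m.
Hypothesis r_null : null_seq r.

Lemma ln2_gt0 : 0 < ln 2 :> R. Proof. by rewrite ln_gt0// ltr1n. Qed.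

(** This gives 2 / ln 2 >= 14/5. Numerically, exp(5/7) >= (1 + 5/112)^16, which is evaluated by four
    squarings, rounding down each time. *)
Lemma ln2_le : ln 2 <= 5 / 7 :> R.
Proof.
rewrite -ler_expR lnK ?posrE//.
have -> : 5 / 7 = 16%:R * (5 / 112) :> R by field.
rewrite expRM_natl; apply: (@le_trans _ _ ((1 + 5 / 112) ^+ 16)); last first.
  have p0 : 0 <= 1 + 5 / 112 :> R by lra.
  by apply: lerXn2r; rewrite ?nnegrE ?p0 ?expR_ge0 ?expR_ge1Dx.
rewrite [X in _ ^+ X](_ : 16 = 2 * 2 * 2 * 2)%N// !exprM.
have S (x c e : R) : 0 <= c -> c <= x -> e <= c ^+ 2 -> e <= x ^+ 2.
  by move=> c0 cx /le_trans; apply; rewrite ler_sqr ?nnegrE// (le_trans c0).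
apply: (S _ (1416 / 1000)); [lra| |lra].
apply: (S _ (1190 / 1000)); [lra| |lra].
apply: (S _ (1091 / 1000)); [lra| |lra].
by apply: (S _ (10446 / 10000)); lra.
Qed.

Lemma log2_pow2 i : log2 ((2 ^ i)%N%:R : R) = i%:R.
Proof.
by rewrite /log2 natrX lnXn// -[X in X / _]mulr_natl mulfK// gt_eqF// ln2_gt0.
Qed.

Lemma truncn_log2_pow2 i : Num.truncn (log2 ((2 ^ i)%N%:R : R)) = i.
Proof. by rewrite log2_pow2 natrK. Qed.

Lemma expR_ln2 (n : nat) : expR (n%:R * ln 2) = 2 ^+ n :> R.
Proof. by rewrite expRM_natl lnK ?posrE. Qed.

Lemma expR_ln2_48 (n : nat) : expR (n%:R / 48 * ln 2) = b ^+ n.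
Proof.
rewrite /b48 /powR pnatr_eq0 /= -expRM_natl; congr expR.
by rewrite mulrA.
Qed.

Let rd i := r (2 ^ i).

Lemma rd_null : null_seq rd.
Proof.
apply: (null_seq_comp (u := r) (f := fun i => (2 ^ i)%N)) => // M.
by exists M => n Mn; rewrite (leq_trans Mn)// ltnW// ltn_expl.
Qed.

Lemma sum_shift1 (u : nat -> R) n : (forall i, 0 <= u i) ->
  \sum_(1 <= i < n.+1) u i <= \sum_(i < n.+1) u i.
Proof.
by move=> u0; rewrite -(big_mkord xpredT u) [leRHS]big_ltn//= lerDr.
Qed.

Section lower_h.
Variables (eps1 eps2 c2 : R).
Hypotheses (heps1 : 0 < eps1) (heps12 : eps1 < eps2) (heps2 : eps2 < 1) (hc2 : 0 < c2).

(** The sum in the exponent of [lower_h] is o(i), since rho(2^i) tends to 0; so [lower_h] at 2^i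
    decays at most like b^(-i), up to a constant, and b^(46i) is below b^(48i) b^(-i). *)
Lemma lower_h_bound : exists c, 0 < c /\ forall i,
  (c * b ^+ (23 * i)) ^+ 2 <= (2 ^ i)%N%:R * lower_h r eps1 eps2 c2 (2 ^ i)%N.
Proof.
have [E1 [E12 E2]] := conj heps1 (conj heps12 heps2).
have e20 : 0 < 1 - eps2 by lra.
have l2 := ln2_gt0.
have e0 : 0 < (1 - eps2) * (ln 2 / 48) by rewrite mulr_gt0// divr_gt0.
have [C [C0 HC]] := sum_null_seq rd_null e0.
pose k := c2 * expR (- ((C + (1 - eps2) * (ln 2 / 48)) / (1 - eps2))).
have k0 : 0 < k by rewrite mulr_gt0// expR_gt0.
exists (Num.sqrt k); split; first by rewrite sqrtr_gt0.
move=> i; rewrite exprMn sqr_sqrtr ?(ltW k0)// -exprM.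
rewrite /lower_h log2_pow2 /k -!mulrA [leRHS]mulrCA ler_pM2l//.
rewrite -mulr_suml natrX -expR_ln2 -expR_ln2_48 -!expRD ler_expR.
set m := Num.truncn _.
have mi : (m <= i)%N.
  rewrite -(@natrK R i) le_truncn// ler_piMl//; lra.
have h1 : \sum_(1 <= j < m.+1) r (2 ^ j)%N <= \sum_(j < i.+1) rd j.
  apply: (@le_trans _ _ (\sum_(1 <= j < i.+1) r (2 ^ j)%N)).
    by rewrite [leRHS](big_cat_nat (n := m.+1))//= lerDl sumr_ge0.
  exact: sum_shift1.
have h2 : (\sum_(1 <= j < m.+1) r (2 ^ j)%N) / (1 - eps2) <=
    (C + (1 - eps2) * (ln 2 / 48)) / (1 - eps2) + i%:R * (ln 2 / 48).
  apply: (@le_trans _ _ ((C + (1 - eps2) * (ln 2 / 48) * i.+1%:R) / (1 - eps2))).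
    by rewrite ler_wpM2r ?invr_ge0 ?(ltW e20)// (le_trans h1).
  rewrite le_eqVlt; apply/orP; left; apply/eqP.
  by rewrite -natr1; field; rewrite gt_eqF.
have e1 : (23 * i * 2)%N%:R / 48 * ln 2 = 46 * (i%:R * (ln 2 / 48)) :> R.
  by rewrite !natrM; field.
have e2 : i%:R * ln 2 = 48 * (i%:R * (ln 2 / 48)) :> R by field.
rewrite e1 e2; move: h2.
have : 0 <= i%:R * (ln 2 / 48) :> R by rewrite mulr_ge0// divr_ge0// ltW.
move: (i%:R * _) ((C + _) / (1 - eps2)) (_ / (1 - eps2)) => A B D; lra.
Qed.

Lemma lower_h_ge0 n : 0 <= lower_h r eps1 eps2 c2 n.
Proof. by rewrite mulr_ge0 ?expR_ge0// ltW. Qed.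

Lemma lower_h_le n : lower_h r eps1 eps2 c2 n <= c2.
Proof.
rewrite /lower_h ler_piMr ?(ltW hc2)// -[leRHS]expR0 ler_expR oppr_le0.
by rewrite -mulr_suml divr_ge0 ?sumr_ge0// subr_ge0 ltW.
Qed.

Variable q0 : nat -> R.
Hypothesis hq0 : admissible_q0 q0.

Lemma q0_null : null_seq (fun i => q0 (2 ^ i)%N).
Proof.
case: hq0 => q00 _ _ cq e e0.
pose u n := \sum_(1 <= i < n.+1) Num.sqrt (q0 (2 ^ i)%N).
have h : u n.+1 - u n @[n --> \oo] --> lim (u n @[n --> \oo]) - lim (u n @[n --> \oo]).
  by apply: cvgB => //; rewrite (cvg_shiftS u).
rewrite subrr in h.
have se : 0 < Num.sqrt e by rewrite sqrtr_gt0.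
move/cvgrPdist_le : h => /(_ _ se)[N _ HN].
exists N.+1 => -[//|n] Nn; have := HN n Nn.
rewrite /= sub0r normrN /u big_nat_recr//= addrAC subrr add0r.
by rewrite ger0_norm ?sqrtr_ge0// ler_sqrt// ltW.
Qed.

(** Indeed [lower_l] is at most c2^4 q0, which tends to 0 along powers of 2. By monotonicity of r,
    the coefficients in [h_d] then dominate the r(2^i). *)
Lemma two_star_le : exists N, forall i, (N <= i)%N ->
  (two_star r eps1 eps2 c2 q0 i <= 2 ^ i)%N.
Proof.
have c4 : 0 < c2 ^+ 4 by rewrite exprn_gt0.
have [N HN] := q0_null (e := (c2 ^+ 4)^-1) ltac:(by rewrite invr_gt0).
exists N => i /HN h; rewrite /two_star -[leqRHS](@natrK R) le_truncn//.
rewrite ler_piMr// /lower_l.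
have h1 : lower_h r eps1 eps2 c2 (2 ^ i) ^+ 4 <= c2 ^+ 4.
  by rewrite ler_pXn2r ?nnegrE ?lower_h_ge0 ?(ltW hc2)// lower_h_le.
have q0i : 0 < q0 (2 ^ i)%N by case: hq0 => + _ _ _; apply; rewrite expn_gt0.
apply: (@le_trans _ _ (c2 ^+ 4 * (c2 ^+ 4)^-1)); last by rewrite divff// gt_eqF.
by apply: ler_pM => //; [rewrite exprn_ge0// lower_h_ge0|exact: ltW].
Qed.

Variable k0 : nat.
Hypothesis hrho : forall k, (k0 <= k)%N -> r (two_star r eps1 eps2 c2 q0 k) < 1.
Local Notation hd n := (h_d r eps1 eps2 c2 q0 k0 n).

Let a i : R := - 2 * log2 (1 - r (two_star r eps1 eps2 c2 q0 i)).

Let hdE n : hd (2 ^ n)%N = expR (\sum_(k0 <= i < n.+1) a i).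
Proof. by rewrite /h_d truncn_log2_pow2 -mulr_sumr. Qed.

Let a_ge i : (k0 <= i)%N -> 14 / 5 * r (two_star r eps1 eps2 c2 q0 i) <= a i.
Proof.
move=> /hrho; rewrite /a /log2; have := r_ge0 (two_star r eps1 eps2 c2 q0 i).
move: (r _) => x x0 x1; rewrite mulrA ler_pdivlMr ?ln2_gt0//.
have h1 : ln (1 - x) <= - x.
  by apply: (le_trans (@le_ln1Dx _ (- x) _)) => //; rewrite ltrN2.
have := ln2_le; have := ln2_gt0; move: (ln (1 - x)) h1 (ln 2) => y h1 z z0 z1.
nra.
Qed.

Let a_ge0 i : (k0 <= i)%N -> 0 <= a i.
Proof. by move=> ki; apply: le_trans (a_ge ki); rewrite mulr_ge0. Qed.

Lemma h_d_ge1 n : 1 <= hd (2 ^ n)%N.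
Proof.
rewrite hdE -[leLHS]expR0 ler_expR big_nat_cond; apply: sumr_ge0 => i.
by rewrite andbT => /andP[/a_ge0].
Qed.

Lemma h_d_mono m n : (m <= n)%N -> hd (2 ^ m)%N <= hd (2 ^ n)%N.
Proof.
move=> mn; rewrite !hdE ler_expR.
have [km|mk] := leqP k0 m.+1; last first.
  rewrite big_geq ?(ltnW mk)// big_nat_cond; apply: sumr_ge0 => i.
  by rewrite andbT => /andP[/a_ge0].
rewrite [leRHS](big_cat_nat (n := m.+1))//= lerDl big_nat_cond; apply: sumr_ge0 => i.
by rewrite andbT => /andP[mi _]; apply: a_ge0; rewrite (leq_trans km).
Qed.

(* The logarithm in [h_d] is binary and the exponential natural; [2 / ln 2 >= 14/5]. *)
Lemma h_d_lower : exists C, 0 < C /\ forall n,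
  expR (14 / 5 * \sum_(1 <= i < n.+1) r (2 ^ i)%N) <= C * hd (2 ^ n)%N.
Proof.
have [N HN] := two_star_le.
pose f n := 14 / 5 * \sum_(1 <= i < n.+1) r (2 ^ i)%N - \sum_(k0 <= i < n.+1) a i.
have [|C [C0 HC]] := @ev_max _ f (N + k0) (f (N + k0)%N).
  elim=> [|n IHn]; first by rewrite leqn0 => /eqP <-.
  rewrite leq_eqVlt => /predU1P[<-//|]; rewrite ltnS => Nn.
  apply: le_trans (IHn Nn); rewrite /f big_nat_recr//=.
  have kn : (k0 <= n.+1)%N by move: Nn; clear; lia.
  have Nn1 : (N <= n.+1)%N by move: Nn; clear; lia.
  rewrite [X in _ - X]big_nat_recr//=.
  have := a_ge kn; have := r_anti (HN _ Nn1).
  move: (\sum_(1 <= i < n.+1) _) (\sum_(k0 <= i < n.+1) _) (a _) (r _) (r _) => *.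
  lra.
exists (expR C); split; first exact: expR_gt0.
by move=> n; rewrite hdE -expRD ler_expR -lerBlDr; exact: HC.
Qed.

End lower_h.

Section delta.
Variable delta : R.
Hypotheses (hdelta0 : 0 < delta) (hdelta1 : delta < 1).
Let theta := 2 / (2 + delta).
Let theta' := 2 / (2 + delta / 2).

Lemma h_deltaE n :
  h_delta r delta (2 ^ n)%N = expR (5 * \sum_(1 <= i < n.+1) rd i `^ theta).
Proof. by rewrite /h_delta truncn_log2_pow2. Qed.

Lemma h_delta_ge1 n : 1 <= h_delta r delta (2 ^ n)%N.
Proof.
rewrite h_deltaE -[leLHS]expR0 ler_expR mulr_ge0// sumr_ge0// => i _.
exact: powR_ge0.
Qed.

Lemma null_seq_powR (u : nat -> R) (x : R) : (forall i, 0 <= u i) -> 0 < x ->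
  null_seq u -> null_seq (fun i => u i `^ x).
Proof.
move=> u0 x0 hu e e0; have [N HN] := hu (e `^ x^-1) (powR_gt0 _ e0).
exists N => n /HN h; apply: le_trans (ler_powRl (ltW x0) (u0 n) h) _.
by rewrite -powRrM mulVf ?gt_eqF// powRr1// ltW.
Qed.

(** Needed to see that the truncation level, in which [h_delta] is a divisor, tends to infinity. *)
Lemma h_delta_small (e : R) : 0 < e -> exists C, 0 < C /\ forall n,
  h_delta r delta (2 ^ n)%N <= C * expR (e * n%:R).
Proof.
move=> e0; have D0 := hdelta0.
have t0 : 0 < theta by rewrite divr_gt0//; lra.
have e5 : 0 < e / 5 by rewrite divr_gt0.
have [C [C0 HC]] := sum_null_seq (null_seq_powR (fun i => r_ge0 _) t0 rd_null) e5.
exists (expR (5 * C + e)); split; first exact: expR_gt0.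
move=> n; rewrite h_deltaE -expRD ler_expR.
have h := le_trans (@sum_shift1 (fun i => rd i `^ theta) n (fun i => powR_ge0 _ _)) (HC n.+1).
have en : n.+1%:R = n%:R + 1 :> R by rewrite natr1.
rewrite en /= in h; move: h; set S := \sum_(_ <= _ < _) _ => h.
have : 5 * S <= 5 * (C + e / 5 * (n%:R + 1)) by rewrite ler_pM2l.
move: (n%:R) (5 * S) {h} => N S5; lra.
Qed.

(* [rho(2^j)^theta'] is negligible with respect to [rho(2^j)^theta]: no constant
   in the moment inequality matters. *)
Lemma h_delta_dominates (D : R) : 0 <= D -> exists C, 0 < C /\ forall n,
  expR (3 * \sum_(i < n) r (2 ^ (1 * i %/ 4))%N `^ theta' +
        D * \sum_(i < n) r (2 ^ (3 * i %/ 4))%N) <=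
  C * h_delta r delta (2 ^ n)%N `^ 2^-1.
Proof.
move=> D0; have [d0 d1] := conj hdelta0 hdelta1.
have t0 : 0 < theta by rewrite divr_gt0//; lra.
have t'0 : 0 < theta' by rewrite divr_gt0//; lra.
have t'1 : theta' <= 1 by rewrite ler_pdivrMr; lra.
have tt' : 0 < theta' - theta.
  have p1 : 0 < 2 + delta / 2 by lra.
  have p2 : 0 < 2 + delta by lra.
  rewrite subr_gt0 /theta /theta' ltr_pM2l// ltf_pV2 ?posrE//; lra.
have E0 : 0 < 12 + 2 * D by lra.
(* By [sum_gap] the gaps 1/4 turn 3 into 3 * 4 = 12 and the gaps 3/4 turn D into 4/3 D <= 2D; 5/2 is
   half of the 5 in [h_delta], whose square root is taken. *)
pose E := 5 / 2 / (12 + 2 * D).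
have Epos : 0 < E by rewrite !divr_gt0.
have [N HN] := null_seq_powR (fun i => r_ge0 _) tt' rd_null Epos.
pose S (u : R -> R) n : R := \sum_(1 <= i < n.+1) u (rd i).
pose f n := 12 * S (fun x => x `^ theta') n + 2 * D * S id n - 5 / 2 * S (fun x => x `^ theta) n.
have [|C [C0 HC]] := @ev_max _ f N (f N).
  elim=> [|n IHn]; first by rewrite leqn0 => /eqP <-.
  rewrite leq_eqVlt => /predU1P[<-//|]; rewrite ltnS => Nn.
  apply: le_trans (IHn Nn).
  have h1 := HN n.+1 (leqW Nn).
  have SS u : S u n.+1 = S u n + u (rd n.+1) by rewrite /S big_nat_recr.
  rewrite /f !SS /=.
  have x0 : 0 <= rd n.+1 by exact: r_ge0.
  have x1 : rd n.+1 <= rd n.+1 `^ theta'.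
    move: x0; rewrite le_eqVlt => /predU1P[<-|x0]; first exact: powR_ge0.
    by apply: ger1_powR => //; rewrite x0 r_le1.
  have x2 : rd n.+1 `^ theta' = rd n.+1 `^ (theta' - theta) * rd n.+1 `^ theta.
    by rewrite -powRD subrK// gt_eqF.
  have x3 : (12 + 2 * D) * rd n.+1 `^ theta' <= 5 / 2 * rd n.+1 `^ theta.
    rewrite x2 mulrA ler_wpM2r ?powR_ge0//.
    by apply: (le_trans (ler_wpM2l (ltW E0) h1)); rewrite /E mulrC divfK ?gt_eqF.
  have x4 := ler_wpM2l D0 x1.
  rewrite -subr_ge0.
  rewrite [leRHS](_ : _ = (5 / 2 * rd n.+1 `^ theta - (12 + 2 * D) * rd n.+1 `^ theta') +
    2 * (D * rd n.+1 `^ theta' - D * rd n.+1)); last by ring.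
  by apply: addr_ge0; rewrite ?mulr_ge0// subr_ge0.
exists (expR (C + 3 * (4 * rd 0%N `^ theta') + D * (4 * rd 0%N))).
split; first exact: expR_gt0.
move=> n.
have -> : h_delta r delta (2 ^ n)%N `^ 2^-1 = expR (5 / 2 * S (fun x => x `^ theta) n).
  by rewrite h_deltaE -expRM; congr expR; rewrite /S; field.
rewrite -expRD ler_expR.
have h1 : \sum_(i < n) r (2 ^ (1 * i %/ 4))%N `^ theta' <=
    4 * rd 0%N `^ theta' + 4 / 1%:R * S (fun x => x `^ theta') n.
  apply: (@sum_gap _ (fun i => rd i `^ theta') 1 n) => // [i|i j ij].
    exact: powR_ge0.
  by apply: ler_powRl; [exact: ltW|exact: r_ge0|apply: r_anti; rewrite leq_exp2l].
have h2 : \sum_(i < n) r (2 ^ (3 * i %/ 4))%N <= 4 * rd 0%N + 4 / 3%:R * S id n.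
  apply: (@sum_gap _ rd 3 n) => // [i|i j ij]; first exact: r_ge0.
  by apply: r_anti; rewrite leq_exp2l.
have S0 : 0 <= S id n by rewrite sumr_ge0// => i _; exact: r_ge0.
have := HC n; rewrite /f.
have h3 := ler_wpM2l D0 h2; have h4 := mulr_ge0 D0 S0; rewrite divr1 in h1.
move: h1 h2 h3 h4.
set A := \sum_(i < n) _; set B := \sum_(i < n) _.
move: A B (S _ n) (S _ n) (S _ n) (rd 0%N `^ theta') (rd 0%N).
move=> A B S1 S2 S3 t' t; lra.
Qed.

End delta.

End rate_functions.

(** * Truncation and uniform integrability *)

Section truncation.
Context {R : realType}.

Definition high (M x : R) : R := if M < `|x| then x else 0.
Definition low (M x : R) : R := if M < `|x| then 0 else x.

Lemma measurable_high M : measurable_fun [set: R] (high M).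
Proof.
by apply: measurable_fun_ifT => //; apply: measurable_fun_ltr.
Qed.

Lemma measurable_low M : measurable_fun [set: R] (low M).
Proof.
by apply: measurable_fun_ifT => //; apply: measurable_fun_ltr.
Qed.

Lemma low_high M x : low M x + high M x = x.
Proof. by rewrite /low /high; case: ifP; rewrite ?add0r ?addr0. Qed.

Lemma normr_low M x : 0 <= M -> `|low M x| <= M.
Proof. by rewrite /low; case: ltP => //; rewrite normr0. Qed.

Lemma normr_high_le M x : `|high M x| <= `|x|.
Proof. by rewrite /high; case: ifP => // _; rewrite normr0. Qed.

Lemma normr_low_le M x : `|low M x| <= `|x|.
Proof. by rewrite /low; case: ifP => // _; rewrite normr0. Qed.

(** Let |a + b| > L. If |a| > L/2, then a^2 <= |a|^q / (L/2)^(q-2); otherwise |b| > L/2 >= |a|. So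
    the tail of a sum is controlled by the moment of order q of one part and the second moment of
    the other. *)
Lemma high_sqr_add (q L a b : R) : 2 < q -> 0 < L ->
  high L (a + b) ^+ 2 <= 2 * (`|a| `^ q / (L / 2) `^ (q - 2)) + 4 * b ^+ 2.
Proof.
move=> q2 L0.
have L20 : 0 < L / 2 by rewrite divr_gt0.
have p0 : 0 < (L / 2) `^ (q - 2) by exact: powR_gt0.
have qa := powR_ge0 `|a| q.
have t0 : 0 <= `|a| `^ q / (L / 2) `^ (q - 2) by rewrite divr_ge0// ltW.
rewrite /high; case: ltP => [Lab|_]; last first.
  by rewrite expr0n /=; apply: addr_ge0; apply: mulr_ge0 => //; exact: sqr_ge0.
have h1 : (a + b) ^+ 2 <= 2 * a ^+ 2 + 2 * b ^+ 2.
  by have := sqr_ge0 (a - b); nra.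
suff h2 : a ^+ 2 <= `|a| `^ q / (L / 2) `^ (q - 2) + b ^+ 2 by lra.
have [aL|La] := leP `|a| (L / 2).
  apply: ler_wpDl => //; rewrite -(real_normK (num_real a)) -(real_normK (num_real b)).
  rewrite ler_sqr ?nnegrE//; have := ler_normD a b; lra.
apply: ler_wpDr; first exact: sqr_ge0.
rewrite ler_pdivlMr// -(real_normK (num_real a)) -powR_mulrn//.
rewrite (_ : `|a| `^ q = `|a| `^ 2%:R * `|a| `^ (q - 2)); last first.
  rewrite -powRD; first by congr (_ `^ _); ring.
  by apply/implyP => /eqP; lra.
by rewrite ler_wpM2l ?powR_ge0// ler_powRl// ?(ltW La) ?(ltW L20)//; lra.
Qed.

End truncation.

Section tails.
Context {d : measure_display} {T : measurableType d} {R : realType}.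
Variable P : probability T R.

Lemma measurable_tail (Z U : T -> R) (M : R) :
  measurable_fun [set: T] Z -> measurable_fun [set: T] U ->
  measurable_fun [set: T] (fun w => if M < `|U w| then Z w else 0).
Proof.
move=> mZ mU; apply: measurable_fun_ifT => //; apply: measurable_fun_ltr => //.
exact: measurableT_comp.
Qed.

Lemma ibl_tail (Z U : T -> R) (M : R) : ibl P Z -> measurable_fun [set: T] U ->
  ibl P (fun w => if M < `|U w| then Z w else 0).
Proof.
move=> iZ mU; apply: (@ibl_le _ _ _ _ _ (fun w => `|Z w|)).
- by apply: measurable_tail => //; exact: ibl_meas iZ.
- by move=> w; case: ifP => // _; rewrite normr0.
- exact: ibl_norm.
Qed.

Lemma tail_null (Z U : T -> R) : ibl P Z -> (forall w, 0 <= Z w) ->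
  measurable_fun [set: T] U ->
  forall e, 0 < e -> exists M0, forall M, M0 <= M ->
    Ex P (fun w => if M < `|U w| then Z w else 0) <= e.
Proof.
move=> iZ Z0 mU e e0.
pose f n w := (if n%:R < `|U w| then Z w else 0)%:E : \bar R.
have mf n : measurable_fun [set: T] (f n).
  by apply/measurable_EFinP; apply: measurable_tail => //; exact: ibl_meas iZ.
have cf : {ae P, forall w, [set: T] w -> f ^~ w @ \oo --> (0%:E : \bar R)}.
  apply/nearW => w _; apply: cvg_near_cst.
  exists (Num.truncn `|U w|).+1 => // n /= Un.
  by rewrite /f ltNge (le_trans (ltW (truncnS_gt _)))// ler_nat.
have bf : {ae P, forall w n, [set: T] w -> (`|f n w| <= (EFin \o Z) w)%E}.
  apply/nearW => w n _; rewrite /f /= lee_fin; case: ifP => _.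
    by rewrite ger0_norm.
  by rewrite normr0.
have [_ _] := dominated_convergence measurableT mf (measurable_cst _) cf iZ bf.
rewrite integral0 => /fine_cvgP[_] /cvgrPdist_le /(_ e e0)[N _ HN].
exists N%:R => M NM; apply: le_trans (_ : _ <= Ex P (fun w => if N%:R < `|U w| then Z w else 0)) _.
  apply: le_Ex => [||w]; [exact: ibl_tail|exact: ibl_tail|].
  case: ifP => h; last by case: ifP.
  by rewrite (le_lt_trans NM h).
have := HN N (leqnn _); rewrite /= sub0r normrN Ex.unlock /Rintegral.
by apply: le_trans; rewrite ler_norm.
Qed.

End tails.

(** * Uniform integrability of the normalised squares of dyadic sums *)

Section uniform_integrability.
Context {d : measure_display} {T : measurableType d} {R : realType}.
Variables (P : probability T R) (X : int -> {RV P >-> R}).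
Hypothesis Xstat : strictly_stationary X.
Hypothesis rho0 : null_seq (rho X).
Hypothesis X_sqi : sqi P (X 0).
Hypothesis X_mean : Ex P (X 0) = 0.
Variable c : R.
Hypothesis c0 : 0 < c.
Local Notation y i := (blkN X id (2 ^ i)).
Hypothesis yb : forall i, c * @b48 R ^+ (23 * i) <= y i.
Variables (delta : R) (g : R -> R).
Hypotheses (hdelta0 : 0 < delta) (hdelta1 : delta < 1).
Hypothesis g_ge0 : forall x : R, 0 <= x -> 0 <= g x.
Hypothesis g_ndecr : forall x y : R, 0 <= x -> x <= y -> g x <= g y.
Hypothesis X_moment : ibl P (fun w => X 0 w ^+ 2 * g `|X 0 w|).
(* [hd r], [hdel r], [lev r] are the values of h_d, h_delta and of the argument of [g]
   at [2^r]; [lev r] serves as truncation level for [X]. *)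
Variables hd hdel lev : nat -> R.
Hypothesis hd1 : forall r, 1 <= hd r.
Hypothesis hd_mono : forall r s, (r <= s)%N -> hd r <= hd s.
Variable CG : R.
Hypotheses (CG0 : 0 < CG) (hd_lower : forall r,
  expR (14 / 5 * \sum_(1 <= i < r.+1) rho X (2 ^ i)) <= CG * hd r).
Variable Cg : R.
Variable Ng : nat.
Hypotheses (Cg0 : 0 < Cg) (hd_g : forall r, (Ng <= r)%N -> hd r <= Cg * g (lev r)).
Hypothesis lev_infty : forall B, exists N, forall r, (N <= r)%N -> B < lev r.
Hypothesis hdel1 : forall r, 1 <= hdel r.
Hypothesis lev_le : forall r,
  0 <= lev r /\ lev r `^ (delta / 2) <= (2 ^+ r) `^ (delta / 4) * (hdel r `^ 2^-1)^-1.
Hypothesis hdel_dom : forall D : R, 0 <= D -> exists C, 0 < C /\ forall r,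
  expR (3 * \sum_(i < r) gap_rho X 1 i `^ (2 / (2 + delta / 2)) +
        D * \sum_(i < r) gap_rho X 3 i) <= C * hdel r `^ 2^-1.

Let midR : measurable_fun [set: R] (id : R -> R) := @measurable_id _ _ _.
Let mX0 : measurable_fun [set: T] (X 0). Proof. exact: sqi_meas X_sqi. Qed.

Lemma sqi_comp (f : R -> R) : measurable_fun [set: R] f ->
  (forall x, `|f x| <= `|x|) -> sqi P (fun w => f (X 0 w)).
Proof.
move=> mf fx; apply: (sqi_le _ _ X_sqi) => //.
exact: (measurableT_comp mf mX0).
Qed.

Let S (r : nat) := \sum_(i < r) gap_rho X 3 i.

Let S_le r : S r <= 4 + 4 / 3 * \sum_(1 <= i < r.+1) rho X (2 ^ i).
Proof.
have := @sum_gap R (fun i => rho X (2 ^ i)) 3 r isT isT (fun i => rho_ge0 _ _).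
have h : forall i j, (i <= j)%N -> rho X (2 ^ j) <= rho X (2 ^ i).
  by move=> i j ij; apply: rho_anti; rewrite leq_exp2l.
move=> /(_ h) /le_trans; apply; rewrite lerD2r.
by rewrite ler_piMr// rho_le1.
Qed.

(** The two parts are centred, as the block estimates ask for mean zero; since X has mean zero, the
    subtracted constants cancel in the sum. *)
Let up M x := high M x - Ex P (fun w => high M (X 0 w)).
Let dn M x := low M x - Ex P (fun w => low M (X 0 w)).

Let mup M : measurable_fun [set: R] (up M).
Proof. by apply: measurable_funB => //; exact: measurable_high. Qed.

Let mdn M : measurable_fun [set: R] (dn M).
Proof. by apply: measurable_funB => //; exact: measurable_low. Qed.

Let sqi_high M : sqi P (fun w => high M (X 0 w)).
Proof. by apply: sqi_comp; [exact: measurable_high|move=> x; exact: normr_high_le]. Qed.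

Let sqi_low M : sqi P (fun w => low M (X 0 w)).
Proof. by apply: sqi_comp; [exact: measurable_low|move=> x; exact: normr_low_le]. Qed.

Let sqi_up M : sqi P (fun w => up M (X 0 w)).
Proof. by apply: sqiB => //; exact: sqi_cst. Qed.

Let sqi_dn M : sqi P (fun w => dn M (X 0 w)).
Proof. by apply: sqiB => //; exact: sqi_cst. Qed.

Let mean0 (f : T -> R) : sqi P f -> Ex P (fun w => f w - Ex P f) = 0.
Proof.
by move=> sf; rewrite ExB; [rewrite Ex_cst subrr|exact: sqi_ibl|exact: ibl_cst].
Qed.

Let Ex_up M : Ex P (fun w => up M (X 0 w)) = 0. Proof. exact: mean0. Qed.

Let dn_up M x : dn M x + up M x = x.
Proof.
rewrite /dn /up addrACA low_high -opprD -ExD; [|exact: sqi_ibl..].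
rewrite (_ : (fun _ => _) = X 0) ?X_mean ?subr0//.
by apply/funext => w; rewrite low_high.
Qed.

Let blk_dn_up M m n w : blk X (dn M) m n w + blk X (up M) m n w = blk X id m n w.
Proof.
rewrite /blk /lsum -big_split /=; apply: eq_bigr => i _; exact: dn_up.
Qed.

Let kappa M : R := Ex P (fun w => if M < `|X 0 w| then X 0 w ^+ 2 * g `|X 0 w| else 0).

Let kappa_null : forall e, 0 < e -> exists N, forall r, (N <= r)%N -> kappa (lev r) <= e.
Proof.
move=> e e0.
have [|M0 HM] := @tail_null _ _ _ P _ (X 0) X_moment _ mX0 e e0.
  by move=> w; rewrite mulr_ge0 ?sqr_ge0 ?g_ge0.
by have [N HN] := lev_infty M0; exists N => r /HN /ltW /HM.
Qed.

Let kappa_ge0 M : 0 <= kappa M.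
Proof.
apply: Ex_ge0 => w; case: ifP => // _.
by rewrite mulr_ge0 ?sqr_ge0 ?g_ge0.
Qed.

(** Where |X| exceeds the level, g(|X|) >= g(lev r) >= hd r / Cg. The gain 1 / hd r is spent in
    [var_high]. *)
Let up_var r : (Ng <= r)%N -> blkN X (up (lev r)) 1 ^+ 2 <= Cg * kappa (lev r) / hd r.
Proof.
move=> Nr; have [L0 _] := lev_le r; set L := lev r in L0 *.
have hr0 : 0 < hd r by exact: lt_le_trans ltr01 (hd1 r).
have gL : hd r / Cg <= g L by rewrite ler_pdivrMr// mulrC hd_g.
have g0 : 0 < hd r / Cg by rewrite divr_gt0.
rewrite (_ : Cg * kappa L / hd r = (hd r / Cg)^-1 * kappa L); last first.
  by rewrite invf_div mulrAC.
rewrite blkN1 ler_pdivlMl//.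
have h1 : N2 P (fun w => up L (X 0 w)) ^+ 2 <= N2 P (fun w => high L (X 0 w)) ^+ 2.
  by rewrite ler_sqr ?nnegrE ?N2_ge0//; exact: (N2_center (sqi_high L)).
apply: (le_trans (ler_wpM2l (ltW g0) h1)); rewrite N2_sqr -ExZ; last exact: (sqi_high L).2.
apply: le_Ex => [||w].
- by apply: iblZ; exact: (sqi_high L).2.
- exact: ibl_tail.
rewrite /high; case: ifP => h; last by rewrite expr0n mulr0.
rewrite mulrC ler_wpM2l ?sqr_ge0//; apply: (le_trans gL).
by apply: g_ndecr => //; exact: ltW.
Qed.

(** The factor exp(S) of [blkN_sharp] over exp(-21/20 S) of [y_lower] is exp(41/20 S i), at most a
    constant times hd i <= hd r, and [up_var] compensates it. *)
Let var_high : exists C, 0 < C /\ forall r i, (Ng <= r)%N -> (i <= r)%N ->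
  blkN X (up (lev r)) (2 ^ i) ^+ 2 <= C * kappa (lev r) * y i ^+ 2.
Proof.
have [C1 [C10 H1]] := blkN_sharp Xstat rho0.
have [c1 [c10 H2]] := y_lower Xstat rho0 X_sqi X_mean c0 yb.
(* The additive 4 in [S_le] gives 41/20 * 4 = 41/5; the slope is 41/20 * 4/3 = 41/15, below the 14/5
   of [hd_lower]. *)
pose E := expR (41 / 5) * CG.
have E0 : 0 < E by rewrite mulr_gt0// expR_gt0.
exists (C1 * Cg * E / c1); split; first by rewrite divr_gt0// !mulr_gt0.
move=> r i Nr ir; set L := lev r.
apply: le_trans (H1 _ (mup L) (sqi_up L) (Ex_up L) i) _.
have hr0 : 0 < hd r by exact: lt_le_trans ltr01 (hd1 r).
have ex0 := expR_gt0 (S i).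
have h1 : expR (S i) <= E * hd r * expR (- (21 / 20 * S i)).
  rewrite -[leLHS](mulfK (lt0r_neq0 (expR_gt0 (21 / 20 * S i)))) -expRN.
  rewrite ler_wpM2r ?expR_ge0// -expRD.
  apply: (@le_trans _ _ (expR (41 / 5) * expR (14 / 5 * \sum_(1 <= j < i.+1) rho X (2 ^ j)))).
    rewrite -expRD ler_expR; have := S_le i.
    have : 0 <= \sum_(1 <= j < i.+1) rho X (2 ^ j).
      by apply: sumr_ge0 => j _; exact: rho_ge0.
    move: (\sum_(1 <= j < i.+1) _) (S i) => G Si; lra.
  rewrite /E -[leRHS]mulrA ler_wpM2l ?expR_ge0//; apply: (le_trans (hd_lower i)).
  by rewrite ler_wpM2l ?(ltW CG0)// hd_mono.
have h2 : blkN X (up L) 1 ^+ 2 <= Cg * kappa L / hd r by exact: up_var.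
have h3 : 2 ^+ i * expR (- (21 / 20 * S i)) <= y i ^+ 2 / c1.
  by rewrite ler_pdivlMr// mulrC; exact: H2.
have p2 : (0 : R) <= 2 ^+ i by rewrite exprn_ge0.
have ek : 0 <= Cg * kappa L by rewrite mulr_ge0 ?(ltW Cg0).
apply: (@le_trans _ _ (C1 * (2 ^+ i * (E * hd r * expR (- (21 / 20 * S i))) *
  (Cg * kappa L / hd r)))).
  rewrite (ler_wpM2l (ltW C10))//; apply: ler_pM.
  - exact: mulr_ge0 p2 (ltW ex0).
  - exact: sqr_ge0.
  - exact: (ler_wpM2l p2 h1).
  - exact: h2.
rewrite [leLHS](_ : _ = C1 * Cg * E * kappa L * (2 ^+ i * expR (- (21 / 20 * S i)))); last first.
  by field; rewrite gt_eqF.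
apply: (@le_trans _ _ (C1 * Cg * E * kappa L * (y i ^+ 2 / c1))).
  apply: ler_wpM2l => //; apply: mulr_ge0 (kappa_ge0 _).
  exact: ltW (mulr_gt0 (mulr_gt0 C10 Cg0) E0).
by rewrite le_eqVlt; apply/orP; left; apply/eqP; field; rewrite gt_eqF.
Qed.

Let var_low : exists C N, 0 < C /\ forall r i, (N <= r)%N -> (i <= r)%N ->
  blkN X (dn (lev r)) (2 ^ i) ^+ 2 <= C * y i ^+ 2.
Proof.
have [C [C0 H]] := var_high; have [N HN] := kappa_null ltr01.
exists (2 * (1 + C)), (N + Ng)%N; split; first by rewrite mulr_gt0// addr_gt0.
move=> r i Nr ir; set L := lev r.
have k1 : kappa L <= 1 by apply: HN; move: Nr; clear; lia.
have Ngr : (Ng <= r)%N by move: Nr; clear; lia.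
have h1 : blkN X (up L) (2 ^ i) ^+ 2 <= C * y i ^+ 2.
  apply: (le_trans (H r i Ngr ir)); rewrite ler_wpM2r ?sqr_ge0//.
  by rewrite ler_piMr ?(ltW C0).
have h2 : blkN X (dn L) (2 ^ i) <= y i + blkN X (up L) (2 ^ i).
  have s1 := sqi_blk Xstat midR X_sqi 0 (2 ^ i).
  have s2 := sqi_blk Xstat (mup L) (sqi_up L) 0 (2 ^ i).
  apply: le_trans (N2B s1 s2); rewrite /blkN le_eqVlt; apply/orP; left; apply/eqP.
  by congr N2; apply/funext => w; rewrite -(blk_dn_up L) addrK.
have h3 : blkN X (dn L) (2 ^ i) ^+ 2 <= (y i + blkN X (up L) (2 ^ i)) ^+ 2.
  by rewrite ler_sqr ?nnegrE ?addr_ge0 ?blkN_ge0.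
apply: (le_trans h3).
have := sqr_ge0 (y i - blkN X (up L) (2 ^ i)).
move: (y i) (blkN X (up L) (2 ^ i)) h1 => a b h1; nra.
Qed.

Let q : R := 2 + delta / 2.
Let q2 : 2 < q. Proof. by rewrite /q ltrDl divr_gt0. Qed.
Let q3 : q <= 3. Proof. by have := hdelta1; rewrite /q; lra. Qed.

(** In [moment_blocks] the product satisfies W^q <= 2^r exp(3 tau), and one truncated term has a
    moment of order (lev r)^(delta/2) at most, from |x|^q = |x|^(delta/2) x^2. By [lev_le] the
    powers of 2 combine to (2^r)^(1 + delta/4) = (2^r)^(q/2), the main factor of y_r^q, and
    hdel^(-1/2) pays for exp(3 tau) and for the loss in [y_lower]. *)
Let moment_low : exists C N, 0 < C /\ forall r, (N <= r)%N ->
  Mq P q (blk X (dn (lev r)) 0 (2 ^ r)) <= C * y r `^ q.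
Proof.
have [Q2 Q3] := (q2, q3).
have [CA [N [CA0 HA]]] := var_low.
have [C1 [C10 H1]] := moment_blocks Xstat rho0 X_sqi X_mean c0 yb Q2 Q3 CA0.
have [c1 [c10 H2]] := y_lower Xstat rho0 X_sqi X_mean c0 yb.
(* The power q/2 of the bound for y_r^2 turns the rate 21/20 into 21/40 q. *)
have D0 : 0 <= 21 / 40 * q by rewrite mulr_ge0//; lra.
have [C3 [C30 H3]] := hdel_dom D0.
have q0 : 0 < q by lra.
have qn0 : q != 0 by rewrite gt_eqF.
have q20 : 0 <= q / 2 by lra.
have d0 := hdelta0.
pose s0 := N2 P (X 0) ^+ 2.
have s00 : 0 <= s0 by exact: sqr_ge0.
pose F := 2 `^ (delta / 2) * s0 * C3 / c1 `^ (q / 2).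
have F0 : 0 <= F.
  exact: divr_ge0 (mulr_ge0 (mulr_ge0 (powR_ge0 _ _) s00) (ltW C30)) (powR_ge0 _ _).
exists ((C1 * (F `^ q^-1 + 1)) `^ q), N; split.
  by rewrite powR_gt0// mulr_gt0// ltr_wpDl ?powR_ge0.
move=> r Nr; set L := lev r; have [L0 Lle] := lev_le r; rewrite -/L in L0 Lle.
have hdel0 : 0 < hdel r `^ 2^-1 by rewrite powR_gt0// (lt_le_trans ltr01).
have mLE : `|Ex P (fun w => low L (X 0 w))| <= L.
  apply: (le_trans (normr_Ex (sqi_ibl (sqi_low L)))).
  rewrite -[leRHS](Ex_cst P); apply: le_Ex => [||w].
  - by apply: ibl_norm; exact: sqi_ibl.
  - exact: ibl_cst.
  - exact: normr_low.
have dnB x : `|dn L x| <= 2 * L.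
  rewrite (le_trans (ler_normB _ _))// mulr_natl mulr2n lerD//.
  exact: normr_low.
have hv i : (i < r)%N -> blkN X (dn L) (2 ^ i) ^+ 2 <= CA * y i ^+ 2.
  by move=> ir; apply: HA => //; exact: ltnW.
have h1 := H1 r (dn L) (2 * L) (mdn L) dnB hv.
have yr0 := y_gt0 c0 yb r.
set W := \prod_(i < r) _ in h1; set K0 := Nq P q (blk X (dn L) 0 1) in h1.
have W0 : 0 <= W by apply: prodr_ge0 => i _; exact: powR_ge0.
have K00 : 0 <= K0 by exact: Nq_ge0.
pose tau := \sum_(i < r) gap_rho X 1 i `^ (2 / q).
have Wq : W `^ q <= 2 ^+ r * expR (3 * tau).
  rewrite /W /tau; elim: (r) => [|n IHn].
    by rewrite !big_ord0 powR1 mulr0 expR0 mulr1.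
  rewrite !big_ord_recr /= powRM ?powR_ge0//; last first.
    by apply: prodr_ge0 => i _; exact: powR_ge0.
  rewrite [3 * (_ + _)]mulrDr expRD [2 ^+ n.+1]exprSr [leRHS]mulrACA.
  apply: ler_pM; rewrite ?powR_ge0//.
  rewrite -powRrM mulVf// powRr1; last by rewrite mulr_ge0// addr_ge0// mulr_ge0// powR_ge0.
  by rewrite ler_pM2l// expR_ge1Dx.
have K0q : K0 `^ q <= 2 `^ (delta / 2) * s0 * L `^ (delta / 2).
  rewrite /K0 Nq_powR// /Mq.
  have pw x : `|dn L x| `^ q <= (2 * L) `^ (delta / 2) * dn L x ^+ 2.
    rewrite (_ : q = delta / 2 + 2%:R); last by rewrite /q addrC.
    rewrite powRD; last by apply/implyP => /eqP; lra.
    rewrite powR_mulrn// real_normK ?num_real// ler_wpM2r ?sqr_ge0//.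
    by apply: ler_powRl => //; lra.
  have sd := sqi_dn L.
  apply: (@le_trans _ _ (Ex P (fun w => (2 * L) `^ (delta / 2) * dn L (X 0 w) ^+ 2))).
    apply: le_Ex => [||w].
    - apply: (@ibl_powR_bounded _ _ _ P _ (2 * L)); [exact: ltW|exact: measurable_blk|].
      by move=> w; rewrite blk1.
    - by apply: iblZ; exact: sd.2.
    - by rewrite blk1; exact: pw.
  rewrite ExZ; last exact: sd.2.
  rewrite (powRM _ (ler0n R 2) L0) -[leRHS]mulrA [s0 * _]mulrC [leRHS]mulrA.
  apply: ler_wpM2l; first exact: mulr_ge0 (powR_ge0 _ _) (powR_ge0 _ _).
  rewrite -N2_sqr /s0 ler_sqr ?nnegrE ?N2_ge0//.
  apply: (le_trans (N2_center (sqi_low L))).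
  rewrite -ler_sqr ?nnegrE ?N2_ge0// !N2_sqr; apply: le_Ex => [||w].
  - exact: (sqi_low L).2.
  - exact: X_sqi.2.
  rewrite -(real_normK (num_real (low _ _))) -(real_normK (num_real (X 0 w))).
  by rewrite ler_sqr ?nnegrE// normr_low_le.
have yq : c1 `^ (q / 2) * ((2 ^+ r) `^ (q / 2) * expR (- (21 / 40 * q * S r))) <= y r `^ q.
  have := ler_powRl q20 _ (H2 r).
  rewrite -(powR_mulrn _ (ltW yr0)) -[(_ `^ 2%:R) `^ _]powRrM.
  rewrite (_ : 2%:R * (q / 2) = q); last by rewrite mulrC divfK ?pnatr_eq0.
  rewrite (powRM _ (ltW c10)); last by rewrite mulr_ge0 ?expR_ge0 ?exprn_ge0.
  rewrite powRM ?expR_ge0 ?exprn_ge0// -expRM.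
  rewrite (_ : - (21 / 20 * \sum_(i < r) gap_rho X 3 i) * (q / 2) = - (21 / 40 * q * S r)).
    by apply; rewrite mulr_ge0 ?(ltW c10)// mulr_ge0 ?expR_ge0 ?exprn_ge0.
  by rewrite /S; field.
have WK : (W * K0) `^ q <= F * y r `^ q.
  rewrite powRM//.
  apply: (le_trans (ler_pM (powR_ge0 _ _) (powR_ge0 _ _) Wq K0q)).
  have hh := H3 r; rewrite -/tau -/(S r) in hh.
  have e1 : (2 ^+ r : R) * (2 ^+ r) `^ (delta / 4) = (2 ^+ r) `^ (q / 2).
    rewrite -{1}[2 ^+ r]powRr1 ?exprn_ge0// -powRD.
      by congr (_ `^ _); rewrite /q; field.
    by apply/implyP => /eqP; lra.
  have c1p : 0 < c1 `^ (q / 2) by exact: powR_gt0.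
  have e2 : F * (c1 `^ (q / 2) * ((2 ^+ r) `^ (q / 2) * expR (- (21 / 40 * q * S r)))) =
     2 `^ (delta / 2) * s0 * (C3 * expR (- (21 / 40 * q * S r))) * (2 ^+ r) `^ (q / 2).
    by rewrite /F; field; rewrite gt_eqF.
  apply: le_trans (ler_wpM2l F0 yq); rewrite e2.
  apply: (@le_trans _ _ (2 ^+ r * expR (3 * tau) * (2 `^ (delta / 2) * s0 *
     ((2 ^+ r) `^ (delta / 4) * (hdel r `^ 2^-1)^-1)))).
    rewrite ler_wpM2l ?mulr_ge0 ?expR_ge0 ?exprn_ge0//.
    by rewrite ler_wpM2l// mulr_ge0// powR_ge0.
  rewrite -e1 [leLHS](_ : _ = 2 `^ (delta / 2) * s0 * (expR (3 * tau) / hdel r `^ 2^-1) *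
    (2 ^+ r * (2 ^+ r) `^ (delta / 4))); last by ring.
  rewrite ler_wpM2r ?mulr_ge0 ?powR_ge0 ?exprn_ge0//.
  apply: ler_wpM2l; first exact: mulr_ge0 (powR_ge0 _ _) s00.
  rewrite ler_pdivrMr// mulrAC.
  by rewrite expRN ler_pdivlMr ?expR_gt0// -expRD.
have h4 : Nq P q (blk X (dn L) 0 (2 ^ r)) <= C1 * (F `^ q^-1 + 1) * y r.
  apply: (le_trans h1); rewrite -mulrA ler_wpM2l ?(ltW C10)// mulrDl mul1r lerD2r.
  have qi : 0 <= q^-1 by rewrite invr_ge0 ltW.
  have := ler_powRl qi (powR_ge0 _ _) WK.
  rewrite -powRrM divff// powRr1 ?mulr_ge0// => /le_trans; apply.
  by rewrite powRM ?powR_ge0// -powRrM divff// powRr1// ltW.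
rewrite -Nq_powR//; have := ler_powRl (ltW q0) (Nq_ge0 _ _ _) h4.
rewrite powRM ?(ltW yr0)//.
by rewrite mulr_ge0 ?(ltW C10)// addr_ge0 ?powR_ge0.
Qed.

Lemma uniformly_integrable : forall e, 0 < e -> exists M N, 0 < M /\
  forall r, (N <= r)%N -> N2 P (fun w => high (M * y r) (blk X id 0 (2 ^ r) w)) ^+ 2 <=
    e * y r ^+ 2.
Proof.
move=> e e0; have [Q2 Q3] := (q2, q3).
have [C1 [N1 [C10 H1]]] := moment_low.
have [C2 [C20 H2]] := var_high.
have e8 : 0 < e / (8 * C2) by rewrite divr_gt0// mulr_gt0.
have [N2' HN2] := kappa_null e8.
have d20 : 0 < q - 2 by lra.
(* Chosen so that (M/2)^(q-2) = 4 C1 / e, which makes the bound for the moment term exactly e/2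
   y_r^2. *)
pose M := 2 * (4 * C1 / e) `^ (q - 2)^-1.
have M0 : 0 < M by rewrite mulr_gt0// powR_gt0// divr_gt0// mulr_gt0.
exists M, (N1 + N2' + Ng)%N; split => // r Nr.
have r1 : (N1 <= r)%N by move: Nr; clear; lia.
have r2 : (N2' <= r)%N by move: Nr; clear; lia.
have r3 : (Ng <= r)%N by move: Nr; clear; lia.
set L := lev r; have yr0 := y_gt0 c0 yb r.
have My : 0 < M * y r by rewrite mulr_gt0.
pose A := blk X (dn L) 0 (2 ^ r); pose B := blk X (up L) 0 (2 ^ r).
have mA : measurable_fun [set: T] A by exact: measurable_blk.
have sB : sqi P B by exact: (sqi_blk Xstat (mup L) (sqi_up L)).
have [L0 _] := lev_le r; rewrite -/L in L0.
have iA : ibl P (fun w => `|A w| `^ q).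
  apply: (ibl_powR_bounded P _ mA (blk_bounded (B := 2 * L) X _ 0 _)) => [|x]; first lra.
  rewrite (le_trans (ler_normB _ _))// mulr_natl mulr2n lerD//; first exact: normr_low.
  apply: (le_trans (normr_Ex (sqi_ibl (sqi_low L)))).
  rewrite -[leRHS](Ex_cst P); apply: le_Ex => [||w].
  - by apply: ibl_norm; exact: sqi_ibl.
  - exact: ibl_cst.
  - exact: normr_low.
pose p := (M * y r / 2) `^ (q - 2).
have p0 : 0 < p by rewrite powR_gt0// divr_gt0.
have le1 : N2 P (fun w => high (M * y r) (blk X id 0 (2 ^ r) w)) ^+ 2 <=
    2 / p * Mq P q A + 4 * N2 P B ^+ 2.
  rewrite !N2_sqr /Mq -(ExZ (2 / p) iA) -(ExZ 4 sB.2).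
  rewrite -ExD; [|exact: iblZ|by apply: iblZ; exact: sB.2].
  have sI := sqi_blk Xstat midR X_sqi 0 (2 ^ r).
  apply: le_Ex => [||w].
  - apply: (ibl_le _ _ sI.2).
      apply: measurable_funX; apply: (measurableT_comp (measurable_high _)).
      exact: measurable_blk.
    move=> w; rewrite ger0_norm ?sqr_ge0// -(real_normK (num_real (high _ _))).
    rewrite -(real_normK (num_real (blk X id 0 (2 ^ r) w))).
    by rewrite ler_sqr ?nnegrE// normr_high_le.
  - by apply: iblD; apply: iblZ => //; exact: sB.2.
  rewrite -(blk_dn_up L); apply: (le_trans (high_sqr_add _ _ Q2 My)).
  by rewrite -/(A w) -/(B w) -/p mulrAC -mulrA.
apply: (le_trans le1).
have h1 : 2 / p * Mq P q A <= e / 2 * y r ^+ 2.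
  apply: (le_trans (ler_wpM2l (ltW (divr_gt0 (ltr0n _ 2) p0)) (H1 r r1))).
  have -> : y r `^ q = y r ^+ 2 * y r `^ (q - 2).
    rewrite -powR_mulrn ?(ltW yr0)// -powRD; first by congr (_ `^ _); ring.
    by apply/implyP => /eqP; lra.
  have -> : p = 4 * C1 / e * y r `^ (q - 2).
    rewrite /p (_ : M * y r / 2 = (4 * C1 / e) `^ (q - 2)^-1 * y r); last first.
      by rewrite /M; field.
    rewrite powRM ?powR_ge0 ?(ltW yr0)// -powRrM mulVf ?gt_eqF// powRr1//.
    by rewrite divr_ge0 ?(ltW e0)// mulr_ge0// ltW.
  have yq0 : 0 < y r `^ (q - 2) by exact: powR_gt0.
  by rewrite le_eqVlt; apply/orP; left; apply/eqP; field; rewrite !gt_eqF.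
have h2 : 4 * N2 P B ^+ 2 <= e / 2 * y r ^+ 2.
  have := H2 r r r3 (leqnn _); rewrite -/L -/B => h.
  apply: (le_trans (ler_wpM2l (ler0n _ 4) h)).
  have := HN2 r r2; rewrite -/L => k1.
  rewrite mulrA ler_wpM2r ?sqr_ge0//.
  apply: (le_trans (ler_wpM2l (ler0n _ 4) (ler_wpM2l (ltW C20) k1))).
  by rewrite le_eqVlt; apply/orP; left; apply/eqP; field; rewrite gt_eqF.
apply: (le_trans (lerD h1 h2)); rewrite -mulrDl ler_wpM2r ?sqr_ge0//; lra.
Qed.

End uniform_integrability.

(** * The heat flow of the normal distribution function *)

Section mean_value.
Context {R : realType}.
Implicit Types f : R -> R.

Lemma mean_value f df (x y : R) : (forall t, is_derive t (1:R) f (df t)) ->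
  exists c, `|c - x| <= `|y - x| /\ f y - f x = df c * (y - x).
Proof.
move=> fd.
have cf : continuous f.
  by move=> t; apply: differentiable_continuous; apply/derivable1_diffP; have [] := fd t.
have [xy|yx] := leP x y.
  have [c] := @MVT_segment _ f df x y xy (fun t _ => fd t) (continuous_subspaceT cf).
  rewrite inE/= => /andP[xc cy] e; exists c; split => //.
  by rewrite !ger0_norm ?subr_ge0// lerD2r.
have [c] := @MVT_segment _ f df y x (ltW yx) (fun t _ => fd t) (continuous_subspaceT cf).
rewrite inE/= => /andP[xc cy] e; exists c; split => //.
  by rewrite !ler0_norm ?subr_le0 ?(ltW yx)// lerN2 lerD2r.
by rewrite -[LHS]opprB e -mulrN opprB.
Qed.

Lemma lipschitz_derive f df (K : R) : (forall t, is_derive t (1:R) f (df t)) ->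
  (forall t, `|df t| <= K) -> forall x y, `|f y - f x| <= K * `|y - x|.
Proof.
move=> fd dK x y; have [c [_ ->]] := mean_value x y fd.
by rewrite normrM ler_wpM2r.
Qed.

Lemma taylor1 f f1 (K : R) : 0 <= K -> (forall t, is_derive t (1:R) f (f1 t)) ->
  (forall x y, `|f1 y - f1 x| <= K * `|y - x|) ->
  forall x y, `|f y - f x - f1 x * (y - x)| <= K * `|y - x| ^+ 2.
Proof.
move=> K0 fd f1K x y; have [c [cx ->]] := mean_value x y fd.
rewrite -mulrBl normrM expr2 mulrA ler_wpM2r//.
by apply: (le_trans (f1K _ _)); rewrite ler_wpM2l.
Qed.

(** The derivative of the second-order remainder of f is the first-order remainder of f1, so the
    mean value theorem reduces the claim to [taylor1]. *)
Lemma taylor2 f f1 f2 (K : R) : 0 <= K -> (forall t, is_derive t (1:R) f (f1 t)) ->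
  (forall t, is_derive t (1:R) f1 (f2 t)) ->
  (forall x y, `|f2 y - f2 x| <= K * `|y - x|) ->
  forall x y, `|f y - f x - f1 x * (y - x) - 2^-1 * f2 x * (y - x) ^+ 2| <=
    K * `|y - x| ^+ 3.
Proof.
move=> K0 fd f1d f2K x y.
pose G t := f t - f1 x * (t - x) - 2^-1 * f2 x * (t - x) ^+ 2.
have Gd t : is_derive t (1:R) G (f1 t - f1 x - f2 x * (t - x)).
  have h := fd t.
  have -> : G = f - cst (f1 x) * (id - cst x) - cst (2^-1 * f2 x) * (id - cst x) ^+ 2.
    by apply/funext.
  by apply: is_derive_eq; rewrite /GRing.scale /= !fctE /=; field.
have [c [cx]] := mean_value x y Gd.
rewrite /G subrr mulr0 expr0n /= mulr0 !subr0 => e.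
have -> : f y - f x - f1 x * (y - x) - 2^-1 * f2 x * (y - x) ^+ 2 =
  f y - f1 x * (y - x) - 2^-1 * f2 x * (y - x) ^+ 2 - f x by ring.
rewrite e normrM exprSr mulrA ler_wpM2r//.
apply: (le_trans (taylor1 K0 f1d f2K x c)).
by rewrite ler_wpM2l// ler_sqr ?nnegrE.
Qed.
End mean_value.

Section normal_cdf.
Context {R : realType}.

Definition gauss (z : R) : R := normal_pdf 0 1 z.
Definition Phi (x : R) : R := fine (normal_prob (0 : R) 1 `]-oo, x]%classic).

Lemma gaussE z : gauss z = normal_peak 1 * expR (- (z ^+ 2 / 2)).
Proof.
by rewrite /gauss normal_pdfE ?oner_eq0// /normal_fun subr0 expr1n mulNr.
Qed.

Lemma PhiE x : normal_prob (0 : R) 1 `]-oo, x]%classic = (Phi x)%:E.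
Proof. by rewrite /Phi fineK// fin_num_measure. Qed.

Lemma Phi_ge0 x : 0 <= Phi x. Proof. by rewrite /Phi fine_ge0. Qed.

Lemma Phi_le1 x : Phi x <= 1.
Proof. by rewrite -lee_fin -PhiE; exact: probability_le1. Qed.

Lemma Phi_mono x y : x <= y -> Phi x <= Phi y.
Proof.
move=> xy; rewrite -lee_fin -!PhiE le_measure ?inE//; exact: subitvPr.
Qed.

Lemma is_derive_Phi x : is_derive x (1:R) Phi (gauss x).
Proof.
have ig : lebesgue_measure.-integrable [set` Interval -oo%O (BRight (x + 1))] (EFin \o gauss).
  by apply: integrableS (integrable_normal_pdf 0 1).
have xu : x < x + 1 by rewrite ltrDl.
have cx : {for x, continuous gauss}.
  by apply: continuous_normal_pdf; rewrite oner_eq0.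
have [h1 h2] : derivable Phi x 1 /\ Phi^`()%classic x = gauss x.
  by apply: (continuous_FTC1 xu ig _ cx); rewrite ltNyr.
by split; [exact: h1|rewrite -derive1E].
Qed.

Lemma is_derive_gauss z : is_derive z (1:R) gauss (- (z * gauss z)).
Proof.
have -> : gauss = cst (normal_peak 1) * (expR \o (cst (- 2^-1) * (id ^+ 2))).
  by apply/funext => t; rewrite gaussE /= !fctE /=; congr (_ * expR _); field.
have d1 : is_derive z (1:R) (cst (- 2^-1) * (id ^+ 2)) (- z).
  by apply: is_derive_eq; rewrite /GRing.scale /= !fctE /=; field.
have d2 : is_derive z (1:R) (expR \o (cst (- 2^-1) * (id ^+ 2)))
   (expR ((cst (- 2^-1) * (id ^+ 2)) z) * (- z)) by exact: is_derive1_comp.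
by apply: is_derive_eq; rewrite /GRing.scale /= !fctE /=; ring.
Qed.

Lemma gauss_ge0 z : 0 <= gauss z. Proof. exact: normal_pdf_ge0. Qed.

Lemma gauss_decay : exists K : R, 0 < K /\ forall z, (1 + z ^+ 4) * gauss z <= K.
Proof.
have p0 : 0 < normal_peak 1 :> R by rewrite normal_peak_gt0// oner_eq0.
(* From exp u >= 1 + u^2/2 at u = z^2/2, that is 8 exp(z^2/2) >= 8 + z^4. *)
exists (8 * normal_peak 1); split; first by rewrite mulr_gt0.
move=> z; rewrite gaussE mulrCA mulrC ler_pM2r// expRN.
rewrite ler_pdivrMr ?expR_gt0//.
have z2 : 0 <= z ^+ 2 / 2 by rewrite divr_ge0 ?sqr_ge0.
have := @expR_ge1Dxn R (z ^+ 2 / 2) 1 z2.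
rewrite (_ : (2`!)%:R = 2)//; rewrite exprMn -exprM => h.
have z4 := exprn_even_ge0 z (isT : ~~ odd 4); lra.
Qed.

Lemma gauss_moments : exists K : R, 0 < K /\ forall z (j : nat), (j <= 4)%N ->
  `|z| ^+ j * gauss z <= K.
Proof.
have [K [K0 H]] := gauss_decay; exists K; split => // z j j4.
apply: le_trans (H z); rewrite ler_wpM2r ?gauss_ge0//.
have -> : z ^+ 4 = `|z| ^+ 4 by rewrite -normrX ger0_norm// exprn_even_ge0.
have [z1|z1] := leP `|z| 1.
  by rewrite (le_trans (exprn_ile1 j (normr_ge0 z) z1))// lerDl exprn_ge0.
by rewrite (le_trans (ler_weXn2l (ltW z1) j4))// lerDr.
Qed.

Section heat.
Variable eps : R.
Hypothesis eps0 : 0 < eps.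
Variable a : R.
(* [heat t] is the expectation of [1_{. <= a}] smoothed by a normal variable with
   standard deviation [t]: it solves the heat equation in the variance [t^2]. *)
Definition heat (t y : R) : R := Phi ((a - y) / t).
Definition heat1 (t y : R) : R := - (gauss ((a - y) / t) / t).
Definition heat2 (t y : R) : R := - ((a - y) / t * gauss ((a - y) / t) / t ^+ 2).
Definition heat3 (t y : R) : R :=
  (1 - ((a - y) / t) ^+ 2) * gauss ((a - y) / t) / t ^+ 3.

Let is_derive_arg (t y : R) : is_derive y (1:R) (fun x => (a - x) / t) (- t^-1).
Proof.
have -> : (fun x => (a - x) / t) = (cst a - id) * cst t^-1 by apply/funext.
by apply: is_derive_eq; rewrite /GRing.scale /= !fctE /=; ring.
Qed.

Lemma is_derive_heat t y : is_derive y (1:R) (heat t) (heat1 t y).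
Proof.
have d1 := is_derive_arg t y; have d2 := is_derive_Phi ((a - y) / t).
have -> : heat t = Phi \o (fun x => (a - x) / t) by apply/funext.
by apply: is_derive_eq; rewrite /heat1 /= mulrN.
Qed.

Lemma is_derive_heat1 t y : t != 0 -> is_derive y (1:R) (heat1 t) (heat2 t y).
Proof.
move=> t0.
have d1 := is_derive_arg t y; have d2 := is_derive_gauss ((a - y) / t).
have -> : heat1 t = (gauss \o (fun x => (a - x) / t)) * cst (- t^-1).
  by apply/funext => x; rewrite /heat1 ?fctE /= mulrN.
have d3 : is_derive y (1:R) (gauss \o (fun x => (a - x) / t))
  (- ((a - y) / t * gauss ((a - y) / t)) * (- t^-1)) by exact: is_derive1_comp.
by apply: is_derive_eq; rewrite /heat2 /GRing.scale /= ?fctE /=; field.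
Qed.

Lemma is_derive_heat2 t y : t != 0 -> is_derive y (1:R) (heat2 t) (heat3 t y).
Proof.
move=> t0.
have d1 := is_derive_arg t y; have d2 := is_derive_gauss ((a - y) / t).
have -> : heat2 t = (fun x => (a - x) / t) * (gauss \o (fun x => (a - x) / t)) *
    cst (- t^-2).
  by apply/funext => x; rewrite /heat2 ?fctE /= mulrN.
have d3 : is_derive y (1:R) (gauss \o (fun x => (a - x) / t))
  (- ((a - y) / t * gauss ((a - y) / t)) * (- t^-1)) by exact: is_derive1_comp.
by apply: is_derive_eq; rewrite /heat3 /GRing.scale /= ?fctE /=; field.
Qed.

Lemma heat_bounds : exists K : R, 0 < K /\ forall t y, eps <= t ->
  [/\ `|heat1 t y| <= K, `|heat2 t y| <= K & `|heat3 t y| <= K].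
Proof.
have [C [C0 H]] := gauss_moments.
have E0 := eps0.
pose D := eps^-1 + eps^-1 ^+ 2 + eps^-1 ^+ 3.
have i0 : 0 < eps^-1 by rewrite invr_gt0.
exists (2 * C * D); split.
  by rewrite !mulr_gt0// !addr_gt0// exprn_gt0.
move=> t y et; have t0 : 0 < t by exact: lt_le_trans et.
have ti : t^-1 <= eps^-1 by rewrite lef_pV2.
have ti0 : 0 <= t^-1 by rewrite invr_ge0 ltW.
have P j : (j <= 3)%N -> (0 < j)%N -> t^-1 ^+ j <= D.
  move=> j3 j0; apply: (@le_trans _ _ (eps^-1 ^+ j)).
    by apply: lerXn2r; rewrite ?nnegrE// ltW.
  have h1 := ltW i0; have h2 := exprn_ge0 2 h1; have h3 := exprn_ge0 3 h1.
  rewrite /D; case: j j3 j0 => [|[|[|[|//]]]] // _ _; rewrite ?expr1; lra.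
set z := (a - y) / t.
have g0 := gauss_ge0 z.
have h0 := H z 0%N isT; have h1 := H z 1%N isT; have h2 := H z 2%N isT.
rewrite expr0 mul1r in h0; rewrite expr1 in h1.
have big x (j : nat) : (j <= 3)%N -> (0 < j)%N -> `|x| <= 2 * C -> `|x / t ^+ j| <= 2 * C * D.
  move=> j3 j0 xC; rewrite normrM normfV normrX (ger0_norm (ltW t0)) -exprVn.
  by apply: ler_pM => //; [rewrite exprn_ge0|exact: P].
split.
- rewrite /heat1 normrN -/z -[X in gauss z / X]expr1; apply: big => //.
  rewrite ger0_norm//; lra.
- rewrite /heat2 normrN -/z; apply: big => //.
  by rewrite normrM (ger0_norm g0); lra.
- rewrite /heat3 -/z; apply: big => //.
  rewrite mulrBl mul1r; apply: (le_trans (ler_normB _ _)).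
  by rewrite normrM normrX !(ger0_norm g0); lra.
Qed.

(** Two bounds for the same remainder, as in the proof of Lindeberg: the cubic one is for small
    increments, the quadratic one for the tail. *)
Definition taylor_estimate (K : R) : Prop := forall t x y, eps <= t ->
  [/\ `|heat1 t x| <= K, `|heat2 t x| <= K,
     `|heat t (x + y) - heat t x - heat1 t x * y - 2^-1 * heat2 t x * y ^+ 2| <= K * y ^+ 2 &
     `|heat t (x + y) - heat t x - heat1 t x * y - 2^-1 * heat2 t x * y ^+ 2| <=
       K * `|y| ^+ 3].

Definition heat_estimate (K : R) : Prop := forall t1 t2 y, eps <= t1 -> t1 <= t2 ->
  `|heat t2 y - heat t1 y - 2^-1 * heat2 t1 y * (t2 ^+ 2 - t1 ^+ 2)| <=
  K * (t2 ^+ 2 - t1 ^+ 2) ^+ 2.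

Lemma heat_taylor : exists K : R, 0 < K /\ taylor_estimate K.
Proof.
have [K [K0 HK]] := heat_bounds; exists (2 * K); split; first by rewrite mulr_gt0.
move=> t x y et; have t0 : t != 0 by rewrite gt_eqF// (lt_le_trans eps0).
have K0' := ltW K0.
have d1 s := is_derive_heat t s; have d2 s := is_derive_heat1 s t0.
have d3 s := is_derive_heat2 s t0.
have l2 := lipschitz_derive d3 (fun s => let: And3 _ _ h := HK t s et in h).
have l1 := lipschitz_derive d2 (fun s => let: And3 _ h _ := HK t s et in h).
have t1 := taylor1 K0' d1 l1 x (x + y); have t2 := taylor2 K0' d1 d2 l2 x (x + y).
rewrite [x + y]addrC addrK in t1; rewrite [x + y]addrC addrK in t2.
have [b1 b2 b3] := HK t x et; have n3 := exprn_ge0 3 (normr_ge0 y).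
split; [lra|lra| |].
- apply: (le_trans (ler_normB _ _)); rewrite -normrX (ger0_norm (sqr_ge0 _)) in t1.
  rewrite (addrC x) normrM normrM (ger0_norm (sqr_ge0 y)).
  have := sqr_ge0 y; rewrite [`|2^-1|]ger0_norm ?invr_ge0// => y2.
  have := ler_wpM2r y2 b2; have := mulr_ge0 K0' y2; lra.
- by rewrite (addrC x); apply: (le_trans t2); have := mulr_ge0 K0' n3; lra.
Qed.

Lemma ln1D_approx (x : R) : 0 <= x -> `|ln (1 + x) - x| <= x ^+ 2.
Proof.
move=> x0; have x1 : 0 < 1 + x by lra.
have h1 : ln (1 + x) <= x by apply: le_ln1Dx; lra.
have h2 : x / (1 + x) <= ln (1 + x).
  rewrite -[leRHS]opprK -lnV ?posrE// lerNr.
  have e : (1 + x)^-1 = 1 + - (x / (1 + x)) by field; rewrite gt_eqF.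
  rewrite [X in ln X]e.
  by apply: le_ln1Dx; rewrite ltrN2 ltr_pdivrMr//; lra.
have h3 : x - x ^+ 2 <= x / (1 + x) by rewrite ler_pdivlMr//; nra.
by rewrite ler_norml; apply/andP; split; lra.
Qed.

(** With t = exp s the function becomes Phi((a - y) exp(-s)), whose derivatives in s are bounded by
    Gaussian moments. The heat equation is the identity A1(ln t1) = t1^2 heat2. The increment of s
    is ln(1 + x) / 2, where x is the relative increase of t^2, and replacing ln(1 + x) by x costs at
    most x^2. *)
Lemma heat_time : exists K : R, 0 < K /\ heat_estimate K.
Proof.
have [C [C0 H]] := gauss_moments; have E0 := eps0.
have i0 : 0 < eps ^- 2 by rewrite invr_gt0 exprn_gt0.
exists (2 * C * (eps ^- 2) ^+ 2); split; first by rewrite !mulr_gt0// exprn_gt0.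
move=> t1 t2 y e1 t12.
have t10 : 0 < t1 by exact: lt_le_trans e1.
have t20 : 0 < t2 by exact: lt_le_trans t12.
pose w := a - y.
pose A s := Phi (w * expR (- s)).
pose A1 s := - (w * expR (- s) * gauss (w * expR (- s))).
pose A2 s := w * expR (- s) * gauss (w * expR (- s)) * (1 - (w * expR (- s)) ^+ 2).
have da s : is_derive s (1:R) (fun s => w * expR (- s)) (- (w * expR (- s))).
  have -> : (fun s => w * expR (- s)) = cst w * (expR \o -%R) by apply/funext.
  by apply: is_derive_eq; rewrite /GRing.scale /= ?fctE /=; ring.
have dA s : is_derive s (1:R) A (A1 s).
  have d1 := da s; have d2 := is_derive_Phi (w * expR (- s)).
  have -> : A = Phi \o (fun s => w * expR (- s)) by apply/funext.
  by apply: is_derive_eq; rewrite /A1 /=; ring.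
have dA1 s : is_derive s (1:R) A1 (A2 s).
  have d1 := da s; have d2 := is_derive_gauss (w * expR (- s)).
  have -> : A1 = - ((fun s => w * expR (- s)) * (gauss \o (fun s => w * expR (- s)))).
    by apply/funext.
  have d3 : is_derive s (1:R) (gauss \o (fun s => w * expR (- s)))
    (- (w * expR (- s) * gauss (w * expR (- s))) * (- (w * expR (- s)))).
    exact: is_derive1_comp.
  by apply: is_derive_eq; rewrite /A2 /GRing.scale /= ?fctE /=; ring.
have A2b s : `|A2 s| <= 2 * C.
  rewrite /A2; move: (w * expR (- s)) => z; have g0 := gauss_ge0 z.
  rewrite mulrBr mulr1; apply: (le_trans (ler_normB _ _)).
  have h1 := H z 1%N isT; have h3 := H z 3%N isT; rewrite expr1 in h1.
  rewrite !normrM (ger0_norm g0); lra.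
have A1b s : `|A1 s| <= C.
  by rewrite /A1 normrN normrM (ger0_norm (gauss_ge0 _)) -{1}[`|_|]expr1; exact: H.
have C20 : 0 <= 2 * C by rewrite mulr_ge0// ltW.
have ta := taylor1 C20 dA (lipschitz_derive dA1 A2b) (ln t1) (ln t2).
have Ae t : 0 < t -> A (ln t) = heat t y.
  by move=> t0; rewrite /A /heat expRN lnK ?posrE.
have A1e : A1 (ln t1) = t1 ^+ 2 * heat2 t1 y.
  rewrite /A1 /heat2 expRN lnK ?posrE// -/w; field; rewrite gt_eqF//.
rewrite !Ae// in ta.
pose x := (t2 ^+ 2 - t1 ^+ 2) / t1 ^+ 2.
have t1n : t1 != 0 by rewrite gt_eqF.
have v0 : 0 <= t2 ^+ 2 - t1 ^+ 2 by rewrite subr_ge0 ler_sqr ?nnegrE ?(ltW t10) ?(ltW t20).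
have x0 : 0 <= x by rewrite divr_ge0// sqr_ge0.
have lx : ln t2 - ln t1 = 2^-1 * ln (1 + x).
  have -> : 1 + x = (t2 / t1) ^+ 2 by rewrite /x; field.
  by rewrite lnXn ?divr_gt0// ln_div ?posrE// -[X in _ * X]mulr_natl mulKf.
have h2 : 2^-1 * heat2 t1 y * (t2 ^+ 2 - t1 ^+ 2) = A1 (ln t1) * (2^-1 * x).
  by rewrite A1e /x; field.
have lb := ln1D_approx x0.
have l0 : 0 <= ln (1 + x) by apply: ln_ge0; lra.
have l1 : ln (1 + x) <= x by apply: le_ln1Dx; lra.
have key : `|heat t2 y - heat t1 y - 2^-1 * heat2 t1 y * (t2 ^+ 2 - t1 ^+ 2)| <=
    2 * C * x ^+ 2.
  rewrite h2 (_ : _ - _ = (heat t2 y - heat t1 y - A1 (ln t1) * (ln t2 - ln t1)) +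
    A1 (ln t1) * (2^-1 * (ln (1 + x) - x))); last by rewrite lx; ring.
  apply: (le_trans (ler_normD _ _)).
  have k1 : `|A1 (ln t1) * (2^-1 * (ln (1 + x) - x))| <= C * (2^-1 * x ^+ 2).
    rewrite normrM; apply: ler_pM => //; rewrite normrM ger0_norm ?invr_ge0//.
    by rewrite ler_wpM2l ?invr_ge0.
  have k2 : `|ln t2 - ln t1| ^+ 2 <= 4^-1 * x ^+ 2.
    rewrite lx ger0_norm ?mulr_ge0 ?invr_ge0// exprMn.
    have -> : (2^-1 : R) ^+ 2 = 4^-1 by field.
    by rewrite ler_wpM2l ?invr_ge0// ler_sqr.
  have := ler_wpM2l C20 k2; have := sqr_ge0 x; move: ta k1; nra.
apply: (le_trans key).
rewrite -[leRHS]mulrA ler_wpM2l// -exprMn ler_sqr ?nnegrE//; last first.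
  by rewrite mulr_ge0// ltW.
rewrite /x mulrC ler_wpM2r// lef_pV2 ?posrE ?exprn_gt0//.
by rewrite ler_sqr ?nnegrE ?(ltW t10) ?(ltW E0).
Qed.

Lemma heat_estimates : exists K : R, [/\ 0 < K, taylor_estimate K & heat_estimate K].
Proof.
have [K1 [K10 H1]] := heat_taylor; have [K2 [K20 H2]] := heat_time.
have K1K : K1 <= K1 + K2 by rewrite lerDl ltW.
exists (K1 + K2); split; first exact: addr_gt0.
  move=> t x z tx; have [h1 h2 h3 h4] := H1 t x z tx; split.
  - exact: le_trans K1K.
  - exact: le_trans K1K.
  - by apply: (le_trans h3); rewrite ler_wpM2r ?sqr_ge0.
  - by apply: (le_trans h4); rewrite ler_wpM2r ?exprn_ge0.
move=> t1 t2 z h1 h2; apply: (le_trans (H2 _ _ z h1 h2)).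
by rewrite ler_wpM2r ?sqr_ge0// lerDr ltW.
Qed.

End heat.

End normal_cdf.

(** * Lindeberg replacement of blocks *)

Section one_step.
Context {d : measure_display} {T : measurableType d} {R : realType}.
Variable P : probability T R.
Variables (A Y : T -> R) (r : R).
Hypothesis mA : measurable_fun [set: T] A.
Hypothesis sY : sqi P Y.
Hypothesis EY : Ex P Y = 0.
Hypothesis mixAY : forall phi psi : R -> R,
  measurable_fun [set: R] phi -> measurable_fun [set: R] psi ->
  sqi P (fun w => phi (A w)) -> sqi P (fun w => psi (Y w)) ->
  `|Ex P (fun w => phi (A w) * psi (Y w)) -
    Ex P (fun w => phi (A w)) * Ex P (fun w => psi (Y w))| <=
  r * (N2 P (fun w => phi (A w)) * N2 P (fun w => psi (Y w))).
Variables (f f1 f2 : R -> R) (K eta : R).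
Hypotheses (mf : measurable_fun [set: R] f) (mf1 : measurable_fun [set: R] f1)
  (mf2 : measurable_fun [set: R] f2).
Hypotheses (f_bd : forall x, `|f x| <= 1) (f1_bd : forall x, `|f1 x| <= K)
  (f2_bd : forall x, `|f2 x| <= K).
Hypothesis f_sq : forall x y,
  `|f (x + y) - f x - f1 x * y - 2^-1 * f2 x * y ^+ 2| <= K * y ^+ 2.
Hypothesis f_cube : forall x y,
  `|f (x + y) - f x - f1 x * y - 2^-1 * f2 x * y ^+ 2| <= K * `|y| ^+ 3.
Hypotheses (K0 : 0 <= K) (eta0 : 0 < eta) (r0 : 0 <= r).
Let v := N2 P Y.
Let tau := N2 P (fun w => high eta (Y w)) ^+ 2.

Lemma N2_bounded (g : T -> R) (C : R) : measurable_fun [set: T] g ->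
  (forall w, `|g w| <= C) -> N2 P g <= C.
Proof.
move=> mg gC; have sg := sqi_bounded P mg gC.
have C0 : 0 <= C.
  (* The space has a point because its total mass is 1. *)
  suff [w _] : [set: T] !=set0 by exact: le_trans (normr_ge0 _) (gC w).
  apply/set0P/negP => /eqP T0; have := @probability_setT _ _ _ P.
  by rewrite T0 measure0 => /eqP; rewrite eqe eq_sym oner_eq0.
rewrite -ler_sqr ?nnegrE ?N2_ge0// N2_sqr -[leRHS](Ex_cst P).
apply: le_Ex => [||w]; [exact: sg.2|exact: ibl_cst|].
by rewrite -(real_normK (num_real _)) ler_sqr ?nnegrE.
Qed.

Let comp_meas (g : R -> R) (Z : T -> R) : measurable_fun [set: R] g ->
  measurable_fun [set: T] Z -> measurable_fun [set: T] (fun w => g (Z w)).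
Proof. by move=> mg mZ; exact: measurableT_comp mg mZ. Qed.

Let mY : measurable_fun [set: T] Y. Proof. exact: sqi_meas sY. Qed.

Let sf1 : sqi P (fun w => f1 (A w)).
Proof. by apply: (@sqi_bounded _ _ _ _ _ K) => //; exact: comp_meas. Qed.

Let sf2 : sqi P (fun w => f2 (A w)).
Proof. by apply: (@sqi_bounded _ _ _ _ _ K) => //; exact: comp_meas. Qed.

Let s_high : sqi P (fun w => high eta (Y w)).
Proof.
apply: (sqi_le _ _ sY) => [|w]; last exact: normr_high_le.
by apply: comp_meas => //; exact: measurable_high.
Qed.

Let low_high_sqr x : low eta x ^+ 2 + high eta x ^+ 2 = x ^+ 2.
Proof. by rewrite /low /high; case: ifP; rewrite expr0n ?add0r ?addr0. Qed.

(** At first order, mixing and E Y = 0 make the mean of f1(A) Y small. At second order, Y is only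
    square-integrable, so Y^2 need not be in L^2, as mixing requires; mixing is applied to Y^2
    truncated at eta, and the rest is bounded by tau. The Taylor remainder is cubic up to eta and
    quadratic beyond. *)
Lemma one_step :
  `|Ex P (fun w => f (A w + Y w)) - Ex P (fun w => f (A w)) -
    2^-1 * v ^+ 2 * Ex P (fun w => f2 (A w))| <=
  K * (r * v + r * eta ^+ 2 + 2 * tau + eta * v ^+ 2).
Proof.
have [K0' eta0'] := (K0, eta0); have r0' := r0.
have mAY : measurable_fun [set: T] (fun w => A w + Y w) by exact: measurable_funD.
have if0 : ibl P (fun w => f (A w)).
  by apply: (@ibl_bounded _ _ _ _ _ 1) => //; exact: comp_meas.
have ifY : ibl P (fun w => f (A w + Y w)).
  by apply: (@ibl_bounded _ _ _ _ _ 1) => //; exact: comp_meas mf mAY.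
have i1 : ibl P (fun w => f1 (A w) * Y w) by exact: sqiM.
have bl : forall w, `|low eta (Y w) ^+ 2| <= eta ^+ 2.
  move=> w; rewrite normrX ler_sqr ?nnegrE ?(ltW eta0)//.
  exact: normr_low (ltW eta0).
have mlow2 : measurable_fun [set: R] (fun x => low eta x ^+ 2).
  by apply: measurable_funX; exact: measurable_low.
have sl2 : sqi P (fun w => low eta (Y w) ^+ 2).
  by apply: (sqi_bounded P _ bl); exact: comp_meas mlow2 mY.
have i2l : ibl P (fun w => f2 (A w) * low eta (Y w) ^+ 2) by exact: sqiM.
have mf2A : measurable_fun [set: T] (fun w => f2 (A w)) by exact: comp_meas.
have i2h : ibl P (fun w => f2 (A w) * high eta (Y w) ^+ 2).
  apply: (ibl_le _ _ (iblZ K s_high.2)).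
    by apply: measurable_funM => //; apply: measurable_funX; exact: sqi_meas s_high.
  by move=> w; rewrite normrM [`|_ ^+ 2|]ger0_norm ?sqr_ge0// ler_wpM2r ?sqr_ge0.
have i2 := iblD i2l i2h.
pose Rm w := f (A w + Y w) - f (A w) - f1 (A w) * Y w -
  2^-1 * (f2 (A w) * low eta (Y w) ^+ 2 + f2 (A w) * high eta (Y w) ^+ 2).
have iR : ibl P Rm.
  by apply: iblB; [apply: iblB => //; exact: iblB|exact: iblZ].
have Rle w : `|Rm w| <= K * (eta * Y w ^+ 2 + high eta (Y w) ^+ 2).
  rewrite /Rm -mulrDr low_high_sqr mulrA.
  rewrite /high; case: ltP => h.
    apply: (le_trans (f_sq _ _)); rewrite ler_wpM2l// lerDr mulr_ge0 ?sqr_ge0//.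
    exact: ltW.
  apply: (le_trans (f_cube _ _)); rewrite expr0n addr0 ler_wpM2l//.
  by rewrite exprS real_normK ?num_real// ler_wpM2r ?sqr_ge0.
have ER : `|Ex P Rm| <= K * (eta * v ^+ 2 + tau).
  rewrite /tau /v !N2_sqr -(ExZ eta sY.2) -ExD; [|exact: iblZ sY.2|exact: s_high.2].
  have iX := iblD (iblZ eta sY.2) s_high.2.
  by rewrite -ExZ//; apply: Ex_le_norm => //; exact: iblZ.
have dec : Ex P (fun w => f (A w + Y w)) = Ex P (fun w => f (A w)) +
    Ex P (fun w => f1 (A w) * Y w) +
    2^-1 * (Ex P (fun w => f2 (A w) * low eta (Y w) ^+ 2) +
            Ex P (fun w => f2 (A w) * high eta (Y w) ^+ 2)) + Ex P Rm.
  rewrite -(ExD i2l i2h) -(ExZ _ i2) -(ExD if0 i1).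
  have i01 := iblD if0 i1; have i2' := iblZ 2^-1 i2.
  rewrite -(ExD i01 i2') -(ExD (iblD i01 i2') iR).
  by apply: eq_Ex => w; rewrite /Rm; ring.
have e1 : `|Ex P (fun w => f1 (A w) * Y w)| <= K * (r * v).
  have := mixAY mf1 (@measurable_id _ _ _) sf1 sY; rewrite EY mulr0 subr0.
  move/le_trans; apply; rewrite mulrCA.
  apply: ler_wpM2r; first by rewrite mulr_ge0 ?N2_ge0.
  by apply: N2_bounded => //; exact: comp_meas.
have N2l : N2 P (fun w => low eta (Y w) ^+ 2) <= eta ^+ 2.
  by apply: N2_bounded => //; exact: comp_meas mlow2 mY.
have N2f2 : N2 P (fun w => f2 (A w)) <= K by exact: N2_bounded.
have e2 : `|Ex P (fun w => f2 (A w) * low eta (Y w) ^+ 2) -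
    Ex P (fun w => f2 (A w)) * Ex P (fun w => low eta (Y w) ^+ 2)| <= K * (r * eta ^+ 2).
  apply: (le_trans (mixAY mf2 mlow2 sf2 sl2)).
  by rewrite [leRHS]mulrCA ler_wpM2l//; apply: ler_pM; rewrite ?N2_ge0.
have tauE : Ex P (fun w => high eta (Y w) ^+ 2) = tau by rewrite /tau N2_sqr.
have tau0 : 0 <= tau by exact: sqr_ge0.
have vE : v ^+ 2 = Ex P (fun w => low eta (Y w) ^+ 2) + tau.
  rewrite -tauE -ExD; [|exact: sqi_ibl|exact: s_high.2].
  by rewrite /v N2_sqr; apply: eq_Ex => w; rewrite low_high_sqr.
have e3 : `|Ex P (fun w => f2 (A w) * high eta (Y w) ^+ 2)| <= K * tau.
  rewrite -tauE -(ExZ K s_high.2); apply: Ex_le_norm => //; first exact: iblZ s_high.2.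
  by move=> w; rewrite normrM [`|_ ^+ 2|]ger0_norm ?sqr_ge0// ler_wpM2r ?sqr_ge0.
have e4 : `|Ex P (fun w => f2 (A w)) * tau| <= K * tau.
  rewrite normrM (ger0_norm tau0) ler_wpM2r//.
  apply: (le_trans (normr_Ex (sqi_ibl sf2))); rewrite -[leRHS](Ex_cst P).
  by apply: le_Ex => //; [apply: ibl_norm; exact: sqi_ibl|exact: ibl_cst].
rewrite dec.
move: vE e1 e2 e3 e4 ER.
move: (Ex P (fun w => f (A w))) (Ex P (fun w => f1 (A w) * Y w))
  (Ex P (fun w => f2 (A w) * low eta (Y w) ^+ 2))
  (Ex P (fun w => f2 (A w) * high eta (Y w) ^+ 2))
  (Ex P (fun w => f2 (A w))) (Ex P (fun w => low eta (Y w) ^+ 2)) (Ex P Rm) => a b c D F G H.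
move=> vE e1 e2 e3 e4 e5; rewrite [X in _ - 2^-1 * X * _]vE.
rewrite (_ : _ - _ - _ = b + 2^-1 * (c - F * G) + 2^-1 * D - 2^-1 * (F * tau) + H); last by ring.
apply: (le_trans (ler_normD _ _)).
have h1 : `|b + 2^-1 * (c - F * G) + 2^-1 * D - 2^-1 * (F * tau)| <=
    `|b| + 2^-1 * `|c - F * G| + 2^-1 * `|D| + 2^-1 * `|F * tau|.
  have i2n : `|2^-1| = 2^-1 :> R by rewrite ger0_norm// invr_ge0.
  apply: (le_trans (ler_normB _ _)); rewrite [`|_ * (F * _)|]normrM i2n lerD2r.
  apply: (le_trans (ler_normD _ _)); rewrite [`|_ * D|]normrM i2n lerD2r.
  by apply: (le_trans (ler_normD _ _)); rewrite [`|_ * (c - _)|]normrM i2n lerD2r.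
have n1 : 0 <= K * (r * eta ^+ 2) := mulr_ge0 K0 (mulr_ge0 r0 (sqr_ge0 _)).
lra.
Qed.

End one_step.

(** * Replacement of k separated blocks, one at a time *)

Section swap.
Context {d : measure_display} {T : measurableType d} {R : realType}.
Variables (P : probability T R) (X : int -> {RV P >-> R}).
Hypothesis Xstat : strictly_stationary X.
Hypothesis X_sqi : sqi P (X 0).
Hypothesis X_mean : Ex P (X 0) = 0.
Variables L p k : nat.
Let D := (L + p)%N.
Local Notation y := (blkN X id L).
Hypotheses (y0 : 0 < y) (k0 : (0 < k)%N).

Let midR : measurable_fun [set: R] (id : R -> R) := @measurable_id _ _ _.

(** In each period of length D the gap comes first: what is selected before step b lies below bD,
    and the next block starts at bD + p. *)
Definition big_idx (b : nat) : seq nat :=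
  flatten [seq iota (c * D + p) L | c <- iota 0 b].
Definition big_sum (b : nat) : T -> R := lsum X id (big_idx b) 0.

Lemma big_idxS b : big_idx b.+1 = big_idx b ++ iota (b * D + p) L.
Proof. by rewrite /big_idx -addn1 iotaD map_cat flatten_cat /= cats0. Qed.

Lemma big_idx_le b i : i \in big_idx b -> (i <= b * D)%N.
Proof.
elim: b => [//|b IHb]; rewrite big_idxS mem_cat => /orP[/IHb h|].
  by rewrite (leq_trans h)// leq_mul2r leqnSn orbT.
rewrite mem_iota => /andP[_ /ltnW h]; rewrite (leq_trans h)//.
by rewrite mulSn /D; clear; lia.
Qed.

Lemma big_sumS b w : big_sum b.+1 w = big_sum b w + blk X id (b * D + p) L w.
Proof. by rewrite /big_sum /blk /lsum big_idxS big_cat. Qed.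

Lemma big_sum0 w : big_sum 0 w = 0.
Proof. by rewrite /big_sum /lsum /big_idx big_nil. Qed.

Lemma sqi_big_sum b : sqi P (big_sum b).
Proof.
elim: b => [|b IHb].
  by rewrite (_ : big_sum 0 = fun=> 0); [exact: sqi_cst|apply/funext => w; exact: big_sum0].
rewrite (_ : big_sum b.+1 = fun w => big_sum b w + blk X id (b * D + p) L w).
  by apply: sqiD => //; exact: sqi_blk.
by apply/funext => w; exact: big_sumS.
Qed.

Lemma mixing_big (phi psi : R -> R) b :
  measurable_fun [set: R] phi -> measurable_fun [set: R] psi ->
  sqi P (fun w => phi (big_sum b w)) ->
  sqi P (fun w => psi (blk X id (b * D + p) L w)) ->
  `|Ex P (fun w => phi (big_sum b w) * psi (blk X id (b * D + p) L w)) -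
    Ex P (fun w => phi (big_sum b w)) * Ex P (fun w => psi (blk X id (b * D + p) L w))|
  <= rho X p * (N2 P (fun w => phi (big_sum b w)) *
                N2 P (fun w => psi (blk X id (b * D + p) L w))).
Proof.
move=> mphi mpsi; apply: (@mixing _ _ _ _ _ _ midR Xstat _ _ _ _ (b * D)%N) => //.
  exact: big_idx_le.
by move=> i; rewrite mem_iota => /andP[].
Qed.

(** Scales every block to variance 1/k. *)
Let kappa : R := (Num.sqrt k%:R * y)^-1.

Let kR0 : 0 < (k%:R : R). Proof. by rewrite ltr0n. Qed.
Let sk0 : 0 < Num.sqrt (k%:R : R). Proof. by rewrite sqrtr_gt0. Qed.
Let kappa0 : 0 < kappa. Proof. by rewrite invr_gt0 mulr_gt0. Qed.

Let A b w := kappa * big_sum b w.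
Let Y b w := kappa * blk X id (b * D + p) L w.

Let sA b : sqi P (A b). Proof. exact: sqiZ (sqi_big_sum b). Qed.
Let sY b : sqi P (Y b). Proof. exact: sqiZ (sqi_blk Xstat midR X_sqi _ _). Qed.
Let EY b : Ex P (Y b) = 0.
Proof.
rewrite /Y ExZ; last exact: sqi_ibl (sqi_blk Xstat midR X_sqi _ _).
by rewrite (Ex_blk Xstat midR X_sqi X_mean) mulr0.
Qed.

Let v : R := (Num.sqrt k%:R)^-1.
Let v0 : 0 < v. Proof. by rewrite invr_gt0. Qed.
Let v2 : v ^+ 2 = k%:R^-1. Proof. by rewrite exprVn sqr_sqrtr// ltW. Qed.

Let N2Y b : N2 P (Y b) = v.
Proof.
rewrite /Y (N2Z kappa (sqi_blk Xstat midR X_sqi (b * D + p) L)).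
rewrite (N2_blk Xstat midR) ger0_norm ?(ltW kappa0)// /kappa /v invfM -mulrA mulVf ?mulr1//.
by rewrite gt_eqF.
Qed.

Let mscale (f : R -> R) : measurable_fun [set: R] f ->
  measurable_fun [set: R] (fun x => f (kappa * x)).
Proof.
move=> mf; apply: (measurableT_comp mf).
by apply: measurable_funM.
Qed.

Let mixAY b (phi psi : R -> R) :
  measurable_fun [set: R] phi -> measurable_fun [set: R] psi ->
  sqi P (fun w => phi (A b w)) -> sqi P (fun w => psi (Y b w)) ->
  `|Ex P (fun w => phi (A b w) * psi (Y b w)) -
    Ex P (fun w => phi (A b w)) * Ex P (fun w => psi (Y b w))| <=
  rho X p * (N2 P (fun w => phi (A b w)) * N2 P (fun w => psi (Y b w))).
Proof. by move=> /mscale mphi /mscale mpsi; exact: (mixing_big mphi mpsi). Qed.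

Let AS b w : A b.+1 w = A b w + Y b w.
Proof. by rewrite /A /Y big_sumS mulrDr. Qed.

(** Every new block adds 1/k to the variance, and twice a covariance. For the latter the triangle
    inequality N2 (A b) <= b v is enough, as b v^2 <= 1. At the end |x - 1| <= |x^2 - 1| for x >=
    0. *)
Lemma N2_big_sum : `|N2 P (A k) - 1| <= 2 * k%:R * rho X p.
Proof.
have r0 := rho_ge0 X p; have v0' := ltW v0.
have H b : (b <= k)%N -> N2 P (A b) <= b%:R * v /\
    `|N2 P (A b) ^+ 2 - b%:R / k%:R| <= 2 * b%:R * rho X p.
  elim: b => [_|b IHb bk].
    have -> : N2 P (A 0) = 0.
      rewrite /N2; under [Ex P _]eq_Ex do rewrite /A big_sum0 mulr0 expr0n /=.
      by rewrite Ex_cst sqrtr0.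
    by rewrite !mul0r mulr0 mul0r expr0n subrr normr0.
  have [h1 h2] := IHb (ltnW bk).
  have e : A b.+1 = fun w => A b w + Y b w by apply/funext => w; exact: AS.
  split.
    rewrite e (le_trans (N2D (sA b) (sY b)))// N2Y -addn1 natrD mulrDl mul1r.
    by rewrite lerD2r.
  rewrite e N2_sqrD// N2Y v2.
  have m := mixAY midR midR (sA b) (sY b); rewrite EY mulr0 subr0 N2Y in m.
  have bv : N2 P (A b) * v <= 1.
    apply: (le_trans (ler_wpM2r v0' h1)); rewrite -mulrA -expr2 v2.
    by rewrite ler_pdivrMr// mul1r ler_nat ltnW.
  have m2 := le_trans m (ler_wpM2l r0 bv); rewrite mulr1 in m2.
  rewrite -addn1 natrD mulrDl mul1r.
  move: (Ex P (fun w => A b w * Y b w)) m2 h2 {m} => E m2 h2.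
  rewrite (_ : _ - _ = (N2 P (A b) ^+ 2 - b%:R / k%:R) + 2 * E); last by ring.
  apply: (le_trans (ler_normD _ _)); rewrite normrM [`|2|]ger0_norm//; lra.
have [_] := H k (leqnn _); rewrite divff ?gt_eqF// => h.
apply: le_trans h; rewrite (_ : _ ^+ 2 - 1 = (N2 P (A k) - 1) * (N2 P (A k) + 1)).
  by rewrite normrM ler_peMr// ger0_norm ?addr_ge0 ?N2_ge0// lerDr N2_ge0.
by ring.
Qed.

Section smooth.
Variables (eps a eta : R).
Hypotheses (eps0 : 0 < eps) (eta0 : 0 < eta).

(** Standard deviation of the Gaussian smoothing when b blocks are in place: its square decreases
    from 1 + eps^2 to eps^2 in steps of 1/k. *)
Let tt b : R := Num.sqrt (eps ^+ 2 + (k - b)%N%:R / k%:R).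

Let arg0 b : 0 <= eps ^+ 2 + (k - b)%N%:R / k%:R.
Proof. by rewrite addr_ge0 ?sqr_ge0// divr_ge0. Qed.

Let tt_ge b : eps <= tt b.
Proof.
rewrite -[leLHS](ger0_norm (ltW eps0)) -sqrtr_sqr ler_sqrt//.
by rewrite lerDl divr_ge0.
Qed.

Let tt_sqr b : tt b ^+ 2 = eps ^+ 2 + (k - b)%N%:R / k%:R.
Proof. exact: sqr_sqrtr. Qed.

Let tt_step b : (b < k)%N -> tt b ^+ 2 - tt b.+1 ^+ 2 = k%:R^-1.
Proof.
move=> bk; rewrite !tt_sqr !natrB// ?(ltnW bk)// -natr1.
by field; rewrite gt_eqF.
Qed.

Let tt_mono b : (b < k)%N -> tt b.+1 <= tt b.
Proof.
move=> bk; rewrite ler_sqrt//; rewrite lerD2l ler_wpM2r ?invr_ge0 ?ltW//.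
by rewrite ltr_nat ltn_sub2l.
Qed.

Let tau : R := N2 P (fun w => high (eta * Num.sqrt k%:R * y) (blk X id 0 L w)) ^+ 2.

Let tauE b : N2 P (fun w => high eta (Y b w)) ^+ 2 = kappa ^+ 2 * tau.
Proof.
have e x : high eta (kappa * x) = kappa * high (eta * Num.sqrt k%:R * y) x.
  rewrite /high normrM (ger0_norm (ltW kappa0)) /kappa mulrC.
  rewrite ltr_pdivlMr ?mulr_gt0// mulrA.
  by case: ifP => //; rewrite ?mulr0// mulrC.
rewrite !N2_sqr /tau N2_sqr -ExZ; last first.
  have s := sqi_blk Xstat midR X_sqi 0 L; apply: (ibl_le _ _ s.2).
    apply: measurable_funX; apply: (measurableT_comp (measurable_high _)).
    exact: measurable_blk.
  move=> w; rewrite ger0_norm ?sqr_ge0// -(real_normK (num_real (high _ _))).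
  by rewrite -(real_normK (num_real (blk X id 0 L w))) ler_sqr ?nnegrE// normr_high_le.
rewrite /Y; under [LHS]eq_Ex do rewrite e exprMn.
apply: (blk_Ex Xstat midR
  (phi := fun x => kappa ^+ 2 * high (eta * Num.sqrt k%:R * y) x ^+ 2)).
by apply: measurable_funM => //; apply: measurable_funX; exact: measurable_high.
Qed.

Let measurable_derive (f df : R -> R) : (forall t, is_derive t (1:R) f (df t)) ->
  measurable_fun [set: R] f.
Proof.
move=> fd; apply: continuous_measurable_fun => t.
by apply: differentiable_continuous; apply/derivable1_diffP; have [] := fd t.
Qed.

Lemma measurable_heat t : measurable_fun [set: R] (heat a t).
Proof. exact: measurable_derive (is_derive_heat a t). Qed.

Lemma heat_bd t x : `|heat a t x| <= 1.
Proof. by rewrite ger0_norm; [exact: Phi_le1|exact: Phi_ge0]. Qed.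

(** Adding a block changes the mean by v^2 / 2 times the mean of [heat2], up to [one_step]; lowering
    t^2 by v^2 = 1/k takes the same term away, up to [heat_estimate]. The k errors add up along a
    telescoping sum that starts from a constant, the value at 0 blocks. *)
Lemma swap (K : R) : 0 < K ->
  taylor_estimate eps a K -> heat_estimate eps a K ->
  `|Ex P (fun w => heat a eps (A k w)) - Phi (a / Num.sqrt (1 + eps ^+ 2))| <=
  K * (rho X p * k%:R + rho X p * k%:R * eta ^+ 2 + 2 * (tau / y ^+ 2) + eta + k%:R^-1).
Proof.
move=> K0 HK HT.
have r0 := rho_ge0 X p; have v0' := ltW v0; have e0 := eta0.
pose step := K * (rho X p * v + rho X p * eta ^+ 2 + 2 * (kappa ^+ 2 * tau) + eta * v ^+ 2)
  + K * (v ^+ 2) ^+ 2.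
have mh b : measurable_fun [set: R] (heat a (tt b)) by exact: measurable_heat.
have tn b : tt b != 0 by rewrite gt_eqF// (lt_le_trans eps0).
have mh1 b : measurable_fun [set: R] (heat1 a (tt b)).
  exact: measurable_derive (fun x => is_derive_heat1 a x (tn b)).
have mh2 b : measurable_fun [set: R] (heat2 a (tt b)).
  exact: measurable_derive (fun x => is_derive_heat2 a x (tn b)).
have ih b c : ibl P (fun w => heat a (tt b) (A c w)).
  apply: (@ibl_bounded _ _ _ _ _ 1) => [|w]; last exact: heat_bd.
  exact: (measurableT_comp (mh b) (sqi_meas (sA c))).
have ih2 b c : ibl P (fun w => heat2 a (tt b) (A c w)).
  apply: (@ibl_bounded _ _ _ _ _ K) => [|w].
    exact: (measurableT_comp (mh2 b) (sqi_meas (sA c))).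
  by have [] := HK (tt b) (A c w) 0 (tt_ge b).
have one b : (b < k)%N -> `|Ex P (fun w => heat a (tt b.+1) (A b.+1 w)) -
    Ex P (fun w => heat a (tt b) (A b w))| <= step.
  move=> bk.
  have h1 := @one_step _ _ _ P (A b) (Y b) (rho X p) (sqi_meas (sA b)) (sY b) (EY b)
    (mixAY (b := b)) (heat a (tt b.+1)) (heat1 a (tt b.+1)) (heat2 a (tt b.+1)) K eta
    (mh _) (mh1 _) (mh2 _) (heat_bd (tt b.+1))
    (fun x => let: And4 h _ _ _ := HK (tt b.+1) x 0 (tt_ge _) in h)
    (fun x => let: And4 _ h _ _ := HK (tt b.+1) x 0 (tt_ge _) in h)
    (fun x z => let: And4 _ _ h _ := HK (tt b.+1) x z (tt_ge _) in h)
    (fun x z => let: And4 _ _ _ h := HK (tt b.+1) x z (tt_ge _) in h) (ltW K0) eta0 r0.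
  rewrite N2Y tauE in h1.
  have h2 : `|Ex P (fun w => heat a (tt b) (A b w)) - Ex P (fun w => heat a (tt b.+1) (A b w))
      - 2^-1 * v ^+ 2 * Ex P (fun w => heat2 a (tt b.+1) (A b w))| <= K * (v ^+ 2) ^+ 2.
    rewrite -ExB// -ExZ//.
    have i1 := iblB (ih b b) (ih b.+1 b); have i2 := iblZ (2^-1 * v ^+ 2) (ih2 b.+1 b).
    rewrite -ExB// -[leRHS](Ex_cst P); apply: Ex_le_norm; [exact: iblB|exact: ibl_cst|].
    move=> w; have := HT (tt b.+1) (tt b) (A b w) (tt_ge _) (tt_mono bk).
    by rewrite tt_step// -v2 mulrAC.
  have -> : Ex P (fun w => heat a (tt b.+1) (A b.+1 w)) =
      Ex P (fun w => heat a (tt b.+1) (A b w + Y b w)).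
    by apply: eq_Ex => w; rewrite AS.
  move: h1 h2.
  move: (Ex P (fun w => heat a (tt b.+1) (A b w + Y b w)))
    (Ex P (fun w => heat a (tt b.+1) (A b w))) (Ex P (fun w => heat a (tt b) (A b w)))
    (_ * Ex P _) => E1 E2 E3 E4 h1 h2.
  rewrite (_ : E1 - E3 = (E1 - E2 - E4) - (E3 - E2 - E4)); last by ring.
  by apply: (le_trans (ler_normB _ _)); exact: lerD.
have tel b : (b <= k)%N -> `|Ex P (fun w => heat a (tt b) (A b w)) - heat a (tt 0) 0| <=
    b%:R * step.
  elim: b => [_|b IHb bk].
    rewrite mul0r (_ : Ex P _ = heat a (tt 0) 0) ?subrr ?normr0//.
    rewrite -[RHS](Ex_cst P); apply: eq_Ex => w; rewrite /A big_sum0 mulr0//.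
  rewrite -natr1 mulrDl mul1r [leRHS]addrC.
  rewrite (_ : _ - _ = (Ex P (fun w => heat a (tt b.+1) (A b.+1 w)) -
     Ex P (fun w => heat a (tt b) (A b w))) +
     (Ex P (fun w => heat a (tt b) (A b w)) - heat a (tt 0) 0)); last by ring.
  by apply: (le_trans (ler_normD _ _)); apply: lerD; [exact: one|exact: IHb (ltnW bk)].
have := tel k (leqnn _).
have -> : tt k = eps.
  by rewrite /tt subnn mul0r addr0 sqrtr_sqr ger0_norm// ltW.
have -> : heat a (tt 0) 0 = Phi (a / Num.sqrt (1 + eps ^+ 2)).
  by rewrite /heat subr0 /tt subn0 divff ?gt_eqF// addrC.
move/le_trans; apply.
have ky : k%:R * kappa ^+ 2 = (y ^+ 2)^-1.
  by rewrite /kappa exprVn exprMn (sqr_sqrtr (ltW kR0)) invfM mulrA divff ?mul1r// gt_eqF.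
have kv : k%:R * v <= k%:R.
  rewrite ler_piMr ?(ltW kR0)// invf_le1// -[leLHS]sqrtr1 ler_sqrt ?(ltW kR0)//.
  by rewrite ler1n.
rewrite [leLHS](_ : _ = K * (rho X p * (k%:R * v) + rho X p * k%:R * eta ^+ 2 +
  2 * (k%:R * kappa ^+ 2 * tau) + eta * (k%:R * v ^+ 2) + v ^+ 2 * (k%:R * v ^+ 2))); last first.
  by rewrite /step; ring.
rewrite ky v2 divff ?gt_eqF// !mulr1 [_^-1 * tau]mulrC ler_wpM2l ?(ltW K0)//.
by rewrite !lerD2r ler_wpM2l.
Qed.

End smooth.

Lemma N2_remainder rem :
  N2 P (fun w => kappa * blk X id 0 (k * D + rem) w - A k w) <=
  kappa * (k%:R * blkN X id p + blkN X id rem).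
Proof.
have s m n := sqi_blk Xstat midR X_sqi m n.
pose E b w := blk X id 0 (b * D) w - big_sum b w.
have sE b : sqi P (E b) by apply: sqiB => //; exact: sqi_big_sum.
have N2E b : N2 P (E b) <= b%:R * blkN X id p.
  elim: b => [|b IHb].
    rewrite mul0r /N2; under [Ex P _]eq_Ex do rewrite /E mul0n blk0 big_sum0 subrr expr0n/=.
    by rewrite Ex_cst sqrtr0.
  rewrite (_ : E b.+1 = fun w => E b w + blk X id (b * D) p w).
    rewrite (le_trans (N2D (sE b) (s _ _)))// (N2_blk Xstat midR) -natr1 mulrDl mul1r.
    by rewrite lerD2r.
  apply/funext => w; rewrite /E big_sumS (_ : (b.+1 * D = b * D + (p + L))%N).
    rewrite (blkD X id 0 (b * D) (p + L)) add0n (blkD X id (b * D) p L); ring.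
  by rewrite mulSn /D; clear; lia.
have sF : sqi P (fun w => E k w + blk X id (k * D) rem w) by exact: sqiD.
rewrite (_ : (fun w => _) = fun w => kappa * (E k w + blk X id (k * D) rem w)).
  rewrite N2Z// ger0_norm ?(ltW kappa0)// ler_wpM2l ?(ltW kappa0)//.
  apply: (le_trans (N2D (sE k) (s _ _))); rewrite (N2_blk Xstat midR) lerD2r.
  exact: N2E.
by apply/funext => w; rewrite /A /E (blkD X id 0 (k * D) rem) add0n; ring.
Qed.

(** The ratio of the two normalisations is read off the blocks: kappa times the sum of n terms
    differs from A k by gaps and remainder only, and A k has norm close to 1, so that kappa [blkN] n
    is close to 1 as well. *)
Lemma normalized_swap (eps a eta K : R) (rem : nat) : 0 < eps -> 0 < eta -> 0 < K ->
  taylor_estimate eps a K -> heat_estimate eps a K ->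
  0 < blkN X id (k * D + rem) ->
  `|Ex P (fun w => heat a eps (blk X id 0 (k * D + rem) w / blkN X id (k * D + rem))) -
    Phi (a / Num.sqrt (1 + eps ^+ 2))| <=
  K * (3 * (rho X p * k%:R) + rho X p * k%:R * eta ^+ 2 +
   2 * (N2 P (fun w => high (eta * Num.sqrt k%:R * y) (blk X id 0 L w)) ^+ 2 / y ^+ 2) +
   eta + k%:R^-1 +
   2 * ((k%:R * blkN X id p + blkN X id rem) / (Num.sqrt k%:R * y))).
Proof.
move=> eps0 eta0 K0 HK HT; set n := (k * D + rem)%N => sn0.
have sw := swap eps0 eta0 K0 HK HT.
have sb := sqi_blk Xstat midR X_sqi 0 n.
set e1 := (k%:R * blkN X id p + blkN X id rem) / (Num.sqrt k%:R * y).
pose U w := blk X id 0 n w / blkN X id n.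
have sU : sqi P U.
  by rewrite /U; under eq_fun do rewrite mulrC; exact: sqiZ.
have sKB : sqi P (fun w => kappa * blk X id 0 n w) by exact: sqiZ.
have h1 : N2 P (fun w => kappa * blk X id 0 n w - A k w) <= e1.
  by rewrite /e1 mulrC; exact: N2_remainder.
have h2 : `|kappa * blkN X id n - N2 P (A k)| <= e1.
  apply: le_trans h1; apply: le_trans (N2_dist sKB (sA k)).
  by rewrite N2Z// (ger0_norm (ltW kappa0)).
have h3 : `|1 - kappa * blkN X id n| <= e1 + 2 * (rho X p * k%:R).
  rewrite (_ : 1 - _ = (N2 P (A k) - kappa * blkN X id n) - (N2 P (A k) - 1)); last by ring.
  apply: (le_trans (ler_normB _ _)); apply: lerD; first by rewrite distrC.
  by apply: (le_trans N2_big_sum); rewrite -mulrA [k%:R * _]mulrC.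
have h4 : N2 P (fun w => U w - A k w) <= 2 * e1 + 2 * (rho X p * k%:R).
  have sD : sqi P (fun w => kappa * blk X id 0 n w - A k w) by exact: sqiB.
  have sUB : sqi P (fun w => U w - kappa * blk X id 0 n w) by exact: sqiB.
  rewrite (_ : (fun w => U w - A k w) = fun w => (U w - kappa * blk X id 0 n w) +
    (kappa * blk X id 0 n w - A k w)); last by apply/funext => w; ring.
  apply: (le_trans (N2D sUB sD)).
  have -> : N2 P (fun w => U w - kappa * blk X id 0 n w) = `|1 - kappa * blkN X id n|.
    rewrite (_ : (fun w => _) = fun w => ((1 - kappa * blkN X id n) / blkN X id n) * blk X id 0 n w).
      by rewrite N2Z// normrM normfV (ger0_norm (ltW sn0)) divfK ?gt_eqF.
    by apply/funext => w; rewrite /U; field; rewrite gt_eqF.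
  by move: h1 h3; lra.
have d1 s := is_derive_heat a eps s.
have lip := lipschitz_derive d1 (fun s => let: And4 h _ _ _ := HK eps s 0 (lexx _) in h).
have mh := measurable_heat a eps.
have iU : ibl P (fun w => heat a eps (U w)).
  apply: (@ibl_bounded _ _ _ _ _ 1) => [|w]; last exact: heat_bd.
  exact: (measurableT_comp mh (sqi_meas sU)).
have iA : ibl P (fun w => heat a eps (A k w)).
  apply: (@ibl_bounded _ _ _ _ _ 1) => [|w]; last exact: heat_bd.
  exact: (measurableT_comp mh (sqi_meas (sA k))).
have sUA : sqi P (fun w => U w - A k w) by exact: sqiB.
have h5 : `|Ex P (fun w => heat a eps (U w)) - Ex P (fun w => heat a eps (A k w))| <=
    K * (2 * e1 + 2 * (rho X p * k%:R)).
  rewrite -ExB//; apply: (@le_trans _ _ (Ex P (fun w => K * `|U w - A k w|))).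
    apply: Ex_le_norm; [exact: iblB|apply: iblZ; apply: ibl_norm; exact: sqi_ibl|].
    by move=> w; exact: lip.
  rewrite ExZ; last by apply: ibl_norm; exact: sqi_ibl.
  rewrite ler_wpM2l ?(ltW K0)//; apply: le_trans h4; exact: Ex_norm_le_N2.
move: sw h5; rewrite -/(U _).
move: (Ex P (fun w => heat a eps (A k w))) => E2 sw h5.
rewrite (_ : Ex P _ - _ = (Ex P (fun w => heat a eps (U w)) - E2) +
  (E2 - Phi (a / Num.sqrt (1 + eps ^+ 2)))); last by rewrite /U; ring.
apply: (le_trans (ler_normD _ _)); apply: (le_trans (lerD h5 sw)).
by rewrite le_eqVlt; apply/orP; left; apply/eqP; ring.
Qed.

End swap.

(** * Choice of the blocks and the limit of smoothed distribution functions *)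

Section smooth_clt.
Context {d : measure_display} {T : measurableType d} {R : realType}.
Variables (P : probability T R) (X : int -> {RV P >-> R}).
Hypothesis Xstat : strictly_stationary X.
Hypothesis rho0 : null_seq (rho X).
Hypothesis X_sqi : sqi P (X 0).
Hypothesis X_mean : Ex P (X 0) = 0.
Variable c : R.
Hypothesis c0 : 0 < c.
Local Notation y i := (blkN X id (2 ^ i)).
Local Notation b := (@b48 R).
Hypothesis yb : forall i, c * b ^+ (23 * i) <= y i.
Hypothesis blkN_gt0 : forall n, (0 < n)%N -> 0 < blkN X id n.
Hypothesis X_ui : forall e, 0 < e -> exists M N, 0 < M /\
  forall r, (N <= r)%N -> N2 P (fun w => high (M * y r) (blk X id 0 (2 ^ r) w)) ^+ 2 <=
    e * y r ^+ 2.

Let midR : measurable_fun [set: R] (id : R -> R) := @measurable_id _ _ _.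

Let quarter_gap (i : nat) : (2 ^ (i %/ 4) <= 2 ^ i)%N.
Proof. by rewrite leq_exp2l// leq_div. Qed.

(** The trivial bound 2^(i/4) <= b^(12i) for the gap against b^(23i): the quotient is
    O(b^(-11i)). *)
Let small_blocks : null_seq (fun i => blkN X id (2 ^ (i %/ 4)) / y i).
Proof.
have := null_seq_b48 (k := 11) isT (_ : 0 <= blkN X id 1 / c).
move=> /(_ (divr_ge0 (blkN_ge0 _ _ _) (ltW c0))) h e e0.
have [N HN] := h e e0; exists N => i /HN; apply: le_trans.
have b0 := @b48_gt0 R.
have y0 : 0 < y i by apply: blkN_gt0; rewrite expn_gt0.
have cb : 0 < c * b ^+ (23 * i) by rewrite mulr_gt0// exprn_gt0.
have h1 : blkN X id (2 ^ (i %/ 4)) <= b ^+ (12 * i) * blkN X id 1.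
  apply: (le_trans (blkN_le Xstat midR X_sqi _)); rewrite ler_wpM2r ?blkN_ge0//.
  by rewrite natrX exp2_b48 b48_le//; have := leq_trunc_div i 4; clear; lia.
apply: (@le_trans _ _ (b ^+ (12 * i) * blkN X id 1 / (c * b ^+ (23 * i)))).
  apply: ler_pM => //; rewrite ?blkN_ge0 ?invr_ge0 ?blkN_ge0//.
  by rewrite lef_pV2 ?posrE.
rewrite le_eqVlt; apply/orP; left; apply/eqP.
rewrite (_ : 23 * i = 12 * i + 11 * i)%N; last by clear; lia.
rewrite exprD exprVn -exprM.
have := exprn_gt0 (12 * i) b0; have := exprn_gt0 (11 * i) b0.
move: (b ^+ (12 * i)) (b ^+ (11 * i)) => u v v0 u0; field.
by rewrite !gt_eqF.
Qed.

Lemma high_sqr_anti (M1 M2 x : R) : M1 <= M2 -> high M2 x ^+ 2 <= high M1 x ^+ 2.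
Proof.
move=> M12; rewrite /high; case: ifP => h2; last by rewrite expr0n sqr_ge0.
by rewrite ifT// (le_lt_trans M12).
Qed.

Lemma smooth_clt (eps a e : R) : 0 < eps -> 0 < e -> exists N, forall n, (N <= n)%N ->
  `|Ex P (fun w => heat a eps (blk X id 0 n w / blkN X id n)) -
    Phi (a / Num.sqrt (1 + eps ^+ 2))| <= e.
Proof.
move=> eps0 e0.
have [K [K0 HK1 HK2]] := heat_estimates eps0 a.
(* All quantities in [normalized_swap] will be at most q, and 12 = 3 + 1 + 2 + 1 + 1 + 2 * 2 is the
   total of their coefficients. *)
pose q := e / (12 * K).
have q0 : 0 < q by rewrite divr_gt0// mulr_gt0.
pose eta := Num.min q 1.
have eta0 : 0 < eta by rewrite lt_min q0 ltr01.
have etaq : eta <= q by rewrite ge_min lexx.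
have eta1 : eta ^+ 2 <= 1 by rewrite expr_le1 ?(ltW eta0)// ge_min lexx orbT.
have [M [N1 [M0 HM]]] := X_ui q0.
have [C [C0 HC]] := blkN_short Xstat rho0 X_sqi X_mean c0 yb.
have [J HJ] : exists J, forall k, (2 ^ J <= k)%N ->
    [/\ k%:R^-1 <= q, M <= eta * Num.sqrt k%:R & C / Num.sqrt k%:R <= q].
  pose B := 1 + q^-1 + (M / eta) + (C / q).
  have qi0 : 0 < q^-1 by rewrite invr_gt0.
  have Me0 : 0 < M / eta by rewrite divr_gt0.
  have Cq0 : 0 < C / q by rewrite divr_gt0.
  have B1 : 1 <= B by rewrite /B; move: qi0 Me0 Cq0; lra.
  exists (Num.truncn (B ^+ 2)).+1 => k Jk.
  have Bk : B ^+ 2 <= k%:R.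
    apply: (le_trans (ltW (truncnS_gt _))); rewrite ler_nat.
    by apply: leq_trans Jk; exact: ltnW (ltn_expl _ _).
  have B0 : 0 < B by rewrite (lt_le_trans ltr01).
  have Bs : B <= Num.sqrt k%:R.
    rewrite -[leLHS](ger0_norm (ltW B0)) -sqrtr_sqr ler_sqrt//.

  have s0 : 0 < Num.sqrt (k%:R : R) by exact: lt_le_trans Bs.
  have BBk : B <= k%:R by apply: le_trans Bk; rewrite expr2 ler_peMr// ltW.
  have k0 : 0 < (k%:R : R) by exact: lt_le_trans BBk.
  split.
  - rewrite -[leRHS]invrK lef_pV2 ?posrE//; apply: le_trans BBk.
    by rewrite /B; move: Me0 Cq0; lra.
  - rewrite mulrC -ler_pdivrMr//; apply: le_trans Bs.
    by rewrite /B; move: qi0 Cq0; lra.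
  - rewrite ler_pdivrMr// mulrC -ler_pdivrMr//; apply: le_trans Bs.
    by rewrite /B; move: qi0 Me0; lra.
(* An upper bound for the number k of blocks: 2^(j+J+1) <= n < 2^(j+J+2) and L <= L + p <= 2L, where
   L = 2^j, give 2^J <= k <= 2^(J+2). So J, fixed by e, makes 1/k small, while k stays bounded as n
   grows. *)
pose A : R := 2 ^+ J.+2.
have A0 : 0 < A by rewrite exprn_gt0.
have qA0 : 0 < q / A by rewrite divr_gt0.
have [N2' HN2] := null_seq_gap_rho rho0 (isT : (0 < 1)%N) qA0.
have [N3 HN3] := small_blocks qA0.
pose N0 := (N1 + N2' + N3)%N.
exists (2 ^ (N0 + J.+1))%N => n Nn.
have n0 : (0 < n)%N by apply: leq_trans Nn; rewrite expn_gt0.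
pose t := trunc_log 2 n.
have /andP[tn nt] : (2 ^ t <= n < 2 ^ t.+1)%N by exact: trunc_log_bounds.
have Nt : (N0 + J.+1 <= t)%N.
  have := leq_ltn_trans Nn nt; rewrite ltn_exp2l//.
have [j tE] : exists j, t = (j + J.+1)%N.
  by exists (t - J.+1)%N; rewrite subnK// (leq_trans _ Nt)// leq_addl.
have Nj : (N0 <= j)%N by move: Nt; rewrite tE leq_add2r.
pose L := (2 ^ j)%N; pose p := (2 ^ (j %/ 4))%N.
have pL : (p <= L)%N by exact: quarter_gap.
have L0 : (0 < L)%N by rewrite expn_gt0.
have LD : (L <= L + p <= 2 ^ j.+1)%N by rewrite leq_addr pow2_double leq_add2l.
case/andP: LD => LD DL.
have D0 : (0 < L + p)%N by exact: leq_trans LD.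
pose k := (n %/ (L + p))%N.
have nE : n = (k * (L + p) + n %% (L + p))%N by exact: divn_eq.
have kJ : (2 ^ J <= k)%N.
  rewrite leq_divRL//; apply: leq_trans tn; rewrite tE.
  rewrite (_ : j + J.+1 = J + j.+1)%N; last by clear; lia.
  by rewrite expnD leq_mul2l DL orbT.
have kA : k%:R <= A.
  rewrite /A -natrX ler_nat ltnW// ltn_divLR//.
  apply: (leq_trans nt); rewrite tE (_ : (j + J.+1).+1 = J.+2 + j)%N; last by clear; lia.
  by rewrite expnD leq_mul2l LD orbT.
have k0 : (0 < k)%N by apply: leq_trans kJ; rewrite expn_gt0.
have [k1 k2 k3] := HJ k kJ.
have y0 : 0 < y j by exact: blkN_gt0.
have s0 : 0 < Num.sqrt (k%:R : R) by rewrite sqrtr_gt0 ltr0n.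
have sk : Num.sqrt k%:R <= (k%:R : R).
  rewrite -[X in _ <= X](@sqr_sqrtr _ k%:R)// expr2 ler_peMr ?(ltW s0)//.
  by rewrite -[leLHS]sqrtr1 ler_sqrt ?ltr0n// ler1n.
have := @normalized_swap _ _ _ P X Xstat X_sqi X_mean L p k y0 k0 eps a eta K
  (n %% (L + p)) eps0 eta0 K0 HK1 HK2.
rewrite -nE => /(_ (blkN_gt0 n0)) /le_trans; apply.
have r1 : rho X p * k%:R <= q.
  have /HN2 : (N2' <= j)%N by apply: leq_trans Nj; rewrite /N0; clear; lia.
  rewrite /gap_rho mul1n -/p => h.
  apply: (le_trans (ler_wpM2l (rho_ge0 _ _) kA)).
  by rewrite -ler_pdivlMr.
have r0 : 0 <= rho X p * k%:R by rewrite mulr_ge0// rho_ge0.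
have r2 : rho X p * k%:R * eta ^+ 2 <= q.
  by apply: le_trans r1; rewrite ler_piMr.
have r3 : N2 P (fun w => high (eta * Num.sqrt k%:R * y j) (blk X id 0 L w)) ^+ 2 / y j ^+ 2 <= q.
  rewrite ler_pdivrMr ?exprn_gt0//.
  have /HM : (N1 <= j)%N by apply: leq_trans Nj; rewrite /N0; clear; lia.
  apply: le_trans; rewrite !N2_sqr.
  have sb := sqi_blk Xstat midR X_sqi 0 L.
  have ih B : ibl P (fun w => high B (blk X id 0 L w) ^+ 2).
    apply: (sqi_le _ _ sb).2; last by move=> w; exact: normr_high_le.
    exact: (measurableT_comp (measurable_high B) (sqi_meas sb)).
  apply: le_Ex => // w; apply: high_sqr_anti.
  by rewrite ler_wpM2r// ltW.
have r4 : Num.sqrt k%:R * (blkN X id p / y j) <= q.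
  have /HN3 : (N3 <= j)%N by apply: leq_trans Nj; rewrite /N0; clear; lia.
  rewrite -/p => h; apply: (@le_trans _ _ (A * (q / A))).
    apply: ler_pM => //; rewrite ?(ltW s0) ?(le_trans sk kA)//.
    by rewrite divr_ge0 ?blkN_ge0.
  by rewrite mulrC divfK ?gt_eqF.
have r5 : blkN X id (n %% (L + p)) / (Num.sqrt k%:R * y j) <= q.
  apply: le_trans k3; rewrite ler_pdivrMr ?mulr_gt0// mulrA divfK ?gt_eqF//.
  by apply: HC; apply: leq_trans DL; rewrite ltn_mod.
have -> : (k%:R * blkN X id p + blkN X id (n %% (L + p))) / (Num.sqrt k%:R * y j) =
    Num.sqrt k%:R * (blkN X id p / y j) +
    blkN X id (n %% (L + p)) / (Num.sqrt k%:R * y j).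
  rewrite mulrDl; congr (_ + _).
  rewrite -{1}(@sqr_sqrtr _ (k%:R : R))//; field.
  by rewrite !gt_eqF.
rewrite [leRHS](_ : e = K * (12 * q)); last first.
  by rewrite /q; field; rewrite gt_eqF.
rewrite ler_wpM2l ?(ltW K0)//.
move: r1 r2 r3 r4 r5 etaq k1; rewrite /L.
move: (rho X p * k%:R) (rho X p * k%:R * eta ^+ 2) (N2 P _ ^+ 2 / _)
  (Num.sqrt _ * (_ / _)) (blkN X id (n %% _) / _) (k%:R^-1) => *; lra.
Qed.
End smooth_clt.

(** * From smoothed to actual distribution functions *)

Section gaussian_tails.
Context {R : realType}.

Let idTR : measurableTypeR R -> R := idfun.

#[local] HB.instance Definition _ :=
  @isMeasurableFun.Build _ _ _ _ idTR (@measurable_id _ _ [set: _]).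

Lemma Phi_tails (e : R) : 0 < e ->
  exists A, 0 < A /\ 1 - Phi A <= e /\ Phi (- A) <= e.
Proof.
move=> e0.
(* The identity, as a random variable under the normal law, exhibits Phi as a [cdf], whose limits at
   both infinities are known. *)
pose Z : {RV (normal_prob (0 : R) 1) >-> R} := idTR.
have cE x : cdf Z x = (Phi x)%:E by rewrite -PhiE.
have -> : @Phi R = fine \o cdf Z by apply/funext => x; rewrite -[RHS]/(fine (cdf Z x)) cE.
have h1 : (fine \o cdf Z) x @[x --> +oo] --> (1 : R) by exact: fine_cvg (cvg_cdfy1 Z).
have h0 : (fine \o cdf Z) x @[x --> -oo] --> (0 : R) by exact: fine_cvg (cvg_cdfNy0 Z).
have /cvgrPdist_le/(_ e e0) := h1; move=> [A1 [_ H1]].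
have /cvgrPdist_le/(_ e e0) := h0; move=> [A2 [_ H2]].
exists (1 + `|A1| + `|A2|); split; first by rewrite -addrA ltr_wpDr ?addr_ge0.
split.
  have := H1 (1 + `|A1| + `|A2|) _; move/(_ _)/(le_trans (ler_norm _)); apply.
  by rewrite /=; have := ler_norm A1; have := normr_ge0 A2; lra.
have := H2 (- (1 + `|A1| + `|A2|)) _; rewrite sub0r normrN => /(_ _)/(le_trans (ler_norm _)); apply.
by rewrite /=; have := ler_norm (- A2); rewrite normrN; have := normr_ge0 A1; lra.
Qed.

Lemma Phi_lipschitz : exists C : R, 0 < C /\ forall x y, `|Phi y - Phi x| <= C * `|y - x|.
Proof.
have [C [C0 HC]] := @gauss_moments R; exists C; split => //.
apply: (lipschitz_derive (@is_derive_Phi R)) => t.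
by have := HC t 0%N isT; rewrite expr0 mul1r ger0_norm// gauss_ge0.
Qed.

Lemma Phi_dilation (x e : R) : 0 < e -> exists eps0, 0 < eps0 /\
  forall A eps, `|A| * eps <= eps0 -> 0 < eps -> eps <= eps0 ->
  `|Phi ((x + A * eps) / Num.sqrt (1 + eps ^+ 2)) - Phi x| <= e.
Proof.
move=> e0; have [C [C0 HC]] := Phi_lipschitz.
exists (e / (C * (1 + `|x|))).
have x1 : 0 < 1 + `|x| by rewrite ltr_pwDl.
have q0 : 0 < e / (C * (1 + `|x|)) by rewrite divr_gt0// mulr_gt0.
split => // A eps Ae e1 e2; apply: (le_trans (HC _ _)).
set s := Num.sqrt _.
have a0 : 0 <= 1 + eps ^+ 2 by rewrite addr_ge0 ?sqr_ge0.
have s2 : s ^+ 2 = 1 + eps ^+ 2 by exact: sqr_sqrtr.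
have s0 : 0 <= s by exact: sqrtr_ge0.
have s1 : 1 <= s.
  by rewrite -(@ler_sqr _ 1 s) ?nnegrE// s2 expr1n lerDl sqr_ge0.
have s3 : s <= 1 + eps.
  rewrite -ler_sqr ?nnegrE ?addr_ge0 ?(ltW e1)// s2; have E1 := e1; nra.
have -> : (x + A * eps) / s - x = (A * eps - x * (s - 1)) / s.
  by field; rewrite gt_eqF// (lt_le_trans ltr01).
have h : `|(A * eps - x * (s - 1)) / s| <= (1 + `|x|) * (e / (C * (1 + `|x|))).
  rewrite normrM normfV (ger0_norm s0) ler_pdivrMr ?(lt_le_trans ltr01)//.
  apply: (@le_trans _ _ ((1 + `|x|) * (e / (C * (1 + `|x|))) * 1)).
    rewrite mulr1 mulrDl mul1r; apply: (le_trans (ler_normB _ _)); rewrite !normrM.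
    apply: lerD; first by rewrite (ger0_norm (ltW e1)).
    rewrite ler_wpM2l// ger0_norm ?subr_ge0//; lra.
  by rewrite ler_wpM2l// mulr_ge0 ?(ltW q0)// ltW.
apply: (le_trans (ler_wpM2l (ltW C0) h)).
by rewrite le_eqVlt; apply/orP; left; apply/eqP; field; rewrite !gt_eqF.
Qed.

End gaussian_tails.

Section smoothing.
Context {d : measure_display} {T : measurableType d} {R : realType}.
Variables (P : probability T R).

Lemma Ex_le_set (W : T -> R) (x : R) : measurable_fun [set: T] W ->
  ibl P (fun w => (W w <= x)%R%:R) /\
  Ex P (fun w => (W w <= x)%R%:R) = fine (P [set w | W w <= x]).
Proof.
move=> mW.
have mA : measurable [set w | W w <= x].
  by rewrite -[X in measurable X]setTI; apply: measurable_fun_le => //; exact: measurable_cst.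
have -> : (fun w => (W w <= x)%R%:R) = \1_[set w | W w <= x] :> (T -> R).
  by apply/funext => w; rewrite indicE; congr ((nat_of_bool _)%:R); apply/idP/idP; rewrite inE.
split.
  apply: (@ibl_bounded _ _ _ _ _ 1) => // w.
  by rewrite indicE; case: (_ \in _); rewrite ?normr1 ?normr0.
by rewrite Ex.unlock /Rintegral integral_indic// setIT.
Qed.

(** A shift by A standard deviations of the smoothing makes [heat] at least Phi(A) on W <= x and, in
    the other direction, at most Phi(-A) on W > x. *)
Lemma cdf_sandwich (W : T -> R) (x A eps : R) : measurable_fun [set: T] W ->
  0 < eps -> 
  fine (P [set w | W w <= x]) <=
    Ex P (fun w => heat (x + A * eps) eps (W w)) + (1 - Phi A) /\
  Ex P (fun w => heat (x + (- A) * eps) eps (W w)) <=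
    fine (P [set w | W w <= x]) + Phi (- A).
Proof.
move=> mW e0.
have [iI EI] := Ex_le_set x mW.
have ih a : ibl P (fun w => heat a eps (W w)).
  apply: (@ibl_bounded _ _ _ _ _ 1) => [|w]; last first.
    by rewrite ger0_norm; [exact: Phi_le1|exact: Phi_ge0].
  apply: (measurableT_comp _ mW); apply: continuous_measurable_fun => t.
  by apply: differentiable_continuous; apply/derivable1_diffP; have [] := is_derive_heat a eps t.
have P0 t := @Phi_ge0 R t; have P1 t := @Phi_le1 R t.
rewrite -EI; split.
  rewrite -[1 - _](Ex_cst P) -ExD//; last exact: ibl_cst.
  apply: le_Ex => // [|w]; first by apply: iblD => //; exact: ibl_cst.
  rewrite /heat; case: (leP (W w) x) => [Wx|_] /=; last by rewrite addr_ge0// subr_ge0.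

  have h : A <= (x + A * eps - W w) / eps by rewrite ler_pdivlMr//; lra.
  by have := Phi_mono h; lra.
rewrite -[Phi (- A)](Ex_cst P) -ExD//; last exact: ibl_cst.
apply: le_Ex => // [|w]; first by apply: iblD => //; exact: ibl_cst.
rewrite /heat; case: (leP (W w) x) => [_|Wx] /=; first by have := P1 ((x + - A * eps - W w) / eps); have := P0 (- A); lra.
have h : (x + - A * eps - W w) / eps <= - A by rewrite ler_pdivrMr//; lra.
by have := Phi_mono h; lra.
Qed.

Lemma cdf_cvg (W : nat -> T -> R) : (forall n, measurable_fun [set: T] (W n)) ->
  (forall eps a e, 0 < eps -> 0 < e -> exists N, forall n, (N <= n)%N ->
    `|Ex P (fun w => heat a eps (W n w)) - Phi (a / Num.sqrt (1 + eps ^+ 2))| <= e) ->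
  forall x e, 0 < e -> exists N, forall n, (N <= n)%N ->
    `|fine (P [set w | W n w <= x]) - Phi x| <= e.
Proof.
move=> mW HW x e e0.
have e3 : 0 < e / 3 by rewrite divr_gt0.
have [A [A0 [A1 A2]]] := Phi_tails e3.
have [q [q0 Hq]] := Phi_dilation x e3.
(* A is already fixed by the tails; both eps and A eps must stay below q for [Phi_dilation]. *)
pose eps := q / (1 + A).
have A10 : 0 < 1 + A by rewrite addr_gt0.
have eps0 : 0 < eps by rewrite divr_gt0.
have epsq : eps <= q by rewrite ler_pdivrMr// ler_peMr ?(ltW q0)// lerDl ltW.
have Aq : A * eps <= q.
  by rewrite /eps mulrCA ler_piMr ?(ltW q0)// ler_pdivrMr// mul1r lerDr.
have [N1 H1] := HW eps (x + A * eps) _ eps0 e3.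
have [N2 H2] := HW eps (x + (- A) * eps) _ eps0 e3.
exists (N1 + N2)%N => n Nn.
have {}H1 := H1 n (leq_trans (leq_addr _ _) Nn).
have {}H2 := H2 n (leq_trans (leq_addl _ _) Nn).
have [S1 S2] := cdf_sandwich x A (mW n) eps0.
have An : `|A| * eps <= q by rewrite (ger0_norm (ltW A0)).
have An' : `|- A| * eps <= q by rewrite normrN.
have D1 := Hq _ _ An eps0 epsq; have D2 := Hq _ _ An' eps0 epsq.
move: H1 H2 S1 S2 D1 D2 A1 A2; rewrite !ler_norml.
move: (Ex P _) (Ex P _) (fine _) (Phi (_ / _)) (Phi (_ / _)) (Phi x) (Phi A) (Phi (- A)) => *.
by apply/andP; split; lra.
Qed.

End smoothing.

(** * The limit theorem *)

Lemma powRN_anti {R : realType} (x y t : R) : 0 < x -> x <= y -> 0 <= t ->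
  y `^ (- t) <= x `^ (- t).
Proof.
move=> x0 xy t0; rewrite !powRN lef_pV2 ?posrE ?powR_gt0//.
  by apply: ler_powRl => //; exact: ltW.
exact: lt_le_trans xy.
Qed.

(** * The truncation level and its divergence *)

Section truncation_level.
Context {R : realType}.
Variables (delta : R) (g : R -> R) (H D : nat -> R).
Hypotheses (hdelta0 : 0 < delta) (hdelta1 : delta < 1).
Hypothesis g_ge0 : forall x : R, 0 <= x -> 0 <= g x.
Hypothesis g_ndecr : forall x y : R, 0 <= x -> x <= y -> g x <= g y.
Hypotheses (H1 : forall r, 1 <= H r) (D1 : forall r, 1 <= D r).
Hypothesis D_mono : forall r s, (r <= s)%N -> D r <= D s.
Hypothesis H_small : forall e, 0 < e -> exists C, 0 < C /\
  forall n, H n <= C * expR (e * n%:R).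

Definition level (r : nat) : R :=
  Num.sqrt (2 ^ r)%N%:R * (H r * D r `^ ((2 + delta) / 4)) `^ (- delta^-1).

Hypothesis D_g : exists Cg N, 0 < Cg /\ forall r, (N <= r)%N -> D r <= Cg * g (level r).

Lemma level_ge0 r : 0 <= level r.
Proof. by rewrite mulr_ge0 ?sqrtr_ge0 ?powR_ge0. Qed.

Let H0 r : 0 < H r. Proof. exact: lt_le_trans (H1 r). Qed.
Let D0 r : 0 < D r. Proof. exact: lt_le_trans (D1 r). Qed.
Let E0 : 0 < (2 + delta) / 4. Proof. by rewrite divr_gt0// addr_gt0. Qed.

Lemma level_le r : 0 <= level r /\
  level r `^ (delta / 2) <= (2 ^+ r) `^ (delta / 4) * (H r `^ 2^-1)^-1.
Proof.
split; first exact: level_ge0.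
rewrite /level natrX -powR12_sqrt ?exprn_ge0//.
set K := H r * _; rewrite (powRM _ (powR_ge0 _ _) (powR_ge0 _ _)) -!powRrM.
have -> : 2^-1 * (delta / 2) = delta / 4 by field.
have -> : - delta^-1 * (delta / 2) = - 2^-1 by field; rewrite gt_eqF.
rewrite -powRN ler_wpM2l ?powR_ge0//; apply: powRN_anti => //.
rewrite ler_peMr ?(ltW (H0 r))//.
by rewrite -[leLHS](powRr0 (D r)) ler_powR// ltW.
Qed.

Let level_bounded (C : R) : (forall r, D r <= C) ->
  forall B, exists N, forall r, (N <= r)%N -> B < level r.
Proof.
move=> DC B; have l2 := @ln2_gt0 R.
(* Raised to the power -1/delta, exp(delta ln 2 / 4 r) becomes 2^(-r/4); the factor 2^(r/2) of the
   level leaves 2^(r/4) = b^(12r). *)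
have e0 : 0 < delta * (ln 2 / 4) by rewrite mulr_gt0// divr_gt0.
have [C1 [C10 HC]] := H_small e0.
have C0 : 0 < C by exact: lt_le_trans (DC 0%N).
pose k := C1 * C `^ ((2 + delta) / 4).
have k0 : 0 < k by rewrite mulr_gt0// powR_gt0.
have kp : 0 < k `^ (- delta^-1) by exact: powR_gt0.
have low r : k `^ (- delta^-1) * @b48 R ^+ (12 * r) <= level r.
  have -> : k `^ (- delta^-1) * @b48 R ^+ (12 * r) =
      Num.sqrt (2 ^ r)%N%:R * (k * expR (delta * (ln 2 / 4) * r%:R)) `^ (- delta^-1).
    rewrite (powRM _ (ltW k0) (expR_ge0 _)) -expRM mulrCA; congr (_ * _).
    rewrite (_ : _ * - delta^-1 = - ((12 * r)%N%:R / 48 * ln 2)); last first.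
      by rewrite natrM; field; rewrite gt_eqF.
    rewrite expRN expR_ln2_48 natrX exp2_b48 (_ : 48 * r = 24 * r * 2)%N; last by rewrite mulnAC.
    rewrite (exprM _ (24 * r) 2) sqrtr_sqr ger0_norm ?exprn_ge0 ?(ltW (@b48_gt0 R))//.
    rewrite (_ : 24 * r = 12 * r + 12 * r)%N; last by rewrite -mulnDl.
    by rewrite exprD mulfK// gt_eqF// exprn_gt0// b48_gt0.
  apply: ler_wpM2l; first exact: sqrtr_ge0.
  apply: powRN_anti; last by rewrite invr_ge0 ltW.
    exact: mulr_gt0 (H0 r) (powR_gt0 _ (D0 r)).
  rewrite /k mulrAC; apply: ler_pM; rewrite ?powR_ge0 ?(ltW (H0 r))//.
  by apply: ler_powRl; rewrite ?(ltW E0) ?(ltW (D0 r)).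
have B0 : 0 < 1 + `|B| by rewrite ltr_pwDl.
have [N HN] := null_seq_b48 (k := 12) isT (@ler01 R) (divr_gt0 kp B0).
exists N => r Nr; apply: lt_le_trans (low r).
have := HN r Nr.
rewrite mul1r exprVn -exprM => h.
have bp := exprn_gt0 (12 * r) (@b48_gt0 R).
apply: (@lt_le_trans _ _ (1 + `|B|)); first by rewrite ltr_pwDl// ler_norm.
move: h; rewrite ler_pdivlMr// mulrC ler_pdivrMr//.
Qed.

(** For bounded D the level is 2^(r/2) over a subexponential factor. For unbounded D the growth
    condition itself forces it up: at a level at most B, D r <= Cg g(|B|), which fails for large r
    as D is monotone. This dichotomy avoids an upper estimate of [h_d]. *)
Lemma level_infty B : exists N, forall r, (N <= r)%N -> B < level r.
Proof.
have [[C DC]|unb] := pselect (exists C, forall r, D r <= C); first exact: level_bounded DC B.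
have [Cg [N [Cg0 HN]]] := D_g.
have [M HM] : exists M, Cg * g `|B| < D M.
  apply: contrapT => h; apply: unb; exists (Cg * g `|B|) => r.
  by rewrite leNgt; apply/negP => hr; apply: h; exists r.
exists (N + M)%N => r NMr; rewrite ltNge; apply/negP => lB.
have h1 := HN r (leq_trans (leq_addr _ _) NMr).
have h2 := D_mono (leq_trans (leq_addl N M) NMr).
have h3 : g (level r) <= g `|B|.
  by apply: g_ndecr; [exact: level_ge0|apply: (le_trans lB); exact: ler_norm].
have := le_lt_trans (le_trans h1 (ler_wpM2l (ltW Cg0) h3)) HM.
by rewrite ltNge h2.
Qed.
End truncation_level.

Section instance.
Context {d : measure_display} {T : measurableType d} {R : realType}.
Variables (P : probability T R) (X : int -> {RV P >-> R}).

Lemma ibl_expectation (f : T -> R) : measurable_fun [set: T] f ->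
  (forall w, 0 <= f w) -> ('E_P[f] < +oo)%E -> ibl P f.
Proof.
move=> mf f0; rewrite unlock => h; apply/integrableP; split; first exact/measurable_EFinP.
by under eq_integral do rewrite gee0_abs ?lee_fin//.
Qed.

Lemma ExE (f : T -> R) : Ex P f = fine 'E_P[f].
Proof. by rewrite Ex.unlock unlock. Qed.

Lemma partial_sumE n w : partial_sum X n w = blk X id 1 n w.
Proof.
rewrite /partial_sum mfun_sum /blk /lsum /index_iota subn1.
by apply: eq_bigr => i _; rewrite addr0.
Qed.

Hypothesis Xstat : strictly_stationary X.
Hypothesis X_sqi : sqi P (X 0).
Hypothesis X_mean : Ex P (X 0) = 0.
Let midR : measurable_fun [set: R] (id : R -> R) := @measurable_id _ _ _.

Lemma sigmaE n : sigma X n = blkN X id n.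
Proof.
rewrite -(N2_blk Xstat midR 1) /sigma /N2 /variance fine_covariance; congr (Num.sqrt _).
have e : partial_sum X n = blk X id 1 n :> (T -> R).
  by apply/funext => w; exact: partial_sumE.
by rewrite e (Ex_blk Xstat midR X_sqi X_mean); apply: eq_Ex => w; rewrite subr0 expr2.
Qed.

End instance.

Theorem theorem2p2 (R : realType) (d : measure_display) (T : measurableType d)
    (P : probability T R) (X : int -> {RV P >-> R})
    (delta : R) (g : R -> R)
    (eps1 eps2 c2 : R) (q0 : nat -> R) (k0 : nat)
    (hdelta0 : 0 < delta) (hdelta1 : delta < 1)
    (g_ge0 : forall x : R, 0 <= x -> 0 <= g x)
    (g_ndecr : forall x y : R, 0 <= x -> x <= y -> g x <= g y)
    (X_stat : strictly_stationary X)
    (X_mean : ('E_P[X 0%R] = 0)%E)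
    (X_sq : ('E_P[(fun w => X 0 w ^+ 2)%R] < +oo)%E)
    (sigma_infty : sigma X n @[n --> \oo] --> +oo)
    (rho_cvg0 : rho X n @[n --> \oo] --> (0 : R))
    (heps1 : 0 < eps1) (heps12 : eps1 < eps2) (heps2 : eps2 < 1)
    (hc2 : 0 < c2)
    (hsigma : forall n : nat, (1 <= n)%N ->
       n%:R * lower_h (rho X) eps1 eps2 c2 n <= sigma X n ^+ 2)
    (hq0 : admissible_q0 q0)
    (hk0 : (0 < k0)%N)
    (hrho : forall k : nat, (k0 <= k)%N ->
       rho X (two_star (rho X) eps1 eps2 c2 q0 k) < 1)
    (X_moment : ('E_P[(fun w => X 0 w ^+ 2 * g `|X 0 w|)%R] < +oo)%E)
    (g_growth :
       (h_d (rho X) eps1 eps2 c2 q0 k0 : nat -> R^o) =O_\oo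
       ((fun n : nat =>
          g (Num.sqrt n%:R *
             (h_delta (rho X) delta n *
              h_d (rho X) eps1 eps2 c2 q0 k0 n `^ ((2 + delta) / 4))
               `^ (- delta^-1))) : nat -> R^o)) :
  cvg_in_distribution (normalized_sum X) (normal_prob 0 1).
Proof.
have midR : measurable_fun [set: R] (id : R -> R) := @measurable_id _ _ _.
have mX0 : measurable_fun [set: T] (X 0) by exact: measurable_funPT.
have sX : sqi P (X 0).
  split => //; apply: ibl_expectation => //; first exact: measurable_funX.
  by move=> w; exact: sqr_ge0.
have EX : Ex P (X 0) = 0 by rewrite ExE X_mean.
have sE := sigmaE X_stat sX EX.
have rho0 : null_seq (rho X).
  move=> e e0; have /cvgrPdist_le/(_ e e0)[N _ HN] := rho_cvg0.
  by exists N => n /HN /=; rewrite sub0r normrN; exact/le_trans/ler_norm.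
have r0 := rho_ge0 X; have r1 := rho_le1 X.
have ra : forall m n, (m <= n)%N -> rho X n <= rho X m by move=> m n; exact: rho_anti.
have l0 n : 0 < lower_h (rho X) eps1 eps2 c2 n by rewrite mulr_gt0// expR_gt0.
have bN n : (0 < n)%N -> 0 < blkN X id n.
  move=> n0; have := hsigma n n0; rewrite sE => h.
  rewrite lt_neqAle blkN_ge0 andbT eq_sym; apply/eqP => z; move: h.
  by rewrite z expr0n /= leNgt mulr_gt0// ltr0n.
have [c [c0 yb0]] := lower_h_bound r0 rho0 heps1 heps12 heps2 hc2.
have yb i : c * @b48 R ^+ (23 * i) <= blkN X id (2 ^ i).
  have h2 : 0 <= c * @b48 R ^+ (23 * i).
    by rewrite mulr_ge0 ?exprn_ge0 ?(ltW c0) ?(ltW (@b48_gt0 R)).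
  rewrite -ler_sqr ?nnegrE ?blkN_ge0// -sE; apply: (le_trans (yb0 i)).
  by apply: hsigma; rewrite expn_gt0.
have Xm : ibl P (fun w => X 0 w ^+ 2 * g `|X 0 w|).
  apply: ibl_expectation => // [|w]; last by rewrite mulr_ge0 ?sqr_ge0// g_ge0.
  apply: measurable_funM; first exact: measurable_funX.
  (* The function g is monotone on [0, oo) only; composed with max(x, 0) it is monotone on the whole
     line, hence measurable. *)
  rewrite (_ : (fun _ => _) = (fun x => g (Num.max x 0)) \o (fun w => `|X 0 w|)); last first.
    by apply/funext => w /=; rewrite max_l.
  apply: measurableT_comp; last exact: measurableT_comp mX0.
  apply: nondecreasing_measurable => // x y xy; apply: g_ndecr.
    by rewrite le_max lexx orbT.
  by rewrite ge_max !le_max xy lexx orbT.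
pose hd r := h_d (rho X) eps1 eps2 c2 q0 k0 (2 ^ r)%N.
pose hdel r := h_delta (rho X) delta (2 ^ r)%N.
pose lev := level delta hdel hd.
have hd1 r : 1 <= hd r by exact: h_d_ge1.
have hd_mono r s : (r <= s)%N -> hd r <= hd s by exact: h_d_mono.
have hdel1 r : 1 <= hdel r by exact: h_delta_ge1.
have [CG [CG0 hd_lower]] := h_d_lower r0 ra heps2 hc2 hq0 hrho.
have hd_g : exists Cg N, 0 < Cg /\ forall r, (N <= r)%N -> hd r <= Cg * g (lev r).
  move/eqO_exP: g_growth => [Cg Cg0 [N _ HN]]; exists Cg, N; split => // r Nr.
  (* The growth condition is read along n = 2^r, where r >= N implies 2^r >= N. *)
  have := HN (2 ^ r)%N (leq_trans Nr (ltnW (ltn_expl r (isT : (1 < 2)%N)))).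
  rewrite -/(hd r) -/(hdel r) -/(level delta hdel hd r) -/(lev r).
  move=> h; apply: (le_trans (le_trans (ler_norm _) h)).
  by rewrite [X in _ * X <= _]ger0_norm// g_ge0// level_ge0.
have [Cg [Ng [Cg0 Hg]]] := hd_g.
have hsmall := fun e (e0 : 0 < e) => h_delta_small r0 rho0 hdelta0 e0.
have linf := level_infty hdelta0 g_ndecr hdel1 hd1 hd_mono hsmall hd_g.
have ui := uniformly_integrable X_stat rho0 sX EX c0 yb hdelta0 hdelta1 g_ge0 g_ndecr Xm
  hd1 hd_mono CG0 hd_lower Cg0 Hg linf hdel1 (level_le hdelta0 hdel1 hd1)
  (fun D (D0 : 0 <= D) => h_delta_dominates r0 r1 ra rho0 hdelta0 hdelta1 D0).
have clt := smooth_clt X_stat rho0 sX EX c0 yb bN ui.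
move=> x _.
have nE n : normalized_sum X n = (fun w => blk X id 1 n w / blkN X id n) :> (T -> R).
  by apply/funext => w; rewrite /= partial_sumE sE mulrC.
have cv := @cdf_cvg _ _ _ P (fun n => normalized_sum X n) _ _ x.
rewrite PhiE.
apply/fine_cvgP; split.
  by apply: nearW => n; rewrite fin_num_measure.
apply/cvgrPdist_le => e e0; have [|eps a e' eps0 e'0|N HN] := cv _ _ e e0.
- by move=> n; exact: measurable_funPT.
- have [N HN] := clt eps a e' eps0 e'0; exists N => m /HN.
  (* The sum starts at time 1 and the block in [smooth_clt] at time 0; stationarity identifies their
     laws. *)
  rewrite nE (blk_Ex X_stat midR 1 m (phi := fun y => heat a eps (y / blkN X id m)))//.
  apply: measurableT_comp; [exact: measurable_heat|exact: measurable_funM].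
by exists N => // n /HN; rewrite distrC.
Qed.
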